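(* Let $(p_d)_{d\in\mathbb{N}}$ be a strictly increasing and unbounded sequence in $(0,\infty)$ and let $(m_d)_{d\in\mathbb{N}}$ be a non-decreasing and unbounded sequence in $\mathbb{N}$. Choose $\alpha\in(0,1)$ and fix an array $\mathcal{A} = \{\alpha_{j,d}\in(0,1): d\in\mathbb{N},\ j=1,\dots,m_d\}$ such that, for an unbounded set $\mathbb{M}\subseteq\mathbb{N}$, it holds that $$\sum_{j=1}^{m_d}\alpha_{j,d} = \alpha \ \text{ for every } d\in\mathbb{N},\qquad \lim_{d\to\infty}\alpha_{m_d,d}>0,\qquad \lim_{d\to\infty}\alpha_{j,d}>0 \ \text{ for every } j\in\mathbb{M},$$ where the conditions implicitly impose the existence of the respective limits. For every $d\in\mathbb{N}$ and every $j=1,\dots,m_d$, choose $\kappa_{j,d}>0$ and $c_d\in(0,1]$ such that $$\mathbb{P}(\|\boldsymbol{\varepsilon}_d\|_{p_j}\ge\kappa_{j,d}) = \alpha_{j,d}\quad\text{and}\quad \mathbb{E}(\psi_d(\boldsymbol{\varepsilon}_d)) = \alpha,\quad\text{where}\quad \psi_d(\cdot) := \mathbf{1}\Big\{\max_{j=1,\dots,m_d}\kappa_{j,d}^{-1}\|\cdot\|_{p_j}\ge c_d\Big\}.$$ Then the following statements hold: 1. The sequence of tests $\psi_d$ has asymptotic size $\alpha$ and satisfies $\mathscr{C}(\{p,\kappa_d\})\subseteq\mathscr{C}(\psi_d)$ for every $p\in(0,\infty)$ and every $\{p,\kappa_d\}\in\mathbb{T}_\alpha$. 2. Under the additional condition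 that $\liminf_{d\to\infty} \frac{p_{m_d}}{\log(d)}>2$, it furthermore holds that $\mathscr{C}(\{\infty,\kappa_d\})\subseteq\mathscr{C}(\psi_d)$ for every $\{\infty,\kappa_d\}\in\mathbb{T}_\alpha$.
   Context: Let $\varepsilon_1,\varepsilon_2,\dots$ be i.i.d. standard normal random variables and $\boldsymbol{\varepsilon}_d = (\varepsilon_1,\dots,\varepsilon_d)$. A (sequence of) test(s) is a sequence $\varphi_d$, $d\in\mathbb{N}$, of Borel measurable functions $\varphi_d:\mathbb{R}^d \to [0,1]$; it has asymptotic size $\alpha\in[0,1]$ if $\lim_{d\to\infty}\mathbb{E}(\varphi_d(\boldsymbol{\varepsilon}_d)) = \alpha$, and $\mathbb{T}_\alpha$ denotes the set of all sequences of tests with asymptotic size $\alpha$. Let $\boldsymbol{\Theta} := \prod_{d=1}^\infty \mathbb{R}^d$ be the set of all triangular arrays $\boldsymbol{\vartheta} = \{\boldsymbol{\theta}_d: d\in\mathbb{N}\}$, $\boldsymbol{\theta}_d\in\mathbb{R}^d$. The consistency set $\mathscr{C}(\varphi_d)\subseteq\boldsymbol{\Theta}$ of a sequence of tests $\varphi_d$ is the set of all $\boldsymbol{\vartheta}\in\boldsymbol{\Theta}$ with $\lim_{d\to\infty}\mathbb{E}(\varphi_d(\boldsymbol{\theta}_d+\boldsymbol{\varepsilon}_d)) = 1$. For $\boldsymbol{x}\in\mathbb{R}^d$, $\|\boldsymbol{x}\|_p := (\sum_{i=1}^d |x_i|^p)^{1/p}$ if $p\in(0,\infty)$ (also for $p<1$)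 and $\|\boldsymbol{x}\|_\infty := \max_{i}|x_i|$. For $p\in(0,\infty]$ and a sequence of real critical values $\kappa_d$, $\{p,\kappa_d\}$ denotes the sequence of tests $\mathbf{1}\{\|\cdot\|_p \ge \kappa_d\}$. *)

(* Defs.v *)
From HB Require Import structures.
From mathcomp Require Export all_boot all_order all_algebra.
From mathcomp Require Export all_classical all_reals all_analysis.

Set Implicit Arguments.
Unset Strict Implicit.
Unset Printing Implicit Defensive.

Import Order.TTheory GRing.Theory Num.Theory.
Import numFieldNormedType.Exports.

Local Open Scope classical_set_scope.
Local Open Scope ring_scope.

(* Sequences are indexed by nat, but mathematically by d = 1, 2, ...; their
   entry at index 0 is junk and is left unconstrained everywhere. *)

Definition array (R : realType) := forall d : nat, 'rV[R]_d.

Definition mutually_independent d (T : measurableType d) (R : realType)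
    (P : probability T R) (X : nat -> {RV P >-> R}) : Prop :=
  forall (s : seq nat) (B : nat -> set R), uniq s ->
    (forall i, measurable (B i)) ->
    P (\bigcap_(i in [set` s]) (X i @^-1` B i)) =
    (\prod_(i <- s) P (X i @^-1` B i))%E.

Definition iid_std_normal d (T : measurableType d) (R : realType)
    (P : probability T R) (eps : nat -> {RV P >-> R}) : Prop :=
  mutually_independent eps /\
  forall i (A : set R), measurable A ->
    distribution P (eps i) A = normal_prob 0 1 A.

(* The coordinates of the noise vector are eps 0, ..., eps (n - 1). *)
Definition noise d (T : measurableType d) (R : realType)
    (P : probability T R) (eps : nat -> {RV P >-> R}) (n : nat) (w : T) :
    'rV[R]_n :=
  \row_(i < n) eps i w.

(* Borel measurability on R^n: sigma-algebra generated by the open sets. *)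
Definition borel_fun (R : realType) (n : nat) (f : 'rV[R]_n -> R) : Prop :=
  measurable_fun [set: g_sigma_algebraType (@open 'rV[R]_n)]
    (f : g_sigma_algebraType (@open 'rV[R]_n) -> R).

Definition test_seq (R : realType) := forall n : nat, 'rV[R]_n -> R.

Definition is_test_seq (R : realType) (phi : test_seq R) : Prop :=
  forall n, (0 < n)%N ->
    borel_fun (phi n) /\ forall x : 'rV[R]_n, 0 <= phi n x <= 1.

Definition tests_of_size d (T : measurableType d) (R : realType)
    (P : probability T R) (eps : nat -> {RV P >-> R}) (a : R) :
    set (test_seq R) :=
  [set phi | is_test_seq phi /\
    ('E_P[fun w => (phi n (noise eps n w))%R])%E @[n --> \oo] --> a%:E].

Definition consistency_set d (T : measurableType d) (R : realType)
    (P : probability T R) (eps : nat -> {RV P >-> R}) (phi : test_seq R) :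
    set (array R) :=
  [set theta |
    ('E_P[fun w => (phi n (theta n + noise eps n w))%R])%E @[n --> \oo]
      --> 1%:E].

(* The value at -oo is junk. *)
Definition pnorm (R : realType) (n : nat) (p : \bar R) (x : 'rV[R]_n) : R :=
  match p with
  | r%:E => (\sum_(i < n) `|x 0 i| `^ r) `^ r^-1
  | +oo%E => \big[Num.max/0]_(i < n) `|x 0 i|
  | -oo%E => 0
  end.

Definition pnorm_test (R : realType) (p : \bar R) (kappa : nat -> R) :
    test_seq R :=
  fun n x => (kappa n <= pnorm p x)%R%:R.

Definition max_pnorm_test (R : realType) (p : nat -> R) (m : nat -> nat)
    (kappa : nat -> nat -> R) (c : nat -> R) : test_seq R :=
  fun n x =>
    (c n <= \big[Num.max/0]_(1 <= j < (m n).+1)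
              ((kappa j n)^-1 * pnorm (p j)%:E x))%R%:R.

Arguments pnorm_test {R} p kappa n x.
Arguments max_pnorm_test {R} p m kappa c n x.

(* Main.v *)
(* Since c_d <= 1, psi_d rejects whenever one of its constituent tests
   {p_j, kappa_j} does, so for each competing test it suffices to find one
   constituent which is consistent wherever the competitor is.

   Finite exponent q.  Take j in M with p = p_j >= max(2, 2q), and let D be the
   sum over the coordinates of theta of theta_i^2 + |theta_i|^p.  By Chebyshev's
   inequality both critical values, raised to the power of the exponent, are
   within O(sqrt d) of the respective null means.  If D <= K sqrt d, the
   q-norm test is not consistent: tilting the law of each noise coordinate by a
   density 1 + O(1 / sqrt d) shifts the mean of the power sum below the critical
   value, while the likelihood ratio keeps a bounded second moment, so that the
   acceptance probability stays bounded away from 0; no central limit theorem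
   is needed.  Hence consistency of the q-norm test forces D / sqrt d to
   infinity, and then the mean of the p-th power sum, which grows by at least
   c D, exceeds the critical value by far more than its standard deviation.

   Supremum norm.  Let k be its critical value.  As p_{m_d} >= (2 + delta) log d
   exceeds k^2 by a factor, the p_{m_d}-th power sum of the noise is carried by
   its extreme terms and the critical value of {p_{m_d}, kappa_{m_d}} is at
   most k + C / k.  Such a shift of the threshold changes each exceedance
   probability P(|theta_i + eps_i| >= k) by at most a constant factor, so the
   product of the non-exceedance probabilities still tends to 0. *)
Require Import Defs.
From mathcomp Require Import measurable_realfun.
From mathcomp Require Import ring lra.
Set Implicit Arguments.
Unset Strict Implicit.
Unset Printing Implicit Defensive.
Import Order.TTheory GRing.Theory Num.Theory.
Import numFieldNormedType.Exports.
Import HBNNSimple.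
Local Open Scope classical_set_scope.
Local Open Scope ring_scope.

(** Two obstacles shape the proof. For finite exponents, a small D still allows single coordinates
    of theta of order d^(1/(2p)), where no expansion in theta_i is available. There the summand
    |theta_i|^p of D has to pay both for the shift of the mean and for the second moment
    |theta_i|^(2q) of the q-th power, whence p >= 2q. The bound p >= 2 makes y^(p/2) convex, which
    yields the gain in mean. The index is taken in M because the upper bound on its critical value
    needs a null rejection probability bounded away from 0. For the supremum norm, a constant factor
    c on every exceedance probability is not enough: one coordinate exceeding with probability near
    1 would only be known to do so with probability about c. An additive comparison with error 2C/k,
    which vanishes as k tends to infinity, covers this case. Integrals are taken of nonnegative
    functions with values in the extended reals, so cross terms are moved to the other side of an
    identity instead of being subtracted. Independence is given for events only and is first lifted
    to products of nonnegative functions. *)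

Lemma measurable_addl (R : realType) (t : R) : measurable_fun setT (+%R t).
Proof. exact: (measurable_funD (measurable_cst t) (@measurable_id _ R setT)). Qed.

Ltac mfun_step := first
  [ assumption | exact: measurable_cst | exact: measurable_id
  | match goal with
    | H : forall _, measurable_fun _ _ |- _ => exact: H
    | H : forall _, measurable _ |- _ => exact: H
    end
  | match goal with
    | |- measurable_fun _ (fun x => (_)%:E) => apply/measurable_EFinP
    | |- measurable_fun _ (+%R _) => exact: measurable_addl
    | |- measurable_fun _ (fun x => - _) => apply: measurable_funN
    | |- measurable_fun _ (fun x => _ - _) => apply: measurable_funB
    | |- measurable_fun _ (fun x => _ + _) => apply: measurable_funD
    | |- measurable_fun _ (fun x => _ * _) => apply: measurable_funM
    | |- measurable_fun _ (fun x => _ ^+ _) => apply: measurable_funX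
    | |- measurable_fun _ (fun x => expR _) =>
        apply: (measurableT_comp (@measurable_expR _))
    | |- measurable_fun _ (fun x => `|_|) =>
        apply: (measurableT_comp (@normr_measurable _ setT))
    | |- measurable_fun _ (fun x => _ `^ _) =>
        apply: (measurableT_comp (measurable_powR _))
    end ].
Ltac mfun := repeat mfun_step.

Ltac pos := repeat first
  [ done | by apply: ltW | exact: sqr_ge0 | exact: expR_ge0 | exact: powR_ge0
  | exact: normr_ge0 | apply: mulr_ge0 | apply: addr_ge0
  | rewrite invr_ge0 | apply: exprn_ge0 ].

(** * Integration against the standard normal law *)

Section ge0_real_integral.
Context {R : realType} {d} {T : measurableType d}.
Variable mu : {measure set T -> \bar R}.
Implicit Types f g : T -> R.
Local Open Scope ereal_scope.

Lemma ge0_integralD_EFin f g : measurable_fun setT f -> measurable_fun setT g ->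
  (forall x, (0 <= f x)%R) -> (forall x, (0 <= g x)%R) ->
  \int[mu]_x (f x + g x)%:E = \int[mu]_x (f x)%:E + \int[mu]_x (g x)%:E.
Proof.
move=> mf mg f0 g0; under eq_integral do rewrite EFinD.
by rewrite ge0_integralD//; try exact/measurable_EFinP;
  move=> x _; rewrite lee_fin.
Qed.

Lemma ge0_integralZ_EFin (k : R) f : measurable_fun setT f ->
  (forall x, (0 <= f x)%R) -> (0 <= k)%R ->
  \int[mu]_x (k * f x)%:E = k%:E * \int[mu]_x (f x)%:E.
Proof.
move=> mf f0 k0; under eq_integral do rewrite EFinM.
by rewrite ge0_integralZl_EFin//; try exact/measurable_EFinP;
  move=> x _; rewrite lee_fin.
Qed.

Lemma ge0_integral_sum_EFin (I : finType) (f : I -> T -> R) :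
  (forall i, measurable_fun setT (f i)) ->
  (forall i x, (0 <= f i x)%R) ->
  \int[mu]_x (\sum_i f i x)%:E = \sum_i \int[mu]_x (f i x)%:E.
Proof.
move=> mf f0; under eq_integral do rewrite -sumEFin.
rewrite ge0_integral_sum// => i; first exact/measurable_EFinP.
by move=> x _; rewrite lee_fin.
Qed.

Lemma ge0_le_integral_EFin f g : measurable_fun setT f ->
  measurable_fun setT g -> (forall x, (0 <= f x)%R) ->
  (forall x, (f x <= g x)%R) ->
  \int[mu]_x (f x)%:E <= \int[mu]_x (g x)%:E.
Proof.
move=> mf mg f0 fg; apply: ge0_le_integral => //; try exact/measurable_EFinP;
  by move=> x _; rewrite lee_fin.
Qed.

Lemma ge0_integral_EFin_ge0 f : (forall x, (0 <= f x)%R) ->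
  0 <= \int[mu]_x (f x)%:E.
Proof. by move=> f0; apply: integral_ge0 => x _; rewrite lee_fin. Qed.

End ge0_real_integral.

Section integral_transfer.
Local Open Scope ereal_scope.
Context {R : realType} {d1 d2} {S : measurableType d1} {T : measurableType d2}.
Variables (mu1 : {measure set S -> \bar R}) (mu2 : {measure set T -> \bar R}).
Variables (X : T -> S) (g : T -> R) (k : R).
Hypotheses (mX : measurable_fun setT X) (mg : measurable_fun setT g).
Hypothesis g0 : forall y, (0 <= g y)%R.
Hypothesis indicE : forall A, measurable A ->
  \int[mu2]_y (\1_A (X y) * g y)%:E = k%:E * mu1 A.

(** The hypothesis [indicE] says that the image under [X] of [mu2] weighted by [g] is [k] times
    [mu1]. Linearity extends this to simple functions and monotone convergence to all nonnegative
    ones. It serves twice: with [X] the identity and [g] a density, and with [X] one noise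
    coordinate and [g] a product over the other coordinates. *)
Lemma ge0_integral_transfer (f : S -> \bar R) :
  measurable_fun setT f -> (forall x, 0 <= f x) ->
  \int[mu2]_y (f (X y) * (g y)%:E) = k%:E * \int[mu1]_x f x.
Proof.
move=> mf f0; pose h := nnsfun_approx measurableT mf.
have hE x : (h n x)%:E @[n --> \oo] --> f x by exact: cvg_nnsfun_approx.
have mhX n : measurable_fun setT (fun y => (h n (X y))%:E).
  apply/measurable_EFinP; exact: (measurableT_comp _ mX).
have mgE : measurable_fun setT (fun y => (g y)%:E) by exact/measurable_EFinP.
have simpleE n : \int[mu2]_y ((h n (X y))%:E * (g y)%:E) =
    k%:E * \int[mu1]_x (h n x)%:E.
  rewrite integralT_nnsfun sintegralE.
  have ind0 r y : 0 <= (r * \1_(h n @^-1` [set r]) y)%:E.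
    by rewrite EFinM nnfun_muleindic_ge0.
  transitivity (\int[mu2]_y \sum_(r \in range (h n))
      ((r * \1_(h n @^-1` [set r]) (X y))%:E * (g y)%:E)).
    apply: eq_integral => y _.
    by rewrite {1}fimfunE -fsumEFin// ge0_mule_fsuml.
  rewrite ge0_integral_fsum//; last 2 first.
  - move=> r; apply: emeasurable_funM => //; apply/measurable_EFinP.
    apply: measurable_funM => //.
    by apply: (measurableT_comp _ mX).
  - by move=> r y _; rewrite mule_ge0// ?lee_fin// ind0.
  rewrite ge0_mule_fsumr; last first.
    move=> r; have [r0|r0] := leP 0%R r; first by rewrite mule_ge0.
    by rewrite preimage_nnfun0// measure0 mule0.
  apply: eq_fsbigr => r _.
  have [r0|r0] := ltP r 0%R.
    rewrite preimage_nnfun0// measure0 !mule0 integral0_eq// => y _.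
    by rewrite indic0 mulr0 mul0e.
  transitivity (\int[mu2]_y (r%:E *
      (\1_(h n @^-1` [set r]) (X y) * g y)%:E)).
    by apply: eq_integral => y _; rewrite -!EFinM mulrA.
  rewrite ge0_integralZl_EFin//.
  - by rewrite indicE// muleCA.
  - by move=> y _; rewrite lee_fin mulr_ge0.
  apply/measurable_EFinP; apply: measurable_funM => //.
  by apply: (measurableT_comp _ mX).
transitivity (limn (fun n => \int[mu2]_y ((h n (X y))%:E * (g y)%:E))).
  rewrite -monotone_convergence//.
  - apply: eq_integral => y _; apply/esym/cvg_lim => //.
    exact: cvgeZr.
  - by move=> n; exact: emeasurable_funM.
  - by move=> n y _; rewrite mule_ge0// lee_fin.
  - move=> y _ m n mn; rewrite lee_wpmul2r// lee_fin//.
    exact/lefP/nd_nnsfun_approx.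
under eq_fun do rewrite simpleE.
apply/cvg_lim => //; apply: cvgeZl => //.
have -> : \int[mu1]_x f x = \int[mu1]_x limn (fun n => (h n x)%:E).
  by apply: eq_integral => x _; apply/esym/cvg_lim => //; exact: hE.
apply: cvg_monotone_convergence => //.
- by move=> n; exact/measurable_EFinP.
- by move=> n x _; rewrite lee_fin.
- by move=> x _ m n mn; rewrite lee_fin; exact/lefP/nd_nnsfun_approx.
Qed.

End integral_transfer.

Section normal_integral.
Context {R : realType}.
Notation mu := lebesgue_measure.
Notation nu := (@normal_prob R 0 1).

Lemma integral_normalE (f : R -> \bar R) :
  measurable_fun setT f -> (forall x, 0 <= f x)%E ->
  (\int[nu]_x f x = \int[mu]_x (f x * (normal_pdf 0 1 x)%:E))%E.
Proof.
move=> mf f0; rewrite -[LHS]mul1e; apply/esym.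
apply: (@ge0_integral_transfer R _ _ _ _ nu mu id (normal_pdf 0 1) 1) => //.
- exact: measurable_normal_pdf.
- by move=> y; exact: normal_pdf_ge0.
move=> A mA; rewrite mul1e /normal_prob /= [RHS]integral_mkcond.
apply: eq_integral => x _; rewrite patchE indicE.
by case: ifPn; rewrite (mul1r, mul0r).
Qed.

Lemma normal_pdf01E (x : R) :
  normal_pdf 0 1 x = normal_peak 1 * expR (- x ^+ 2 / 2).
Proof.
by rewrite normal_pdfE ?oner_neq0// /normal_fun subr0 expr1n.
Qed.

Lemma lebesgue_measure_shift (s : R) (A : set R) : measurable A ->
  pushforward mu ((fun x => x + s) : R -> measurableTypeR R) A = mu A.
Proof.
move=> mA; apply/esym/lebesgue_measure_unique => //=.
  exact: measurable_funD.
move=> _ _ [[a b]] _ <-.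
rewrite /pushforward.
have -> : (fun x => x + s) @^-1` `]a, b] = `]a - s, b - s]%classic.
  by apply/seteqP; split=> x /=; rewrite !in_itv/= ltrBlDr lerBrDr.
rewrite !lebesgue_measure_itv/= !lte_fin ltrD2r.
by case: ifP => // _; rewrite -!EFinB; congr EFin; ring.
Qed.

(** The Cameron-Martin formula in dimension one: translating Lebesgue measure moves the shift onto
    the density, and the exponential is the ratio of the densities of N(s, 1) and N(0, 1). *)
Lemma integral_normal_shift (s : R) (f : R -> R) :
  measurable_fun setT f -> (forall x, 0 <= f x) ->
  (\int[nu]_x (f (x + s))%:E =
   \int[nu]_x (f x * expR (s * x - s ^+ 2 / 2))%:E)%E.
Proof.
move=> mf f0.
have msh : measurable_fun setT (fun x : R => x + s) by exact: measurable_funD.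
have me : measurable_fun setT (fun x : R => expR (s * x - s ^+ 2 / 2)).
  apply: measurableT_comp => //; apply: measurable_funD => //.
pose h x := f x * normal_pdf 0 1 (x - s).
have mh : measurable_fun setT h.
  apply: measurable_funM => //.
  apply: (measurableT_comp (measurable_normal_pdf _ _)).
  exact: measurable_funB.
have h0 x : 0 <= h x by rewrite mulr_ge0// normal_pdf_ge0.
rewrite integral_normalE; last 2 first.
- apply/measurable_EFinP; exact: (measurableT_comp mf).
- by move=> x; rewrite lee_fin.
rewrite integral_normalE; last 2 first.
- by apply/measurable_EFinP; exact: measurable_funM.
- by move=> x; rewrite lee_fin mulr_ge0// expR_ge0.
transitivity (\int[mu]_x (h (x + s))%:E)%E.
  by apply: eq_integral => x _; rewrite -EFinM /h addrK.
transitivity (\int[pushforward mu ((fun x => (x + s)%R) : R -> measurableTypeR R)]_x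
   (h x)%:E)%E.
  rewrite ge0_integral_pushforward//.
  exact/measurable_EFinP.
  by move=> x _; rewrite lee_fin.
transitivity (\int[mu]_x (h x)%:E)%E.
  by apply: eq_measure_integral => A mA _; exact: lebesgue_measure_shift.
apply: eq_integral => x _; rewrite -EFinM; congr EFin.
rewrite /h !normal_pdf01E -mulrA; congr (_ * _).
rewrite mulrCA -expRD; congr (_ * expR _).
by field.
Qed.

Lemma integral_normalN (f : R -> R) :
  measurable_fun setT f -> (forall x, 0 <= f x) ->
  (\int[nu]_x (f (- x))%:E = \int[nu]_x (f x)%:E)%E.
Proof.
move=> mf f0.
rewrite integral_normalE; last 2 first.
- apply/measurable_EFinP; apply: (measurableT_comp mf).
  exact: oppr_measurable.
- by move=> x; rewrite lee_fin.
rewrite integral_normalE; last 2 first.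
- exact/measurable_EFinP.
- by move=> x; rewrite lee_fin.
pose h x := f x * normal_pdf 0 1 x.
transitivity (\int[pushforward mu (-%R : R -> measurableTypeR R)]_x
   (h x)%:E)%E.
  have mN : measurable_fun setT (-%R : measurableTypeR R -> measurableTypeR R).
    exact: oppr_measurable.
  have mh : measurable_fun setT (fun x : measurableTypeR R => (h x)%:E).
    apply/measurable_EFinP; apply: measurable_funM => //.
    exact: measurable_normal_pdf.
  have h0 : {in setT, forall x : measurableTypeR R, (0 <= (h x)%:E)%E}.
    by move=> x _; rewrite lee_fin mulr_ge0// normal_pdf_ge0.
  have E := ge0_integral_pushforward mN mu measurableT mh h0.
  apply: etrans (esym E); apply: eq_integral => x _.
  by rewrite -EFinM /h/= !normal_pdf01E sqrrN.
transitivity (\int[mu]_x (h x)%:E)%E.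
  by apply: eq_measure_integral => A mA _; exact: lebesgue_measureN.
by apply: eq_integral => x _; rewrite -EFinM.
Qed.

End normal_integral.

(** * Products and variances under independence *)

Section iid_normal.
Context {disp : measure_display} {T : measurableType disp} {R : realType}.
Context {P : probability T R} {eps : nat -> {RV P >-> R}}.
Hypothesis eps_iid : iid_std_normal eps.
Notation nu := (@normal_prob R 0 1).

Lemma measurable_eps i : measurable_fun setT (eps i : T -> R).
Proof. exact: measurable_funP. Qed.

Lemma measurable_eps_comp i (f : R -> R) : measurable_fun setT f ->
  measurable_fun setT (fun w => f (eps i w)).
Proof. by move=> mf; exact: (measurableT_comp mf (measurable_eps i)). Qed.

Lemma probability_eps i (A : set R) : measurable A ->
  P (eps i @^-1` A) = nu A.
Proof. by move=> mA; have [_ H] := eps_iid; rewrite -(H i). Qed.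

(* The factors indexed by t stay indicators, for which independence is given;
   the induction moves indices from t to s one at a time. *)
Lemma integral_prod_indic_eps (s t : seq nat) (B : nat -> set R)
    (f : nat -> R -> R) (e : nat -> R) :
  uniq (s ++ t) -> (forall i, measurable (B i)) ->
  (forall i, measurable_fun setT (f i)) -> (forall i x, 0 <= f i x) ->
  (forall i, \int[nu]_x (f i x)%:E = (e i)%:E)%E ->
  (\int[P]_w (\prod_(i <- s) f i (eps i w) *
     \prod_(i <- t) \1_(B i) (eps i w))%:E =
   (\prod_(i <- s) e i * \prod_(i <- t) fine (nu (B i)))%:E)%E.
Proof.
move=> + mB mf f0 fe.
elim: s t B mB => [|i s IH] t B mB; rewrite ?cat0s => ust.
  under eq_integral do rewrite big_nil mul1r.
  rewrite big_nil mul1r.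
  have -> : (\int[P]_w (\prod_(i <- t) \1_(B i) (eps i w))%:E =
    \int[P]_w (\1_(\bigcap_(i in [set` t]) (eps i @^-1` B i)) w)%:E)%E.
    apply: eq_integral => w _; congr EFin.
    rewrite indicE; case: (boolP (w \in _)) => [|/negP].
      rewrite inE => wB; rewrite big1_seq// => j /andP[_ jt].
      by rewrite indicE mem_set//; exact: wB.
    rewrite inE => /existsNP[j] /not_implyP[/= jt jB].
    by rewrite (big_rem j)//= indicE memNset// mul0r.
  rewrite integral_indic//; last first.
    by apply: bigcap_measurableType => k _; exact: measurable_sfunP.
  rewrite setIT; have [ind _] := eps_iid;
  transitivity (\prod_(i <- t) nu (B i))%E.
    etransitivity; first exact: (ind t B).
    by apply: eq_bigr => j _; exact: probability_eps.
  rewrite -prodEFin.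
  by apply: eq_bigr => j _; rewrite fineK// fin_num_measure//; exact: mB.
have ist : i \notin s ++ t by move: ust => /=/andP[].
have ust' : uniq (s ++ i :: t) by rewrite -[i :: t]cat1s uniq_catCA.
pose g w := \prod_(j <- s) f j (eps j w) * \prod_(j <- t) \1_(B j) (eps j w).
pose k := \prod_(i <- s) e i * \prod_(i <- t) fine (nu (B i)).
transitivity (\int[P]_w ((f i (eps i w))%:E * (g w)%:E))%E.
  by apply: eq_integral => w _; rewrite -EFinM big_cons mulrA.
rewrite (@ge0_integral_transfer R _ _ _ _ nu P (eps i) g k _ _ _ _
  (fun x => (f i x)%:E))//.
- by rewrite fe -EFinM big_cons /k; congr EFin; ring.
- exact: measurable_eps.
- apply: measurable_funM; apply: measurable_prod => j _.
    exact: measurable_eps_comp.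
  by apply: measurable_eps_comp; exact: measurable_indic.
- by move=> w; rewrite mulr_ge0//; apply: prodr_ge0 => j _.
- move=> A mA; pose B' j := if j == i then A else B j.
  have B'E j : j \in s ++ t -> B' j = B j.
    by rewrite /B'; case: eqP => // ->; rewrite (negbTE ist).
  have B'i : B' i = A by rewrite /B' eqxx.
  have mB' j : measurable (B' j) by rewrite /B'; case: ifP => _; [exact: mA|exact: mB].
  have tE (F : nat -> set R -> R) :
      \prod_(j <- t) F j (B' j) = \prod_(j <- t) F j (B j).
    by apply: eq_big_seq => j jt; rewrite B'E// mem_cat jt orbT.
  transitivity (\int[P]_w (\prod_(j <- s) f j (eps j w) *
      \prod_(j <- i :: t) \1_(B' j) (eps j w))%:E)%E.
    apply: eq_integral => w _; congr EFin.
    by rewrite big_cons B'i (tE (fun j C => \1_C (eps j w))) /g mulrCA.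
  rewrite IH// big_cons B'i (tE (fun j C => fine (nu C))).
  by rewrite mulrCA EFinM muleC fineK// fin_num_measure//; exact: mA.
- by apply/measurable_EFinP; exact: mf.
- by move=> x; rewrite lee_fin.
Qed.

Lemma integral_prod_eps (s : seq nat) (f : nat -> R -> R) (e : nat -> R) :
  uniq s -> (forall i, measurable_fun setT (f i)) ->
  (forall i x, 0 <= f i x) ->
  (forall i, \int[nu]_x (f i x)%:E = (e i)%:E)%E ->
  (\int[P]_w (\prod_(i <- s) f i (eps i w))%:E = (\prod_(i <- s) e i)%:E)%E.
Proof.
move=> us mf f0 fe.
have := @integral_prod_indic_eps s [::] (fun=> setT) f e _ _ mf f0 fe.
rewrite cats0 big_nil mulr1 => <- //.
by apply: eq_integral => w _; rewrite big_nil mulr1.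
Qed.

Lemma integral_prod_eps_ord n (f : 'I_n -> R -> R) (e : 'I_n -> R) :
  (forall i, measurable_fun setT (f i)) -> (forall i x, 0 <= f i x) ->
  (forall i, \int[nu]_x (f i x)%:E = (e i)%:E)%E ->
  (\int[P]_w (\prod_(i < n) f i (eps i w))%:E = (\prod_(i < n) e i)%:E)%E.
Proof.
move=> mf f0 fe.
(* Beyond [n] the factors are the constant 1, of integral 1, so that the version for lists of
   naturals applies. *)
pose f' k := if insub k is Some i then f i else cst 1.
pose e' k := if insub k is Some i then e i else 1.
have -> : \prod_(i < n) e i = \prod_(0 <= k < n) e' k.
  by rewrite big_mkord; apply: eq_bigr => i _; rewrite /e' valK.
rewrite -(@integral_prod_eps (index_iota 0 n) f' e').
- apply: eq_integral => w _; congr EFin.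
  by rewrite big_mkord; apply: eq_bigr => i _; rewrite /f' valK.
- exact: iota_uniq.
- move=> k; rewrite /f'; case: insub => [i|]; first exact: mf.
  exact: measurable_cst.
- by move=> k x; rewrite /f'; case: insub => [i|] /=.
- move=> k; rewrite /f' /e'; case: insub => [i|] //=.
  by rewrite integral_cst// mul1e; exact: (@probability_setT _ _ _ nu).
Qed.


Lemma measurable_row_fun n (f : 'I_n -> R -> R) (op : R -> R -> R) (idx : R)
    (mop : forall f g : T -> R, measurable_fun setT f ->
       measurable_fun setT g -> measurable_fun setT (fun w => op (f w) (g w))) :
  (forall i, measurable_fun setT (f i)) ->
  measurable_fun setT (fun w => \big[op/idx]_(i < n) f i (eps i w)).
Proof.
move=> mf; elim: (index_enum _) => [|i s IH].
  by under eq_fun do rewrite big_nil; exact: measurable_cst.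
under eq_fun do rewrite big_cons.
by apply: mop => //; exact: measurable_eps_comp.
Qed.

(** Under the law with density [\prod_i l i] the coordinates remain independent, with means [m i],
    so the covariances vanish and the variance of the sum is the sum of the variances. Each variance
    is at most the second moment about any centre [t i]; a free centre allows one that is explicit,
    unlike the mean. *)
Lemma weighted_chebyshev n (l X : 'I_n -> R -> R) (t m w : 'I_n -> R) :
  (forall i, measurable_fun setT (l i)) -> (forall i x, 0 <= l i x) ->
  (forall i, measurable_fun setT (X i)) -> (forall i x, 0 <= X i x) ->
  (forall i, \int[nu]_x (l i x)%:E = 1)%E ->
  (forall i, \int[nu]_x (l i x * X i x)%:E = (m i)%:E)%E ->
  (forall i, 0 <= t i) ->
  (forall i, \int[nu]_x (l i x * (X i x - t i) ^+ 2)%:E <= (w i)%:E)%E ->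
  (\int[P]_w ((\prod_(i < n) l i (eps i w)) *
     ((\sum_(i < n) X i (eps i w)) - \sum_(i < n) m i) ^+ 2)%:E <=
   (\sum_(i < n) w i)%:E)%E.
Proof.
move=> ml l0 mX X0 l1 lX t0 lXt.
have m0 i : 0 <= m i.
  by rewrite -lee_fin -lX integral_ge0// => x _; rewrite lee_fin mulr_ge0.
pose v i := fine (\int[nu]_x (l i x * X i x ^+ 2)%:E)%E.
(* The expanded square with its cross term on the other side: all integrands are nonnegative, so
   additivity holds before finiteness of the second moment is known, and the identity then provides
   that finiteness. *)
have sqE i : (\int[nu]_x (l i x * X i x ^+ 2)%:E + (t i ^+ 2)%:E =
   \int[nu]_x (l i x * (X i x - t i) ^+ 2)%:E + (2 * t i * m i)%:E)%E.
  have -> : ((t i ^+ 2)%:E = \int[nu]_x (t i ^+ 2 * l i x)%:E)%E.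
    by rewrite ge0_integralZ_EFin ?l1 ?mule1 ?sqr_ge0//; mfun.
  rewrite (EFinM (2 * t i)) -lX -ge0_integralZ_EFin; first last.
  - by rewrite mulr_ge0.
  - by move=> x; rewrite mulr_ge0.
  - by mfun.
  rewrite -!ge0_integralD_EFin; try (by mfun);
    try (by move=> x; rewrite ?(sqr_ge0, mulr_ge0)//).
  by apply: eq_integral => x _; congr EFin; ring.
have vE i : (\int[nu]_x (l i x * X i x ^+ 2)%:E = (v i)%:E)%E.
  rewrite /v fineK// ge0_fin_numE; last first.
    by apply: ge0_integral_EFin_ge0 => x; rewrite mulr_ge0// sqr_ge0.
  apply: (@le_lt_trans _ _ (\int[nu]_x (l i x * X i x ^+ 2)%:E + (t i ^+ 2)%:E)%E).
    by rewrite leeDl// lee_fin sqr_ge0.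
  rewrite sqE lte_add_pinfty ?ltry//.
  by rewrite (le_lt_trans (lXt i))// ltry.
have vw i : v i - m i ^+ 2 <= w i.
  have : (v i + t i ^+ 2 <= w i + 2 * t i * m i).
    by rewrite -lee_fin !EFinD -vE sqE leeD2r.
  have := sqr_ge0 (m i - t i); nra.
pose M := \sum_(i < n) m i.
have M0 : 0 <= M by exact: sumr_ge0.
pose L (w : T) := \prod_(i < n) l i (eps i w).
pose S (w : T) := \sum_(i < n) X i (eps i w).
have mL : measurable_fun setT L.
  by apply: measurable_row_fun => // f g; exact: measurable_funM.
have mS : measurable_fun setT S.
  by apply: measurable_row_fun => // f g; exact: measurable_funD.
have mXe i : measurable_fun setT (fun w' => X i (eps i w')).
  exact: measurable_eps_comp.
have L0 w' : 0 <= L w' by exact: prodr_ge0.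
have S0 w' : 0 <= S w' by exact: sumr_ge0.
have intL : (\int[P]_w (L w)%:E = 1)%E.
  by rewrite (integral_prod_eps_ord ml l0 l1) big1.
have intLX i : (\int[P]_w (L w * X i (eps i w))%:E = (m i)%:E)%E.
  pose f j x := l j x * (if j == i then X i x else 1).
  have -> : m i = \prod_j (if j == i then m i else 1).
    by rewrite (bigD1 i)//= eqxx big1 ?mulr1// => j /negbTE ->.
  rewrite -(@integral_prod_eps_ord _ f).
  - apply: eq_integral => w' _; congr EFin.
    rewrite /L big_split/=; congr (_ * _).
    by rewrite (bigD1 i)//= eqxx big1 ?mulr1// => j /negbTE ->.
  - by move=> j; rewrite /f; case: eqP => _; mfun.
  - by move=> j x; rewrite /f; case: eqP => _; rewrite mulr_ge0.
  - move=> j; rewrite /f; case: eqP => [->|_]; first exact: lX.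
    by under eq_integral do rewrite mulr1; exact: l1.
have intLXX i j : (\int[P]_w (L w * X i (eps i w) * X j (eps j w))%:E =
    (m i * m j + (if i == j then v i - m i ^+ 2 else 0))%:E)%E.
  pose f k x := l k x * (if k == i then X i x else 1) *
                        (if k == j then X j x else 1).
  pose e k := if i == j then (if k == i then v i else 1) else
    (if k == i then m i else 1) * (if k == j then m j else 1).
  have -> : m i * m j + (if i == j then v i - m i ^+ 2 else 0) = \prod_k e k.
    rewrite /e; case: eqP => [->|/eqP ij].
      by rewrite (bigD1 j)//= eqxx big1 ?mulr1 => [|k /negbTE -> //]; ring.
    rewrite big_split/= (bigD1 i)//= eqxx big1 ?mulr1 => [|k /negbTE -> //].
    rewrite (bigD1 j)//= eqxx big1 ?mulr1 => [|k /negbTE -> //].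
    by rewrite addr0.
  rewrite -(@integral_prod_eps_ord _ f).
  - apply: eq_integral => w' _; congr EFin.
    rewrite /L !big_split/=; congr (_ * _ * _).
      by rewrite (bigD1 i)//= eqxx big1 ?mulr1// => k /negbTE ->.
    by rewrite (bigD1 j)//= eqxx big1 ?mulr1// => k /negbTE ->.
  - by move=> k; rewrite /f; do 2 case: eqP => _; mfun.
  - by move=> k x; rewrite /f; do 2 case: eqP => _; rewrite !mulr_ge0.
  - move=> k; rewrite /f /e; have [->|ij] := eqVneq i j.
      have [->|_] := eqVneq k j.
        by rewrite -vE; apply: eq_integral => x _; rewrite -mulrA.
      by under eq_integral do rewrite !mulr1; exact: l1.
    have [->|ki] := eqVneq k i.
      rewrite (negbTE ij) mulr1 -lX.
      by apply: eq_integral => x _; rewrite mulr1.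
    have [->|_] := eqVneq k j.
      by rewrite mul1r -lX; apply: eq_integral => x _; rewrite mulr1.
    by under eq_integral do rewrite !mulr1; rewrite mulr1 l1.
have intLS : (\int[P]_w (L w * S w)%:E = M%:E)%E.
  under eq_integral do rewrite /S mulr_sumr.
  rewrite ge0_integral_sum_EFin.
  - by under eq_bigr do rewrite intLX; rewrite sumEFin.
  - by move=> i; apply: measurable_funM.
  - by move=> i w'; rewrite mulr_ge0.
have intLSS : (\int[P]_w (L w * S w ^+ 2)%:E =
    (M ^+ 2 + \sum_(i < n) (v i - m i ^+ 2))%:E)%E.
  transitivity (\int[P]_w (\sum_i \sum_j
      (L w * X i (eps i w) * X j (eps j w)))%:E)%E.
    apply: eq_integral => w' _; congr EFin.
    rewrite expr2 {1}/S mulr_suml mulr_sumr; apply: eq_bigr => i _.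
    by rewrite /S mulr_sumr mulr_sumr; apply: eq_bigr => j _; rewrite mulrA.
  rewrite ge0_integral_sum_EFin; last 2 first.
  - move=> i; apply: measurable_sum => j.
    by apply: measurable_funM => //; apply: measurable_funM.
  - by move=> i w'; apply: sumr_ge0 => j _; rewrite !mulr_ge0.
  transitivity (\sum_i \sum_j
      (m i * m j + (if i == j then v i - m i ^+ 2 else 0))%:E)%E.
    apply: eq_bigr => i _; rewrite ge0_integral_sum_EFin.
    + by apply: eq_bigr => j _; exact: intLXX.
    + by move=> j; apply: measurable_funM => //; apply: measurable_funM.
    + by move=> j w'; rewrite !mulr_ge0.
  under eq_bigr do rewrite sumEFin.
  rewrite sumEFin; congr EFin.
  rewrite expr2 {1}/M mulr_suml -big_split/=; apply: eq_bigr => i _.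
  rewrite big_split/= mulr_sumr; congr (_ + _).
  by rewrite -big_mkcond/= (big_pred1 i)// => j; rewrite /= eq_sym.
have eqE : (\int[P]_w (L w * (S w - M) ^+ 2)%:E + (2 * M * M)%:E =
  (M ^+ 2 + \sum_(i < n) (v i - m i ^+ 2))%:E + (M ^+ 2)%:E)%E.
  rewrite -intLSS (EFinM (2 * M)) -intLS -ge0_integralZ_EFin; first last.
  - by rewrite mulr_ge0.
  - by move=> x; rewrite mulr_ge0.
  - by mfun.
  have -> : ((M ^+ 2)%:E = \int[P]_w (M ^+ 2 * L w)%:E)%E.
    by rewrite ge0_integralZ_EFin ?intL ?mule1 ?sqr_ge0//.
  rewrite -!ge0_integralD_EFin; try (by mfun);
    try (by move=> x; rewrite ?(sqr_ge0, mulr_ge0)//).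
  by apply: eq_integral => x _; congr EFin; ring.
have -> : (\int[P]_w (L w * (S w - M) ^+ 2)%:E =
           (\sum_(i < n) (v i - m i ^+ 2))%:E)%E.
  move: eqE; rewrite -EFinD.
  case: (\int[P]_w _)%E => [r||] //; rewrite -?EFinD => -[] rE.
  congr EFin; nra.
by rewrite lee_fin; apply: ler_sum.
Qed.

End iid_normal.

(** * Deviation bounds for sums under the original and the tilted law *)

Section deviations.
Context {disp : measure_display} {T : measurableType disp} {R : realType}.
Context {P : probability T R} {eps : nat -> {RV P >-> R}}.
Hypothesis eps_iid : iid_std_normal eps.
Notation nu := (@normal_prob R 0 1).

Lemma integral_normal_prob1 : (\int[nu]_x 1%:E = 1)%E.
Proof.
by rewrite integral_cst// mul1e; exact: (@probability_setT _ _ _ nu).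
Qed.

(** The untilted case [l i = 1] of the variance bound, followed by Markov's inequality for the
    squared deviation. *)
Lemma chebyshev_eps n (X : 'I_n -> R -> R) (t m w : 'I_n -> R) (r : R)
    (A : set T) :
  (forall i, measurable_fun setT (X i)) -> (forall i x, 0 <= X i x) ->
  (forall i, \int[nu]_x (X i x)%:E = (m i)%:E)%E ->
  (forall i, 0 <= t i) ->
  (forall i, \int[nu]_x ((X i x - t i) ^+ 2)%:E <= (w i)%:E)%E ->
  0 < r -> measurable A ->
  (forall y, A y -> r <= `|\sum_(i < n) X i (eps i y) - \sum_(i < n) m i|) ->
  (P A <= (\sum_(i < n) w i / r ^+ 2)%:E)%E.
Proof.
move=> mX X0 Xm t0 Xt r0 mA Ar.
have H := @weighted_chebyshev _ _ _ _ _ eps_iid n (fun _ => cst 1) X t m w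
  (fun=> measurable_cst _) (fun _ _ => ler01) mX X0
  (fun=> integral_normal_prob1).
have {}H : (\int[P]_w ((\sum_(i < n) X i (eps i w) - \sum_(i < n) m i) ^+ 2)%:E
    <= (\sum_(i < n) w i)%:E)%E.
  apply: le_trans (H _ t0 _).
  - rewrite le_eqVlt; apply/orP; left; apply/eqP; apply: eq_integral => y _.
    have -> : \prod_(i < n) cst 1 (eps i y) = 1 :> R by apply: big1.
    by rewrite mul1r.
  - by move=> i; rewrite -Xm; apply: eq_integral => y _; rewrite mul1r.
  - move=> i; apply: le_trans (Xt i).
    by under eq_integral do rewrite mul1r.
have r20 : 0 < r ^+ 2 by rewrite exprn_gt0.
have mS : measurable_fun setT (fun w => \sum_(i < n) X i (eps i w)).
  by apply: (@measurable_row_fun _ _ _ P eps n X +%R 0) => // f g;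
    exact: measurable_funD.
rewrite -mulr_suml -(setIT A) -integral_indic// mulrC EFinM.
apply: le_trans (lee_wpmul2l _ H); last by rewrite lee_fin invr_ge0 ltW.
rewrite -ge0_integralZ_EFin//; last 3 first.
- by mfun.
- by move=> x; rewrite sqr_ge0.
- by rewrite invr_ge0 ltW.
apply: ge0_le_integral_EFin => //.
- by mfun.
- move=> y; rewrite indicE; have [|] := boolP (y \in A); last first.
    by move=> _; rewrite mulr_ge0 ?sqr_ge0// invr_ge0 ltW.
  rewrite inE => /Ar rS; rewrite mulrC ler_pdivlMr// mul1r.
  by rewrite -[leRHS]real_normK ?num_real// lerXn2r// nnegrE// ltW.
Qed.

(* With S = \sum_i X i (eps i) and L = \prod_i l i (eps i), the reweighted
   Chebyshev bound gives E[L; A] >= 1/2, and the Cauchy-Schwarz inequality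
   transfers this to P A at the cost of the second moment of L. *)
Lemma tilted_lower_bound n (l X : 'I_n -> R -> R) (m w : 'I_n -> R) (b r : R)
    (A : set T) :
  (forall i, measurable_fun setT (l i)) -> (forall i x, 0 <= l i x) ->
  (forall i, measurable_fun setT (X i)) -> (forall i x, 0 <= X i x) ->
  (forall i, \int[nu]_x (l i x)%:E = 1)%E ->
  (forall i, \int[nu]_x (l i x ^+ 2)%:E <= (1 + b)%:E)%E ->
  (forall i, \int[nu]_x (l i x * X i x)%:E = (m i)%:E)%E ->
  (forall i, \int[nu]_x (l i x * X i x ^+ 2)%:E <= (w i)%:E)%E ->
  0 < r -> \sum_(i < n) w i <= r ^+ 2 / 2 -> measurable A ->
  (forall y, `|\sum_(i < n) X i (eps i y) - \sum_(i < n) m i| < r -> A y) ->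
  0 <= b -> ((4 * (1 + b) ^+ n)^-1%:E <= P A)%E.
Proof.
move=> ml l0 mX X0 l1 l2 lX lX2 r0 wr mA Ar b0.
pose L (y : T) := \prod_(i < n) l i (eps i y).
pose S (y : T) := \sum_(i < n) X i (eps i y).
pose M := \sum_(i < n) m i.
have mL : measurable_fun setT L.
  by apply: (@measurable_row_fun _ _ _ P eps n l *%R 1) => // f g;
    exact: measurable_funM.
have mS : measurable_fun setT S.
  by apply: (@measurable_row_fun _ _ _ P eps n X +%R 0) => // f g;
    exact: measurable_funD.
have L0 y : 0 <= L y by exact: prodr_ge0.
have intL : (\int[P]_w (L w)%:E = 1)%E.
  by rewrite (integral_prod_eps_ord eps_iid ml l0 l1) big1.
pose u i := fine (\int[nu]_x (l i x ^+ 2)%:E)%E.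
have uE i : (\int[nu]_x (l i x ^+ 2)%:E = (u i)%:E)%E.
  rewrite /u fineK// ge0_fin_numE; last first.
    by apply: ge0_integral_EFin_ge0 => x; rewrite sqr_ge0.
  by apply: le_lt_trans (l2 i) _; rewrite ltry.
pose Q := (1 + b) ^+ n.
have Q0 : 0 < Q by rewrite exprn_gt0// ltr_wpDr.
have intL2 : (\int[P]_w (L w ^+ 2)%:E <= Q%:E)%E.
  under eq_integral do rewrite /L -prodrXl.
  rewrite (@integral_prod_eps_ord _ _ _ _ _ eps_iid _ (fun i x => l i x ^+ 2) u)//.
  - rewrite lee_fin /Q -[n in (1 + b) ^+ n]card_ord -prodr_const.
    apply: ler_prod => i _.
    by rewrite -!lee_fin -uE l2 ge0_integral_EFin_ge0// => x; rewrite sqr_ge0.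
  - by move=> i; mfun.
  - by move=> i x; rewrite sqr_ge0.
have H : (\int[P]_w (L w * (S w - M) ^+ 2)%:E <= (r ^+ 2 / 2)%:E)%E.
  apply: (@le_trans _ _ (\sum_(i < n) w i)%:E); last by rewrite lee_fin.
  apply: (@weighted_chebyshev _ _ _ _ _ eps_iid n l X (cst 0)) => // i.
  by under eq_integral do rewrite subr0; exact: lX2.
have PA : P A \is a fin_num by rewrite fin_num_measure.
have r20 : 0 < r ^+ 2 by rewrite exprn_gt0.
have mA' : measurable_fun setT (\1_A : T -> R) by exact: measurable_indic.
have Q'0 : 0 <= (4 * Q)^-1 by rewrite invr_ge0 mulr_ge0// ltW.
have r'0 : 0 <= (r ^+ 2)^-1 by rewrite invr_ge0 ltW.
(* Cauchy-Schwarz in additive form, integrated from a pointwise bound on L: on A, L <= Q + L^2 /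
   (4Q) by completing the square; off A the deviation is at least r, so L <= L (S - M)^2 / r^2. The
   three terms are at most 1/2, Q P(A) and 1/4. *)
have bound : (1 <= (r ^+ 2)^-1%:E * (r ^+ 2 / 2)%:E +
    (Q%:E * P A + (4 * Q)^-1%:E * Q%:E))%E.
  rewrite -{1}intL.
  apply: (@le_trans _ _ (\int[P]_w ((r ^+ 2)^-1 * (L w * (S w - M) ^+ 2) +
      (Q * \1_A w + (4 * Q)^-1 * L w ^+ 2))%:E)%E).
    apply: ge0_le_integral_EFin => //.
      by mfun.
    move=> y; have [yA|/negP yA] := boolP (y \in A).
      rewrite indicE yA mulr1.
      have : 0 <= (r ^+ 2)^-1 * (L y * (S y - M) ^+ 2).
        by pos.
      have -> : Q + (4 * Q)^-1 * L y ^+ 2 =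
          L y + (4 * Q)^-1 * (2 * Q - L y) ^+ 2.
        by field; rewrite gt_eqF.
      have : 0 <= (4 * Q)^-1 * (2 * Q - L y) ^+ 2 by pos.
      by lra.
    have rS : r <= `|S y - M|.
      by rewrite leNgt; apply/negP => /Ar; rewrite inE in yA.
    have {}rS : r ^+ 2 <= (S y - M) ^+ 2.
      by rewrite -[leRHS]real_normK ?num_real// lerXn2r// nnegrE// ltW.
    rewrite ler_wpDr//.
      by rewrite addr_ge0// mulr_ge0// ?sqr_ge0//; exact: ltW.
    rewrite mulrCA ler_peMr//.
    by rewrite mulrC ler_pdivlMr// mul1r.
  rewrite ge0_integralD_EFin; [|by mfun|by mfun|by move=> x; pos|by move=> x; pos].
  rewrite ge0_integralZ_EFin; [|by mfun|by move=> x; pos|by pos].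
  apply: leeD; first by rewrite lee_wpmul2l.
  rewrite ge0_integralD_EFin; [|by mfun|by mfun|by move=> x; pos|by move=> x; pos].
  rewrite ge0_integralZ_EFin; [|by mfun|by move=> x; pos|by pos].
  rewrite ge0_integralZ_EFin; [|by mfun|by move=> x; pos|by pos].
  by rewrite integral_indic// setIT leeD2l// lee_wpmul2l.
move: bound; rewrite -(fineK PA) -!EFinM -!EFinD !lee_fin.
have -> : (r ^+ 2)^-1 * (r ^+ 2 / 2) = 2^-1 by field; rewrite gt_eqF.
have -> : (4 * Q)^-1 * Q = 4^-1 by field; rewrite gt_eqF.
rewrite -[(1 + b) ^+ n]/Q => H'.
by rewrite invfM ler_pdivrMr// mulrC; lra.
Qed.

End deviations.

(** * Expectations of functions of one normal variable *)

Section tame.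
Context {R : realType}.
Notation nu := (@normal_prob R 0 1).
Implicit Types f g : R -> R.

(* fine maps +oo to 0, so this is the expectation of f under N(0, 1) only when
   f is integrable, e.g. tame: nonnegative, with at most exponential growth. *)
Definition Nexp f : R := fine (\int[nu]_x (f x)%:E)%E.

Definition tame f := [/\ measurable_fun setT f, forall x, 0 <= f x &
  exists C c : R, forall x, f x <= C * expR (c * `|x|)].

(** The shift formula applied to the constant 1: the shifted density has total mass 1. *)
Lemma integral_normal_expR (s : R) :
  (\int[nu]_x (expR (s * x))%:E = (expR (s ^+ 2 / 2))%:E)%E.
Proof.
have := @integral_normal_shift R s (cst 1) (measurable_cst _) (fun=> ler01).
rewrite (integral_normal_prob1 (R := R)).
under eq_integral do rewrite mul1r.
move=> H.
transitivity (\int[nu]_x (expR (s ^+ 2 / 2) * expR (s * x - s ^+ 2 / 2))%:E)%E.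
  by apply: eq_integral => x _; rewrite -expRD; congr ((expR _)%:E); ring.
rewrite ge0_integralZ_EFin; [|by mfun|by move=> x; pos|by pos].
by rewrite -H mule1.
Qed.

Lemma integral_normal_exp_abs (c : R) :
  (\int[nu]_x (expR (c * `|x|))%:E <= (2 * expR (c ^+ 2 / 2))%:E)%E.
Proof.
apply: (@le_trans _ _ (\int[nu]_x (expR (c * x) + expR (- c * x))%:E)%E).
  apply: ge0_le_integral_EFin; [by mfun|by mfun|by move=> x; pos|].
  move=> x; have [x0|x0] := ler0P x.
    by rewrite mulrN mulNr lerDr expR_ge0.
  by rewrite lerDl expR_ge0.
rewrite ge0_integralD_EFin; [|by mfun|by mfun|by move=> x; pos|by move=> x; pos].
by rewrite !integral_normal_expR sqrrN -EFinD lee_fin; lra.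
Qed.

Lemma Nexp_dominated f (C c : R) : measurable_fun setT f ->
  (forall x, 0 <= f x) -> (forall x, f x <= C * expR (c * `|x|)) ->
  (\int[nu]_x (f x)%:E <= (C * (2 * expR (c ^+ 2 / 2)))%:E)%E.
Proof.
move=> mf f0 fC.
have C0 : 0 <= C.
  by have := fC 0; rewrite normr0 mulr0 expR0 mulr1; exact: le_trans.
apply: (@le_trans _ _ (\int[nu]_x (C * expR (c * `|x|))%:E)%E).
  by apply: ge0_le_integral_EFin => //; mfun.
rewrite ge0_integralZ_EFin; [|by mfun|by move=> x; pos|by []].
by rewrite EFinM lee_wpmul2l// integral_normal_exp_abs.
Qed.

Lemma tame_measurable f : tame f -> measurable_fun setT f.
Proof. by case. Qed.

Lemma tame_ge0 f : tame f -> forall x, 0 <= f x.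
Proof. by case. Qed.

Lemma NexpE f : tame f -> (\int[nu]_x (f x)%:E = (Nexp f)%:E)%E.
Proof.
move=> [mf f0 [C [c fC]]]; rewrite /Nexp fineK// ge0_fin_numE; last first.
  exact: ge0_integral_EFin_ge0.
by apply: le_lt_trans (Nexp_dominated mf f0 fC) _; rewrite ltry.
Qed.

Lemma Nexp_ge0 f : tame f -> 0 <= Nexp f.
Proof.
by move=> tf; rewrite -lee_fin -NexpE// ge0_integral_EFin_ge0//; exact: tame_ge0.
Qed.

Lemma Nexp_le_dominated f (C c : R) : tame f ->
  (forall x, f x <= C * expR (c * `|x|)) ->
  Nexp f <= C * (2 * expR (c ^+ 2 / 2)).
Proof.
move=> tf fC; rewrite -lee_fin -NexpE//.
by apply: Nexp_dominated => //; [exact: tame_measurable|exact: tame_ge0].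
Qed.

Lemma le_Nexp f g : tame f -> tame g -> (forall x, f x <= g x) ->
  Nexp f <= Nexp g.
Proof.
move=> tf tg fg; rewrite -lee_fin -!NexpE//.
by apply: ge0_le_integral_EFin => //; [exact: tame_measurable|
  exact: tame_measurable|exact: tame_ge0].
Qed.

Lemma tame_le f g : measurable_fun setT f -> (forall x, 0 <= f x) ->
  tame g -> (forall x, f x <= g x) -> tame f.
Proof.
move=> mf f0 [_ _ [C [c gC]]] fg; split => //; exists C, c => x.
exact: le_trans (fg x) (gC x).
Qed.

Lemma tameD f g : tame f -> tame g -> tame (fun x => f x + g x).
Proof.
move=> [mf f0 [C [c fC]]] [mg g0 [D [d gD]]]; split.
- by mfun.
- by move=> x; rewrite addr_ge0.
have C0 : 0 <= C.
  by have := fC 0; rewrite normr0 mulr0 expR0 mulr1; exact: le_trans.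
have D0 : 0 <= D.
  by have := gD 0; rewrite normr0 mulr0 expR0 mulr1; exact: le_trans.
exists (C + D), (Num.max c d) => x; rewrite mulrDl lerD//.
  apply: le_trans (fC x) _; rewrite ler_wpM2l// ler_expR ler_wpM2r//.
  by rewrite le_max lexx.
apply: le_trans (gD x) _; rewrite ler_wpM2l// ler_expR ler_wpM2r//.
by rewrite le_max lexx orbT.
Qed.

Lemma tameM f g : tame f -> tame g -> tame (fun x => f x * g x).
Proof.
move=> [mf f0 [C [c fC]]] [mg g0 [D [d gD]]]; split.
- by mfun.
- by move=> x; rewrite mulr_ge0.
exists (C * D), (c + d) => x.
rewrite mulrDl expRD mulrACA.
exact: ler_pM.
Qed.

Lemma tame_sqr f : tame f -> tame (fun x => f x ^+ 2).
Proof. by move=> tf; exact: (tameM tf tf). Qed.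

Lemma tame_cst (k : R) : 0 <= k -> tame (fun=> k).
Proof.
move=> k0; split; [exact: measurable_cst|by []|].
by exists k, 0 => x; rewrite mul0r expR0 mulr1.
Qed.

Lemma tameZ (k : R) f : 0 <= k -> tame f -> tame (fun x => k * f x).
Proof. by move=> k0 tf; apply: tameM => //; exact: tame_cst. Qed.

Lemma NexpD f g : tame f -> tame g ->
  Nexp (fun x => f x + g x) = Nexp f + Nexp g.
Proof.
move=> tf tg; apply: EFin_inj; rewrite EFinD -!NexpE//; last exact: tameD.
by rewrite ge0_integralD_EFin//; first [exact: tame_measurable|exact: tame_ge0].
Qed.

Lemma NexpZ (k : R) f : 0 <= k -> tame f -> Nexp (fun x => k * f x) = k * Nexp f.
Proof.
move=> k0 tf; apply: EFin_inj; rewrite EFinM -!NexpE//; last exact: tameZ.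
by rewrite ge0_integralZ_EFin//; first [exact: tame_measurable|exact: tame_ge0].
Qed.

Lemma Nexp_cst (k : R) : 0 <= k -> Nexp (fun=> k) = k.
Proof.
move=> k0; rewrite -[k in LHS]mulr1 (@NexpZ k (fun=> 1))//.
  by rewrite /Nexp integral_normal_prob1 mulr1.
exact: tame_cst.
Qed.

Lemma tame_expabs (c : R) : tame (fun x => expR (c * `|x|)).
Proof.
split; [by mfun|by move=> x; pos|].
by exists 1, c => x; rewrite mul1r.
Qed.

Lemma eq_Nexp f g : f =1 g -> Nexp f = Nexp g.
Proof. by move=> fg; congr Nexp; exact/funext. Qed.

Lemma tame_shift (t : R) f : tame f -> tame (fun x => f (t + x)).
Proof.
move=> [mf f0 [C [c fC]]]; split => //.
  have mt : measurable_fun setT (fun x : R => t + x) by mfun.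
  exact: (measurableT_comp mf mt).
have C0 : 0 <= C.
  by have := fC 0; rewrite normr0 mulr0 expR0 mulr1; exact: le_trans.
exists (C * expR (`|c| * `|t|)), `|c| => x; apply: le_trans (fC _) _.
rewrite -mulrA -expRD ler_wpM2l// ler_expR -mulrDr.
apply: (@le_trans _ _ (`|c| * `|t + x|)).
  by rewrite ler_wpM2r// ler_norm.
by rewrite ler_wpM2l// ler_normD.
Qed.

Lemma NexpN f : tame f -> Nexp (fun x => f (- x)) = Nexp f.
Proof.
by move=> tf; rewrite /Nexp integral_normalN//;
  [exact: tame_measurable|exact: tame_ge0].
Qed.

End tame.

Section normal_moments.
Context {R : realType}.
Notation nu := (@normal_prob R 0 1).
Implicit Types (f g : R -> R) (q p : R).

Lemma powR_le_expR q (y : R) : 0 <= q -> 0 <= y -> y `^ q <= expR (q * y).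
Proof.
move=> q0 y0; have [->|yn0] := eqVneq y 0.
  by rewrite mulr0 expR0 /powR eqxx; case: (q == 0).
have ypos : 0 < y by rewrite lt_def yn0.
rewrite /powR (negbTE yn0) ler_expR ler_wpM2l//.
have -> : y = 1 + (y - 1) by ring.
by apply: (le_trans (le_ln1Dx _)); lra.
Qed.

(** The bound is a product, from 1 + |x| <= exp |x|, so that powers and expectations split into a
    factor in [t] and an exponential moment free of [t]. *)
Lemma abs_shift_le (t x : R) : `|t + x| <= Num.max 1 `|t| * expR `|x|.
Proof.
apply: (le_trans (ler_normD _ _)).
have := expR_ge1Dx `|x|; have := normr_ge0 x; have := normr_ge0 t.
have : 1 <= Num.max 1 `|t| by rewrite le_max lexx.
have : `|t| <= Num.max 1 `|t| by rewrite le_max lexx orbT.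
nra.
Qed.

Lemma powR_shift_le q (t x : R) : 0 <= q ->
  `|t + x| `^ q <= Num.max 1 `|t| `^ q * expR (q * `|x|).
Proof.
move=> q0; have m0 : 0 <= Num.max 1 `|t| by rewrite le_max ler01.
have -> : expR (q * `|x|) = expR `|x| `^ q by rewrite mulrC expRM.
rewrite -powRM// ?expR_ge0//; apply: ge0_ler_powR => //.
  by rewrite nnegrE mulr_ge0// expR_ge0.
exact: abs_shift_le.
Qed.

Lemma tame_powR q : 0 <= q -> tame (fun x : R => `|x| `^ q).
Proof.
move=> q0; split; [by mfun|by move=> x; pos|].
by exists 1, q => x; rewrite mul1r powR_le_expR.
Qed.

Lemma tame_indic (A : set R) : measurable A -> tame (\1_A : R -> R).
Proof.
move=> mA; split; [exact: measurable_indic|by []|].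
by exists 1, 0 => x; rewrite mul0r expR0 mulr1 indicE; case: (_ \in _).
Qed.

Lemma Nexp_indic (A : set R) : measurable A ->
  (nu A = (Nexp (\1_A : R -> R))%:E)%E.
Proof. by move=> mA; rewrite -NexpE ?integral_indic ?setIT//; exact: tame_indic. Qed.

Lemma Nexp_powR_shift_le q (t : R) : 0 <= q ->
  Nexp (fun x => `|t + x| `^ q) <=
  Num.max 1 `|t| `^ q * (2 * expR (q ^+ 2 / 2)).
Proof.
move=> q0; apply: Nexp_le_dominated => [|x]; last exact: powR_shift_le.
exact: (tame_shift t (tame_powR q0)).
Qed.

Lemma normal_itv_ge (a b c : R) : a <= b ->
  (forall x, a <= x <= b -> `|x| <= c) ->
  (((b - a) * (normal_peak 1 * expR (- c ^+ 2 / 2)))%:E <= nu `[a, b]%classic)%E.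
Proof.
move=> ab xc; rewrite /normal_prob.
have -> : (((b - a) * (normal_peak 1 * expR (- c ^+ 2 / 2)))%:E =
  \int[lebesgue_measure]_(x in `[a, b])
     (normal_peak 1 * expR (- c ^+ 2 / 2))%:E)%E.
  rewrite integral_cst//= lebesgue_measure_itv/= lte_fin.
  case: ltgtP ab => // [ab _|-> _]; last by rewrite subrr mule0 mul0r.
  by rewrite -EFinB -EFinM mulrC.
apply: ge0_le_integral => //.
- by move=> x _; rewrite lee_fin mulr_ge0// ?normal_peak_ge0// expR_ge0.
- apply/measurable_EFinP; apply: measurable_funTS.
  exact: measurable_normal_pdf.
- move=> x /=; rewrite in_itv/= => /xc xc'; rewrite lee_fin normal_pdf01E.
  rewrite ler_wpM2l ?normal_peak_ge0// ler_expR ler_wpM2r// lerN2.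
  by rewrite -[x ^+ 2]real_normK ?num_real// lerXn2r// nnegrE// (le_trans _ xc').
Qed.

Lemma Nexp_indic_gt0 (A : set R) (a b : R) : measurable A -> a < b ->
  `[a, b]%classic `<=` A -> 0 < Nexp (\1_A : R -> R).
Proof.
move=> mA ab sA; rewrite -lte_fin -Nexp_indic//.
apply: lt_le_trans (le_measure nu _ _ sA); rewrite ?inE//.
apply: (lt_le_trans _ (@normal_itv_ge a b (`|a| + `|b|) (ltW ab) _)).
  rewrite lte_fin mulr_gt0 ?subr_gt0// mulr_gt0 ?expR_gt0//.
  by rewrite normal_peak_gt0.
move=> x /andP[ax xb]; have := ler_norm a; have := ler_norm b.
have := ler_norm (- a); rewrite normrN; have := ler_norm (- b); rewrite normrN.
by rewrite ler_norml; lra.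
Qed.

(** With u = exp(t/2) and v = 1/u, cosh t - 1 is (u - v)^2 / 2, and u - v <= u t for t >= 0. The
    error is quadratic in [t] with only exponential growth, which tame functions absorb. *)
Lemma cosh_le (t : R) : (expR t + expR (- t)) / 2 <= 1 + t ^+ 2 / 2 * expR `|t|.
Proof.
wlog t0 : t / 0 <= t.
  move=> H; have [/H//|t0] := leP 0 t.
  have := H (- t); rewrite opprK sqrrN normrN addrC; apply; lra.
rewrite ger0_norm//.
pose u := expR (t / 2); pose v := expR (- (t / 2)).
have uv : u * v = 1 by rewrite -expRD addrN expR0.
have -> : expR t = u ^+ 2 by rewrite expr2 -expRD; congr expR; field.
have -> : expR (- t) = v ^+ 2 by rewrite expr2 -expRD; congr expR; field.
have u1 : 1 <= u by rewrite -expR0 ler_expR; lra.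
have v0 : 0 < v := expR_gt0 _.
have v1 : v <= 1 by rewrite -expR0 ler_expR; lra.
have v2 : 1 - t <= v ^+ 2.
  by rewrite expr2 -expRD; apply: le_trans (expR_ge1Dx _); lra.
(* u - v = u (1 - v ^ 2), since u v = 1 *)
have uvt : u - v <= u * t.
  have : u * (1 - t) <= u * v ^+ 2 by rewrite ler_wpM2l//; lra.
  by rewrite expr2 mulrA uv; lra.
have : (u - v) ^+ 2 <= (u * t) ^+ 2.
  by rewrite lerXn2r// nnegrE; [lra|rewrite mulr_ge0//; lra].
by rewrite exprMn sqrrB uv; lra.
Qed.

(* Averaging the densities of N(t, 1) and N(- t, 1) turns the likelihood ratio
   into cosh (t x) exp (- t ^ 2 / 2), which is 1 + O(t ^ 2). *)
Lemma Nexp_even_shift_le f (t : R) : tame f -> (forall x, f (- x) = f x) ->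
  `|t| <= 1 ->
  Nexp (fun x => f (t + x)) <=
  Nexp f + t ^+ 2 * Nexp (fun x => f x * expR (2 * `|x|)).
Proof.
move=> tf fN t1.
have [mf f0 _] := tf.
have te := tame_expabs (R := R).
have tfe : tame (fun x => f x * expR (2 * `|x|)) by apply: tameM.
have gtame s : tame (fun x => f x * expR (s * x - s ^+ 2 / 2)).
  apply: (@tame_le _ _ (fun x => f x * expR (`|s| * `|x|))).
  - by mfun.
  - by move=> x; pos.
  - by apply: tameM.
  - move=> x; rewrite ler_wpM2l// ler_expR -normrM.
    have := ler_norm (s * x); have := sqr_ge0 s; lra.
have E1 : Nexp (fun x => f (t + x)) =
    Nexp (fun x => f x * expR (t * x - t ^+ 2 / 2)).
  rewrite /Nexp -integral_normal_shift//; congr fine.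
  by apply: eq_integral => x _; rewrite addrC.
have E2 : Nexp (fun x => f (t + x)) =
    Nexp (fun x => f x * expR ((- t) * x - (- t) ^+ 2 / 2)).
  rewrite E1 -(NexpN (gtame t)); apply: eq_Nexp => x.
  by rewrite fN sqrrN mulrN mulNr.
rewrite -[leLHS](mulfK (x := 2)) ?pnatr_eq0// mulr_natr mulr2n {1}E1 E2.
rewrite -NexpD//; do 2?exact: gtame.
rewrite ler_pdivrMr// -NexpZ ?sqr_ge0// -NexpD//; last first.
  by apply: tameZ => //; exact: sqr_ge0.
rewrite [leRHS]mulrC -NexpZ//; last first.
  by apply: tameD => //; apply: tameZ => //; exact: sqr_ge0.
apply: le_Nexp.
- by apply: tameD; exact: gtame.
- by apply: tameZ => //; apply: tameD => //; apply: tameZ => //; exact: sqr_ge0.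
move=> x.
rewrite sqrrN.
suff : expR (t * x - t ^+ 2 / 2) + expR (- t * x - t ^+ 2 / 2) <=
    2 * (1 + t ^+ 2 * expR (2 * `|x|)).
  by move=> /(ler_wpM2l (f0 x)); lra.
have := cosh_le (t * x).
have e1 : expR (t * x - t ^+ 2 / 2) <= expR (t * x).
  by rewrite ler_expR; have := sqr_ge0 t; lra.
have e2 : expR (- t * x - t ^+ 2 / 2) <= expR (- (t * x)).
  by rewrite ler_expR; have := sqr_ge0 t; lra.
have e3 : (t * x) ^+ 2 / 2 * expR `|t * x| <= t ^+ 2 * expR (2 * `|x|).
  rewrite (_ : _ / 2 * _ = t ^+ 2 * (x ^+ 2 / 2 * expR `|t * x|)); last by ring.
  rewrite ler_wpM2l ?sqr_ge0//.
  rewrite (_ : expR (2 * `|x|) = expR `|x| * expR `|x|); last first.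
    by rewrite -expRD; congr expR; ring.
  apply: ler_pM; pos.
    have := expR_ge1Dxn 1 (normr_ge0 x); rewrite real_normK ?num_real//.
    by rewrite (_ : 2`! = 2)%N//; lra.
  by rewrite ler_expR normrM ler_piMl.
by lra.
Qed.

End normal_moments.

Section level_sets.
Context {R : realType} {d} {T : measurableType d}.
Implicit Types (f : T -> R) (c : R).

Lemma measurable_set_ge f c : measurable_fun setT f ->
  measurable [set w | c <= f w].
Proof.
move=> mf; rewrite (_ : [set _ | _] = f @^-1` `[c, +oo[).
  by rewrite -[X in measurable X]setTI; exact: mf.
by apply/seteqP; split => x /=; rewrite in_itv/= andbT.
Qed.

Lemma measurable_set_lt f c : measurable_fun setT f ->
  measurable [set w | f w < c].
Proof.
move=> mf; rewrite (_ : [set _ | _] = f @^-1` `]-oo, c[).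
  by rewrite -[X in measurable X]setTI; exact: mf.
by apply/seteqP; split => x /=; rewrite in_itv.
Qed.

Lemma measurable_set_le f c : measurable_fun setT f ->
  measurable [set w | f w <= c].
Proof.
move=> mf; rewrite (_ : [set _ | _] = f @^-1` `]-oo, c]).
  by rewrite -[X in measurable X]setTI; exact: mf.
by apply/seteqP; split => x /=; rewrite in_itv.
Qed.

End level_sets.

(** * Tilting a single coordinate against a small shift *)

Section one_coordinate.
Context {R : realType}.
Notation nu := (@normal_prob R 0 1).
Implicit Types (f g : R -> R) (q p : R).

Lemma one_powR q : 1 `^ q = 1 :> R.
Proof. by rewrite powR1. Qed.

Let H : set R := [set x | 1 <= `|x|].

Let mH : measurable H.
Proof. by apply: measurable_set_ge; mfun. Qed.

(** The power is at least 1 on H and at most 1 off H, and on B it stays below 1 by at least [k].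
    Hence the covariance with the indicator of H is at least k P(H) P(B). *)
Lemma powR_cov_gt0 q : 0 < q ->
  Nexp (\1_H : R -> R) * Nexp (fun x : R => `|x| `^ q) <
  Nexp (fun x : R => `|x| `^ q * \1_H x).
Proof.
move=> q0.
pose B : set R := [set x | `|x| <= 2^-1].
have mB : measurable B by apply: measurable_set_le; mfun.
have eta0 : 0 < Nexp (\1_H : R -> R).
  apply: (@Nexp_indic_gt0 _ _ 1 2) => //; first by rewrite ltr1n.
  move=> x /=; rewrite in_itv/= /H/= => /andP[x1 _].
  by apply: le_trans x1 (ler_norm _).
have B0 : 0 < Nexp (\1_B : R -> R).
  apply: (@Nexp_indic_gt0 _ _ 0 2^-1) => //.
  by move=> x /=; rewrite in_itv/= /B/= => /andP[x0 xB]; rewrite ger0_norm.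
have tf := tame_powR (ltW q0).
have tH := tame_indic mH.
have mcH : measurable (~` H) by apply: measurableC; exact: mH.
have tC := tame_indic mcH.
have tB := tame_indic mB.
pose k : R := 1 - 2^-1 `^ q.
have k0 : 0 < k.
  rewrite subr_gt0 -[ltRHS](one_powR q); apply: gt0_ltr_powR => //.
  - by rewrite nnegrE invr_ge0.
  - by rewrite nnegrE.
  - by rewrite invf_lt1// ltr1n.
have H1 : Nexp (\1_H : R -> R) <= Nexp (fun x : R => `|x| `^ q * \1_H x).
  apply: le_Nexp => //; first exact: tameM.
  move=> x; rewrite indicE; have [|] := boolP (x \in H); last by rewrite mulr0.
  rewrite inE /H/= mulr1 => x1.
  by rewrite -(one_powR q); apply: ge0_ler_powR; rewrite ?nnegrE// ltW.
have HC : Nexp (\1_H : R -> R) + Nexp (\1_(~` H) : R -> R) = 1.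
  rewrite -NexpD// -[RHS](Nexp_cst (ler01 (R := R))); apply: eq_Nexp => x.
  by rewrite !indicE in_setC; case: (x \in H); rewrite (addr0, add0r).
have H2 : Nexp (fun x : R => `|x| `^ q * \1_(~` H) x) + k * Nexp (\1_B : R -> R)
    <= Nexp (\1_(~` H) : R -> R).
  have tfC : tame (fun x : R => `|x| `^ q * \1_(~` H) x) by exact: tameM.
  have tkB : tame (fun x : R => k * \1_B x) by apply: tameZ => //; exact: ltW.
  rewrite -NexpZ//; last exact: ltW.
  rewrite -NexpD//; apply: le_Nexp => //; first exact: tameD.
  move=> x; rewrite !indicE in_setC; have [xH|xH] := boolP (x \in H).
    rewrite mulr0 add0r (_ : x \in B = false) ?mulr0//.
    apply/negbTE; move: xH; rewrite !notin_setE inE /H /B/= => x1.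
    by apply/negP; rewrite -ltNge; apply: lt_le_trans x1; rewrite invf_lt1// ltr1n.
  rewrite mulr1; have [xB|xB] := boolP (x \in B).
    rewrite mulr1 /k addrCA gerDl subr_le0.
    apply: ge0_ler_powR; rewrite ?nnegrE//; first exact: ltW.
    by move: xB; rewrite inE.
  rewrite mulr0 addr0 -[leRHS](one_powR q).
  apply: ge0_ler_powR; rewrite ?nnegrE//; first exact: ltW.
  by move: xH; rewrite notin_setE /H/= => /negP; rewrite -ltNge => /ltW.
have FE : Nexp (fun x : R => `|x| `^ q) = Nexp (fun x : R => `|x| `^ q * \1_H x) +
    Nexp (fun x : R => `|x| `^ q * \1_(~` H) x).
  rewrite -NexpD; [|exact: tameM|exact: tameM]; apply: eq_Nexp => x.
  rewrite -mulrDr !indicE in_setC.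
  by case: (x \in H); rewrite (addr0, add0r) mulr1.
have kB : 0 < k * Nexp (\1_B : R -> R) by exact: mulr_gt0.
have := Nexp_ge0 tC.
rewrite FE; nra.
Qed.

(* For |t| <= 1 the tilt is l = 1 - a (h - E h) with h the indicator of
   |t + x| >= 1: as h is positively correlated with |t + x|^q, this lowers the
   mean by order a at the price of a second moment 1 + O(a ^ 2).  For |t| > 1 the
   term C (t ^ 2 + |t|^p) absorbs everything and l = 1 will do. *)
Lemma tilt_exists q p : 0 < q -> 2 * q <= p ->
  exists gam C : R, [/\ 0 < gam, 0 <= C & forall t a : R, 0 <= a <= 1 ->
    exists (l : R -> R) (m w : R),
    [/\ measurable_fun setT l, (forall x, 0 <= l x) &
     [/\ (\int[nu]_x (l x)%:E = 1)%E,
         (\int[nu]_x (l x ^+ 2)%:E <= (1 + a ^+ 2)%:E)%E,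
         (\int[nu]_x (l x * `|t + x| `^ q)%:E = m%:E)%E,
         (\int[nu]_x (l x * (`|t + x| `^ q) ^+ 2)%:E <= w%:E)%E &
         m <= Nexp (fun x : R => `|x| `^ q) - a * gam + C * (t ^+ 2 + `|t| `^ p) /\
         w <= C * (1 + (t ^+ 2 + `|t| `^ p)) ] ] ].
Proof.
move=> q0 qp.
have q2 : 0 <= 2 * q by rewrite mulr_ge0// ltW.
pose f (x : R) := `|x| `^ q.
pose h : R -> R := \1_H.
have tf : tame f := tame_powR (ltW q0).
have th : tame h := tame_indic mH.
have h01 x : 0 <= h x <= 1 by rewrite /h indicE; case: (_ \in _); rewrite ?ler01 ?lexx.
have hh x : h x ^+ 2 = h x.
  by rewrite /h indicE; case: (_ \in _); rewrite ?expr1n ?expr0n.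
have hN x : h (- x) = h x.
  rewrite /h !indicE; congr (nat_of_bool _)%:R.
  by apply/idP/idP; rewrite !inE /H/= normrN.
have fN x : f (- x) = f x by rewrite /f normrN.
have tfh : tame (fun x => f x * h x) by exact: tameM.
pose gam := Nexp (fun x => f x * h x) - Nexp h * Nexp f.
have gam0 : 0 < gam by rewrite subr_gt0; exact: powR_cov_gt0.
have te := tame_expabs (R := R) 2.
pose c1 := Nexp (fun x => h x * expR (2 * `|x|)).
pose c2 := Nexp (fun x => f x * expR (2 * `|x|)).
have tfe : tame (fun x => f x * expR (2 * `|x|)) by exact: tameM.
have c10 : 0 <= c1 by apply: Nexp_ge0; exact: tameM.
have c20 : 0 <= c2 by exact: Nexp_ge0.
have mu0 : 0 <= Nexp f by exact: Nexp_ge0.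
have eta0 : 0 <= Nexp h by exact: Nexp_ge0.
have eta1 : Nexp h <= 1.
  rewrite -[leRHS](Nexp_cst (ler01 (R := R))); apply: le_Nexp => //.
    exact: tame_cst.
  by move=> x; have /andP[] := h01 x.
pose e1 := 2 * expR (q ^+ 2 / 2).
pose e2 := 2 * expR ((2 * q) ^+ 2 / 2).
have e10 : 0 <= e1 by rewrite mulr_ge0// expR_ge0.
have e20 : 0 <= e2 by rewrite mulr_ge0// expR_ge0.
pose C := (c2 + c1 * Nexp f + c2 + c1 * c2) + (e1 + gam) + 2 * e2.
have C10 : 0 <= c2 + c1 * Nexp f + c2 + c1 * c2 by rewrite !addr_ge0// mulr_ge0.
have C0 : 0 <= C by rewrite /C; pos.
have sqf x : f x ^+ 2 = `|x| `^ (2 * q).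
  by rewrite /f mulrC powRrM powR_mulrn ?powR_ge0.
exists gam, C; split => // t a /andP[a0 a1].
have tft := tame_shift t tf.
have tht := tame_shift t th.
have tX2 : tame (fun x => f (t + x) ^+ 2) by exact: tame_sqr.
have [t1|t1] := leP `|t| 1; last first.
  exists (cst 1), (Nexp (fun x => f (t + x))), (Nexp (fun x => f (t + x) ^+ 2)).
  split => //; split.
  - exact: integral_normal_prob1.
  - under eq_integral do rewrite expr1n.
    by rewrite integral_normal_prob1 lee_fin lerDl sqr_ge0.
  - by under eq_integral do rewrite mul1r; exact: NexpE.
  - by under eq_integral do rewrite mul1r; rewrite NexpE.
  have tE : Num.max 1 `|t| = `|t| by apply/max_idPr; exact: ltW.
  have qq : q <= p by apply: le_trans qp; lra.
  have t2 : 1 <= t ^+ 2.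
    by rewrite -[leRHS]real_normK ?num_real// exprn_ege1// ltW.
  have tqp : `|t| `^ q <= `|t| `^ p by apply: ler_powR => //; exact: ltW.
  (* The second moment of the shifted power grows like |t|^(2q); [2 * q <= p] lets |t|^p control
     it. *)
  have tqp2 : `|t| `^ (2 * q) <= `|t| `^ p by apply: ler_powR => //; exact: ltW.
  have tp0 : 0 <= `|t| `^ p by exact: powR_ge0.
  split.
  - apply: le_trans (Nexp_powR_shift_le _ (ltW q0)) _; rewrite tE -/e1.
    have A1 : `|t| `^ q * e1 <= `|t| `^ p * e1 by rewrite ler_wpM2r.
    have A2 : a * gam <= gam by rewrite ler_piMl// ltW.
    have A3 : (e1 + gam) * (t ^+ 2 + `|t| `^ p) <= C * (t ^+ 2 + `|t| `^ p).
      rewrite ler_wpM2r//; first by rewrite addr_ge0// sqr_ge0.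
      by rewrite /C; have := e20; lra.
    have A4 : gam <= gam * t ^+ 2 by rewrite ler_peMr// ltW.
    have A5 : 0 <= e1 * t ^+ 2 by rewrite mulr_ge0// sqr_ge0.
    have A6 : 0 <= gam * `|t| `^ p by rewrite mulr_ge0// ltW.
    by rewrite -/f; lra.
  - under eq_Nexp do rewrite sqf.
    apply: le_trans (Nexp_powR_shift_le _ q2) _; rewrite tE -/e2.
    have A1 : `|t| `^ (2 * q) * e2 <= `|t| `^ p * e2 by rewrite ler_wpM2r.
    apply: le_trans A1 _; rewrite mulrC; apply: ler_pM => //.
      by rewrite /C; have := C10; lra.
    by have := sqr_ge0 t; lra.
have tE : Num.max 1 `|t| = 1 by apply/max_idPl.
pose eta := Nexp (fun x => h (t + x)).
have et0 : 0 <= eta by exact: Nexp_ge0.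
have et1 : eta <= 1.
  rewrite -[leRHS](Nexp_cst (ler01 (R := R))); apply: le_Nexp => //.
    exact: tame_cst.
  by move=> x; have /andP[] := h01 (t + x).
pose l x := 1 - a * h (t + x) + a * eta.
have l0 x : 0 <= l x.
  have /andP[h0 h1] := h01 (t + x).
  have : a * h (t + x) <= 1 by rewrite mulr_ile1.
  have : 0 <= a * eta by rewrite mulr_ge0.
  by rewrite /l; lra.
have l2 x : l x <= 2.
  have /andP[h0 h1] := h01 (t + x).
  have : 0 <= a * h (t + x) by rewrite mulr_ge0.
  have : a * eta <= 1 by rewrite mulr_ile1.
  by rewrite /l; lra.
have ml : measurable_fun setT l.
  by have mht := tame_measurable tht; rewrite /l; mfun.
have tl : tame l by apply: (tame_le ml l0 _ l2); exact: tame_cst.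
have ae0 : 0 <= a * eta by rewrite mulr_ge0.
have c0 : 0 <= 1 + a * eta by rewrite addr_ge0.
have tlX : tame (fun x => l x * f (t + x)) by exact: tameM.
have tlX2 : tame (fun x => l x * f (t + x) ^+ 2) by exact: tameM.
exists l, (Nexp (fun x => l x * f (t + x))), (Nexp (fun x => l x * f (t + x) ^+ 2)).
split => //; split.
- rewrite NexpE//; congr EFin.
  apply: (@addIr _ (a * eta)); rewrite -{1}(NexpZ a0 tht) -NexpD//; last exact: tameZ.
  by rewrite -[RHS](Nexp_cst c0); apply: eq_Nexp => x; rewrite /l; ring.
- have tl2 : tame (fun x => l x ^+ 2) by exact: tame_sqr.
  rewrite NexpE// lee_fin.
  have k0 : 0 <= 2 * (1 + a * eta) * a by rewrite !mulr_ge0.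
  have E : Nexp (fun x => l x ^+ 2) + 2 * (1 + a * eta) * a * eta =
      (1 + a * eta) ^+ 2 + a ^+ 2 * eta.
    rewrite -(NexpZ k0 tht) -NexpD//; last exact: tameZ.
    rewrite -(NexpZ (sqr_ge0 a) tht) -[X in _ = X + _](Nexp_cst (sqr_ge0 _)).
    rewrite -NexpD//; last 2 first.
    - by apply: tame_cst; exact: sqr_ge0.
    - by apply: tameZ => //; exact: sqr_ge0.
    apply: eq_Nexp => x; rewrite /l -{3}hh; ring.
  have : a ^+ 2 * eta <= a ^+ 2 by rewrite ler_piMr// sqr_ge0.
  have : 0 <= (a * eta) ^+ 2 by exact: sqr_ge0.
  by lra.
- exact: NexpE.
- by rewrite NexpE.
split; last first.
  apply: (@le_trans _ _ (Nexp (fun x => 2 * f (t + x) ^+ 2))).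
    apply: le_Nexp => //; first exact: tameZ.
    by move=> x; rewrite ler_wpM2r// sqr_ge0.
  rewrite NexpZ//.
  have B1 : Nexp (fun x => f (t + x) ^+ 2) <= e2.
    under eq_Nexp do rewrite sqf.
    by have := Nexp_powR_shift_le t q2; rewrite tE one_powR mul1r.
  have B2 : 2 * e2 <= C by rewrite /C; have := C10; lra.
  have B3 : 0 <= t ^+ 2 + `|t| `^ p by rewrite addr_ge0 ?sqr_ge0 ?powR_ge0.
  have : 0 <= C * (t ^+ 2 + `|t| `^ p) by rewrite mulr_ge0.
  by lra.
(* The tilted mean is E F(t + x) + a eta E f(t + x). Since F, f and h are even, each of these
   expectations exceeds its value at t = 0 by O(t^2) only, and at t = 0 the total is E f - a
   [gam]. *)
pose F x := f x * (1 - a * h x).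
have F0 x : 0 <= F x.
  by rewrite mulr_ge0 ?powR_ge0// subr_ge0 mulr_ile1//; have /andP[] := h01 x.
have Ff x : F x <= f x.
  by rewrite ler_piMr ?powR_ge0// gerBl mulr_ge0//; have /andP[] := h01 x.
have mF : measurable_fun setT F.
  have mf' := tame_measurable tf; have mh' := tame_measurable th.
  by rewrite /F; mfun.
have tF : tame F := tame_le mF F0 tf Ff.
have tFt := tame_shift t tF.
have FE : Nexp F = Nexp f - a * Nexp (fun x => f x * h x).
  apply/eqP; rewrite eq_sym subr_eq -NexpZ// -NexpD//; last exact: tameZ.
  by apply/eqP/eq_Nexp => x; rewrite /F; ring.
have mE : Nexp (fun x => l x * f (t + x)) =
    Nexp (fun x => F (t + x)) + a * eta * Nexp (fun x => f (t + x)).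
  rewrite -NexpZ// -NexpD//; last exact: tameZ.
  by apply: eq_Nexp => x; rewrite /F /l; ring.
have FNe x : F (- x) = F x by rewrite /F fN hN.
have b1 := Nexp_even_shift_le tF FNe t1.
have b2 := Nexp_even_shift_le tf fN t1.
have b3 := Nexp_even_shift_le th hN t1.
have b4 : Nexp (fun x => F x * expR (2 * `|x|)) <= c2.
  apply: le_Nexp => //; first exact: tameM.
  by move=> x; rewrite ler_wpM2r// expR_ge0.
have t2 : t ^+ 2 <= 1 by rewrite -[leLHS]real_normK ?num_real// exprn_ile1.
rewrite mE.
apply: (@le_trans _ _ (Nexp f - a * gam + (c2 + c1 * Nexp f + c2 + c1 * c2) * t ^+ 2)); last first.
  rewrite lerD2l.
  have D1 : 0 <= C * `|t| `^ p by rewrite mulr_ge0 ?powR_ge0.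
  have D2 : 0 <= (e1 + gam + 2 * e2) * t ^+ 2.
    by pos.
  rewrite /C in D1 *; move: D1 D2; clear -R; move: (Nexp f) (`|t| `^ p) => N u.
  by move: c1 c2 e1 e2 gam => c1 c2 e1 e2 gam; lra.
have t20 : 0 <= t ^+ 2 := sqr_ge0 t.
have b5 : Nexp (fun x => F (t + x)) <= Nexp f - a * Nexp (fun x => f x * h x) + t ^+ 2 * c2.
  by apply: le_trans b1 _; rewrite FE lerD2l ler_wpM2l.
have b6 : eta * Nexp (fun x => f (t + x)) <= (Nexp h + t ^+ 2 * c1) * (Nexp f + t ^+ 2 * c2).
  exact: (ler_pM et0 (Nexp_ge0 tft) b3 b2).
have b7 : a * (eta * Nexp (fun x => f (t + x))) <= a * ((Nexp h + t ^+ 2 * c1) * (Nexp f + t ^+ 2 * c2)).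
  by rewrite ler_wpM2l.
have b8 : a * (t ^+ 2 * (c1 * Nexp f + Nexp h * c2 + t ^+ 2 * (c1 * c2))) <=
    t ^+ 2 * (c1 * Nexp f + c2 + c1 * c2).
  have G0 : 0 <= c1 * Nexp f + Nexp h * c2 + t ^+ 2 * (c1 * c2).
    by pos.
  apply: (@le_trans _ _ (t ^+ 2 * (c1 * Nexp f + Nexp h * c2 + t ^+ 2 * (c1 * c2)))).
    by rewrite ler_piMl// mulr_ge0.
  rewrite ler_wpM2l// lerD//.
    by rewrite lerD2l ler_piMl.
  by rewrite ler_piMl// mulr_ge0.
rewrite /gam; move: b5 b7 b8; clear -R.
set A := Nexp (fun x => F (t + x)); set B := Nexp (fun x => f (t + x)).
set G := Nexp (fun x => f x * h x); set N := Nexp f; set K := Nexp h.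
move: A B G N K c1 c2 eta => A B G N K c1 c2 eta; lra.
Qed.

End one_coordinate.

(** * Mean and spread of powers of a shifted normal variable *)

Section powR_shift.
Context {R : realType}.
Notation nu := (@normal_prob R 0 1).
Implicit Types (f g : R -> R) (q p r a b : R).

Lemma powR_convex2 r a b : 1 <= r -> 0 <= a -> 0 <= b ->
  ((a + b) / 2) `^ r <= (a `^ r + b `^ r) / 2.
Proof.
move=> r1 a0 b0; have := @convex_powR R r r1.
have h01 : 0 <= (2^-1 : R) <= 1 by rewrite invr_ge0 ler0n invf_le1// ler1n.
move=> /(_ (Itv01 (andP h01).1 (andP h01).2) a b).
rewrite !inE/= !in_itv/= !andbT => /(_ a0 b0).
have oE : 1 - 2^-1 = 2^-1 :> R by field.
rewrite [X in X `^ r](_ : _ = 2^-1 * a + (1 - 2^-1) * b); last exact: convRE.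
rewrite [leRHS](_ : _ = 2^-1 * a `^ r + (1 - 2^-1) * b `^ r); last exact: convRE.
rewrite oE.
by rewrite -!mulrDr !(mulrC 2^-1).
Qed.

Lemma powR_superadd r a b : 1 <= r -> 0 <= a -> 0 <= b ->
  a `^ r + b `^ r <= (a + b) `^ r.
Proof.
move=> r1 a0 b0; have r0 : 0 < r by lra.
rewrite -(mulr_powRB1 a0 r0) -(mulr_powRB1 b0 r0).
rewrite -(mulr_powRB1 (addr_ge0 a0 b0) r0) mulrDl.
by apply: lerD; apply: ler_wpM2l => //; apply: ge0_ler_powR;
  rewrite ?nnegrE; lra.
Qed.

Lemma powR_addl_ge r a b : 1 <= r -> 0 <= a -> 1 <= b ->
  b `^ r + a <= (a + b) `^ r.
Proof.
move=> r1 a0 b1; have r0 : 0 < r by lra.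
have b0 : 0 <= b by lra.
rewrite -(mulr_powRB1 b0 r0) -(mulr_powRB1 (addr_ge0 a0 b0) r0) mulrDl addrC.
have H1 : 1 <= (a + b) `^ (r - 1).
  rewrite -[leLHS](one_powR (r - 1)); apply: ge0_ler_powR; rewrite ?nnegrE; lra.
apply: lerD; first by rewrite ler_peMr.
by apply: ler_wpM2l => //; apply: ge0_ler_powR; rewrite ?nnegrE; lra.
Qed.

(** A mean value bound without derivatives. If b <= a/2, then a - b is already half of a. Otherwise
    ln(a/b) <= a/b - 1 gives (b/a)^r >= 1 - r (a/b - 1), and a/b < 2 costs the factor 2. *)
Lemma powR_diff_le r a b : 1 <= r -> 0 <= b -> b <= a ->
  a `^ r - b `^ r <= 2 * r * (a - b) * a `^ (r - 1).
Proof.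
move=> r1 b0 ba; have r0 : 0 < r by lra.
have a0 : 0 <= a by lra.
have p0 : 0 <= a `^ (r - 1) by exact: powR_ge0.
have [b2|b2] := leP b (a / 2).
  rewrite -(mulr_powRB1 a0 r0).
  apply: (@le_trans _ _ (a * a `^ (r - 1))).
    by rewrite gerBl powR_ge0.
  apply: ler_wpM2r => //; nra.
have bpos : 0 < b by lra.
have apos : 0 < a by lra.
have E : b `^ r = a `^ r * (b / a) `^ r.
  rewrite -powRM//; first by rewrite mulrCA mulfV ?gt_eqF// mulr1.
  by rewrite divr_ge0.
have L : 1 - r * (a / b - 1) <= (b / a) `^ r.
  have ba0 : 0 < b / a by rewrite divr_gt0.
  rewrite /powR gt_eqF//; apply: le_trans (expR_ge1Dx _).
  have -> : ln (b / a) = - ln (a / b) by rewrite -lnV ?invf_div// posrE divr_gt0.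
  rewrite lerD2l mulrN lerN2 ler_wpM2l; [by []|lra|].
  have ab0 : 0 < a / b by rewrite divr_gt0.
  have -> : a / b = 1 + (a / b - 1) by ring.
  rewrite [leRHS](_ : _ = a / b - 1); last by ring.
  by apply: le_ln1Dx; lra.
have ap0 : 0 <= a `^ r by exact: powR_ge0.
rewrite E; apply: (@le_trans _ _ (a `^ r * (r * (a / b - 1)))).
  have := ler_wpM2l ap0 L; lra.
rewrite -(mulr_powRB1 a0 r0).
have -> : a / b - 1 = (a - b) / b by field; rewrite gt_eqF.
have -> : a * a `^ (r - 1) * (r * ((a - b) / b)) =
    (r * (a - b) * a `^ (r - 1)) * (a / b) by field; rewrite gt_eqF.
have -> : 2 * r * (a - b) * a `^ (r - 1) = (r * (a - b) * a `^ (r - 1)) * 2 by ring.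
apply: ler_wpM2l; first by rewrite !mulr_ge0//; lra.
by rewrite ler_pdivrMr//; lra.
Qed.

Lemma sqr_powR_half p (y : R) : (y ^+ 2) `^ (p / 2) = `|y| `^ p.
Proof.
rewrite -[y ^+ 2]real_normK ?num_real// -powR_mulrn// -powRrM.
by congr (_ `^ _); field.
Qed.

(** The noise is symmetric, so |t + x|^p may be averaged with |t - x|^p. The squares of t + x and t
    - x have average t^2 + x^2, so convexity of y^(p/2) bounds the average below by (t^2 +
    x^2)^(p/2). This is used twice: once superadditivity gives |x|^p + |t|^p, once it gives |x|^p
    plus t^2 on the event |x| >= 1. *)
Lemma powR_shift_mean_ge p : 2 <= p -> exists2 c : R, 0 < c &
  forall t : R, Nexp (fun x : R => `|x| `^ p) + c * (t ^+ 2 + `|t| `^ p) <=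
    Nexp (fun x => `|t + x| `^ p).
Proof.
move=> p2; have p0 : 0 <= p by lra.
have r1 : 1 <= p / 2 by lra.
pose H : set R := [set x | 1 <= `|x|].
have mH : measurable H by apply: measurable_set_ge; mfun.
have tH := tame_indic mH.
have eta0 : 0 < Nexp (\1_H : R -> R).
  apply: (@Nexp_indic_gt0 _ _ 1 2) => //; first by rewrite ltr1n.
  move=> x /=; rewrite in_itv/= /H/= => /andP[x1 _].
  by apply: le_trans x1 (ler_norm _).
have eta1 : Nexp (\1_H : R -> R) <= 1.
  rewrite -[leRHS](Nexp_cst (ler01 (R := R))); apply: le_Nexp => //.
  exact: tame_cst.
exists (Nexp (\1_H : R -> R) / 2); first by rewrite divr_gt0.
move=> t; have tf := tame_powR p0.
have tft := tame_shift t tf.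
have tftN : tame (fun x => `|t - x| `^ p).
  have [m0 g0 [C [c HC]]] := tft; split; [by mfun|by move=> x; pos|].
  by exists C, c => x; have := HC (- x); rewrite normrN.
have tp0 : 0 <= `|t| `^ p by exact: powR_ge0.
have EN : Nexp (fun x => `|t - x| `^ p) = Nexp (fun x => `|t + x| `^ p).
  exact: (NexpN tft).
have k1 : 0 <= t ^+ 2 by exact: sqr_ge0.
have tk1 : tame (fun x => t ^+ 2 * \1_H x) by exact: tameZ.
have tk2 : tame (fun x => t ^+ 2 * \1_H x + `|t| `^ p).
  exact: tameD tk1 (tame_cst tp0).
have tk3 : tame (fun x => 2 * `|x| `^ p) by exact: tameZ.
have : Nexp (fun x : R => 2 * `|x| `^ p + (t ^+ 2 * \1_H x + `|t| `^ p)) <=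
    Nexp (fun x => `|t + x| `^ p + `|t - x| `^ p).
  apply: le_Nexp; [exact: tameD|exact: tameD|].
  move=> x.
  have C2 := powR_convex2 r1 (sqr_ge0 (t + x)) (sqr_ge0 (t - x)).
  have E2 : ((t + x) ^+ 2 + (t - x) ^+ 2) / 2 = t ^+ 2 + x ^+ 2 by field.
  rewrite E2 !sqr_powR_half in C2.
  have S1 := powR_superadd r1 (sqr_ge0 t) (sqr_ge0 x).
  rewrite !sqr_powR_half in S1.
  clear tk1 tk2 tk3 EN tftN tft tf eta1 eta0 tH.
  have S2 : `|x| `^ p + t ^+ 2 * \1_H x <= (t ^+ 2 + x ^+ 2) `^ (p / 2).
    rewrite indicE; have [|] := boolP (x \in H); last first.
      by rewrite mulr0 addr0 => _; apply: (le_trans _ S1); rewrite lerDr.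
    rewrite inE /H/= mulr1 => x1; rewrite -(sqr_powR_half p x).
    apply: powR_addl_ge => //.
    by rewrite -[leRHS]real_normK ?num_real// exprn_ege1.
  lra.
rewrite (NexpD tk3 tk2) (NexpD tk1 (tame_cst tp0)) (NexpD tft tftN).
rewrite (NexpZ (ler0n R 2) tf) (NexpZ k1 tH) (Nexp_cst tp0) EN.
move: (ler_piMl tp0 eta1); clear -R.
set A := Nexp (fun x : R => `|x| `^ p); set B := Nexp (fun x => `|t + x| `^ p).
set h := Nexp _; set u := `|t| `^ p.
move: A B h u => A B h u; lra.
Qed.

(** The centre is the noiseless value |t|^p, so that a mean value bound applies directly. The
    increment is of order max(1, |t|)^(p-1), one power of |t| below |t|^p itself; this gap makes the
    standard deviation negligible against the signal. *)
Lemma powR_shift_var_le p : 1 <= p -> exists2 C : R, 0 <= C &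
  forall t : R,
    (\int[nu]_x ((`|t + x| `^ p - `|t| `^ p) ^+ 2)%:E <=
     (C * Num.max 1 `|t| `^ (2 * p - 2))%:E)%E.
Proof.
move=> p1; exists (4 * p ^+ 2 * (2 * expR ((2 * p) ^+ 2 / 2))).
  by pos.
move=> t; set Th := Num.max 1 `|t|.
have Th1 : 1 <= Th by rewrite le_max lexx.
have Th0 : 0 <= Th by lra.
rewrite mulrAC.
apply: Nexp_dominated; [by mfun|by move=> x; pos|] => x.
have dif : `| `|t + x| `^ p - `|t| `^ p| <=
    2 * p * Th `^ (p - 1) * expR (p * `|x|).
  have xe : `|x| <= expR `|x| by apply: le_trans (expR_ge1Dx _); lra.
  have e1 : 1 <= expR `|x| by rewrite -expR0 ler_expR.
  have main a b : 0 <= b -> b <= a -> a <= Th * expR `|x| -> a - b <= `|x| ->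
      `|a `^ p - b `^ p| <= 2 * p * Th `^ (p - 1) * expR (p * `|x|).
    move=> b0 ba aTh abx; have a0 : 0 <= a by lra.
    rewrite ger0_norm; last first.
      by rewrite subr_ge0; apply: ge0_ler_powR; rewrite ?nnegrE; lra.
    apply: (le_trans (powR_diff_le p1 b0 ba)).
    have -> : 2 * p * Th `^ (p - 1) * expR (p * `|x|) =
       2 * p * expR `|x| * (Th `^ (p - 1) * expR `|x| `^ (p - 1)).
      have -> : expR (p * `|x|) = expR `|x| * expR `|x| `^ (p - 1).
        rewrite -expRM -expRD; congr expR; ring.
      ring.
    apply: ler_pM; rewrite ?powR_ge0 ?mulr_ge0//; try lra.
      apply: ler_wpM2l; lra.
    rewrite -powRM ?expR_ge0//; apply: ge0_ler_powR; rewrite ?nnegrE ?mulr_ge0 ?expR_ge0//.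
    lra.
  have tTh : `|t| <= Th by rewrite /Th le_max lexx orbT.
  have := abs_shift_le t x; rewrite -/Th => txT.
  have [tx|tx] := leP `|t| `|t + x|.
    apply: main => //.
    by have := ler_normD t x; lra.
  rewrite distrC; apply: main; [by []|exact: ltW| |].
    by apply: (le_trans tTh); rewrite ler_peMr.
  by have := ler_normB (t + x) x; rewrite addrK; lra.
rewrite -[leLHS]real_normK ?num_real//.
have -> : 4 * p ^+ 2 * Th `^ (2 * p - 2) * expR (2 * p * `|x|) =
   (2 * p * Th `^ (p - 1) * expR (p * `|x|)) ^+ 2.
  have -> : 2 * p - 2 = (p - 1) * 2%:R by ring.
  rewrite powRrM powR_mulrn ?powR_ge0//.
  have -> : expR (2 * p * `|x|) = expR (p * `|x|) ^+ 2.
    by rewrite expr2 -expRD; congr expR; ring.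
  ring.
by rewrite lerXn2r// nnegrE; pos; lra.
Qed.

End powR_shift.

(** * Power sums of shifted noise *)

Section power_sums.
Context {disp : measure_display} {T : measurableType disp} {R : realType}.
Context {P : probability T R} {eps : nat -> {RV P >-> R}}.
Hypothesis eps_iid : iid_std_normal eps.
Notation nu := (@normal_prob R 0 1).
Implicit Types (q p r : R) (n : nat).

Definition psum q n (x : 'rV[R]_n) : R := \sum_(i < n) `|x 0 i| `^ q.

(** The quantity D of the overview. *)
Definition signal p n (t : 'rV[R]_n) : R :=
  \sum_(i < n) (t 0 i ^+ 2 + `|t 0 i| `^ p).

Notation mom q := (Nexp (fun x : R => `|x| `^ q)).

Lemma psum_noiseE q n (t : 'rV[R]_n) w :
  psum q (t + noise eps n w) = \sum_(i < n) `|t 0 i + eps i w| `^ q.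
Proof. by apply: eq_bigr => i _; rewrite !mxE. Qed.

Lemma signal_ge0 p n (t : 'rV[R]_n) : 0 <= signal p t.
Proof. by apply: sumr_ge0 => i _; rewrite addr_ge0 ?sqr_ge0 ?powR_ge0. Qed.

Lemma sumr_const_natl n (k : R) : \sum_(i < n) k = n%:R * k.
Proof. by rewrite sumr_const card_ord mulr_natl. Qed.

Lemma psum_null_deviation q : 0 < q -> exists2 V : R, 0 <= V &
  forall n r (A : set T), (0 < n)%N -> 0 < r -> measurable A ->
  (forall w, A w -> r * Num.sqrt n%:R <=
     `|psum q (noise eps n w) - n%:R * mom q|) ->
  (P A <= (V / r ^+ 2)%:E)%E.
Proof.
move=> q0; have tf := tame_powR (ltW q0).
have tf2 := tame_sqr tf.
exists (Nexp (fun x : R => (`|x| `^ q) ^+ 2)); first exact: Nexp_ge0.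
move=> n r A n0 r0 mA Ar.
have sn0 : 0 < Num.sqrt n%:R :> R by rewrite sqrtr_gt0 ltr0n.
have nr0 : 0 < n%:R :> R by rewrite ltr0n.
have H : (P A <= (\sum_(i < n) Nexp (fun x : R => (`|x| `^ q) ^+ 2) /
    (r * Num.sqrt n%:R) ^+ 2)%:E)%E.
  apply: (@chebyshev_eps _ _ _ _ _ eps_iid n (fun i x => `|x| `^ q) (fun=> 0)
    (fun=> mom q) (fun=> Nexp (fun x : R => (`|x| `^ q) ^+ 2))
    (r * Num.sqrt n%:R)) => //.
  - by move=> i; mfun.
  - by move=> i; exact: NexpE.
  - by move=> i; under eq_integral do rewrite subr0; rewrite NexpE.
  - by rewrite mulr_gt0.
  - move=> w /Ar; rewrite sumr_const_natl /psum.
    by rewrite (eq_bigr (fun i : 'I_n => `|eps i w| `^ q))// => i _; rewrite mxE.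
apply: (le_trans H); rewrite lee_fin sumr_const_natl exprMn sqr_sqrtr ?ler0n//.
rewrite le_eqVlt; apply/orP; left; apply/eqP; field.
by rewrite !gt_eqF.
Qed.

Lemma psum_low_prob q p (K C0 : R) : 0 < q -> 2 * q <= p -> 0 <= K -> 0 <= C0 ->
  exists2 b : R, 0 < b & exists N : nat, forall n (t : 'rV[R]_n) (A : set T),
  (N <= n)%N -> signal p t <= K * Num.sqrt n%:R -> measurable A ->
  (forall w, psum q (t + noise eps n w) < n%:R * mom q - C0 * Num.sqrt n%:R ->
     A w) ->
  (b%:E <= P A)%E.
Proof.
move=> q0 qp K0 C00.
have [gam [C [gam0 Cge0 tilt]]] := tilt_exists q0 qp.
(* Chosen so that the total second moment, at most C (1 + K) n, is at most (rho sqrt n)^2 / 2, as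
   the tilted bound with radius rho sqrt n requires. *)
pose rho := 2 * (C * (1 + K)) + 1.
have CK0 : 0 <= C * (1 + K) by rewrite mulr_ge0// addr_ge0.
have rho1 : 1 <= rho by rewrite /rho; lra.
(* The tilt of size a0 / sqrt n lowers the total mean by a0 [gam] sqrt n. The three terms pay, in
   units of sqrt n, for the signal, for the radius of the deviation bound and for the slack in the
   critical value. *)
pose a0 := (C * K + rho + C0) / gam.
have a00 : 0 <= a0.
  by rewrite /a0 divr_ge0 ?(ltW gam0)// !addr_ge0// ?mulr_ge0//; lra.
exists (4 * expR (a0 ^+ 2))^-1; first by rewrite invr_gt0 mulr_gt0 ?expR_gt0.
exists (Num.truncn (a0 ^+ 2)).+1 => n t A Nn tK mA AS.
have nA : a0 ^+ 2 <= n%:R.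
  apply: le_trans (ltW (truncnS_gt _)) _; by rewrite ler_nat.
have n0 : (0 < n)%N by apply: leq_trans Nn.
have nr0 : 0 < n%:R :> R by rewrite ltr0n.
pose s := Num.sqrt n%:R : R.
have s0 : 0 < s by rewrite sqrtr_gt0.
have ss : s ^+ 2 = n%:R by rewrite sqr_sqrtr// ltW.
have s1 : 1 <= s by rewrite -sqrtr1 ler_wsqrtr// ler1n.
have as1 : 0 <= a0 / s <= 1.
  rewrite divr_ge0 ?(ltW s0)//= ler_pdivrMr// mul1r.
  by rewrite -(ler_pXn2r (n := 2))// ?nnegrE ?ss// ltW.
have /choice [l /choice [m /choice [w lmw]]] := fun i : 'I_n => tilt (t 0 i) _ as1.
have Sm : \sum_(i < n) m i <= n%:R * mom q - (rho + C0) * s.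
  apply: (@le_trans _ _ (\sum_(i < n) (mom q - a0 / s * gam + C *
     (t 0 i ^+ 2 + `|t 0 i| `^ p)))).
    by apply: ler_sum => i _; have [_ _ [_ _ _ _ []]] := lmw i.
  rewrite big_split/= sumr_const_natl -mulr_sumr -/(signal p t).
  have -> : n%:R * (mom q - a0 / s * gam) =
      n%:R * mom q - (C * K + rho + C0) * s.
    by rewrite -ss /a0; field; rewrite !gt_eqF.
  have := ler_wpM2l Cge0 tK; rewrite -/s; lra.
have Sw : \sum_(i < n) w i <= (rho * s) ^+ 2 / 2.
  apply: (@le_trans _ _ (\sum_(i < n) (C * (1 +
     (t 0 i ^+ 2 + `|t 0 i| `^ p))))).
    by apply: ler_sum => i _; have [_ _ [_ _ _ _ []]] := lmw i.
  rewrite -mulr_sumr big_split/= sumr_const_natl mulr1 -/(signal p t).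
  rewrite exprMn ss.
  have k1 : signal p t <= K * n%:R.
    apply: (le_trans tK); rewrite ler_wpM2l// -/s -ss expr2.
    by rewrite ler_peMr// ltW.
  have k2 : C * (n%:R + signal p t) <= C * (1 + K) * n%:R.
    by rewrite -mulrA ler_wpM2l//; lra.
  apply: (le_trans k2).
  rewrite (mulrAC (rho ^+ 2)); apply: ler_wpM2r; first exact: ltW.
  have : rho <= rho ^+ 2 by rewrite expr2 ler_peMr//; lra.
  by rewrite /rho; lra.
have ml i : measurable_fun setT (l i) by have [] := lmw i.
have l0 i x : 0 <= l i x by have [] := lmw i.
have l1 i : (\int[nu]_x (l i x)%:E = 1)%E by have [_ _ []] := lmw i.
have l2 i : (\int[nu]_x (l i x ^+ 2)%:E <= (1 + (a0 / s) ^+ 2)%:E)%E.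
  by have [_ _ []] := lmw i.
have lX i : (\int[nu]_x (l i x * `|t 0 i + x| `^ q)%:E = (m i)%:E)%E.
  by have [_ _ []] := lmw i.
have lX2 i : (\int[nu]_x (l i x * (`|t 0 i + x| `^ q) ^+ 2)%:E <= (w i)%:E)%E.
  by have [_ _ []] := lmw i.
have := @tilted_lower_bound _ _ _ _ _ eps_iid n l (fun i x => `|t 0 i + x| `^ q)
  m w ((a0 / s) ^+ 2) (rho * s) A ml l0 _ _ l1 l2 lX lX2 _ Sw mA _ (sqr_ge0 _).
move=> H; apply: le_trans (H _ _ _ _); last 4 first.
- by move=> i; mfun.
- by move=> i x; pos.
- by rewrite mulr_gt0//; lra.
- move=> y; rewrite -psum_noiseE ltr_norml => /andP[_ yS].
  by apply: AS; rewrite -/s; lra.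
rewrite lee_fin lef_pV2 ?posrE ?mulr_gt0 ?expR_gt0 ?exprn_gt0//; last first.
  by rewrite ltr_wpDr ?sqr_ge0.
rewrite ler_wpM2l//.
apply: (@le_trans _ _ (expR ((a0 / s) ^+ 2) ^+ n)).
  by apply: lerXn2r; rewrite ?nnegrE ?expR_ge0 ?addr_ge0 ?sqr_ge0// expR_ge1Dx.
rewrite -expRM_natl; rewrite ler_expR le_eqVlt; apply/orP; left; apply/eqP.
by rewrite exprMn exprVn ss; field; rewrite gt_eqF.
Qed.

(** Every |t_i|^p is at most D, so |t_i|^(2p-2) <= D^((p-2)/p) |t_i|^p, and summation gives D^(2 -
    2/p). The factor D^(-2/p) gained over D^2 is what makes Chebyshev's inequality effective for
    large D. *)
Lemma sum_max_powR_le p n (t : 'rV[R]_n) : 2 <= p ->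
  \sum_(i < n) Num.max 1 `|t 0 i| `^ (2 * p - 2) <=
  n%:R + signal p t ^+ 2 * signal p t `^ (- (2 / p)).
Proof.
move=> p2; have p0 : 0 < p by lra.
set D := signal p t.
have D0 : 0 <= D by exact: signal_ge0.
have tD i : `|t 0 i| `^ p <= D.
  rewrite /D /signal (bigD1 i)//=.
  have h1 : 0 <= \sum_(j < n | j != i) (t 0 j ^+ 2 + `|t 0 j| `^ p).
    by apply: sumr_ge0 => j _; rewrite addr_ge0 ?sqr_ge0 ?powR_ge0.
  by have := sqr_ge0 (t 0 i); lra.
have tDp : \sum_(i < n) `|t 0 i| `^ p <= D.
  by apply: ler_sum => i _; rewrite lerDr sqr_ge0.
have e0 : 0 <= (p - 2) / p by rewrite divr_ge0//; lra.
apply: (@le_trans _ _ (\sum_(i < n) (1 + D `^ ((p - 2) / p) * `|t 0 i| `^ p))).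
  apply: ler_sum => i _.
  have P0 : 0 <= D `^ ((p - 2) / p) * `|t 0 i| `^ p by rewrite mulr_ge0 ?powR_ge0.
  have [t1|t1] := leP `|t 0 i| 1; first by rewrite one_powR lerDl.
  have tpos : 0 < `|t 0 i| by lra.
  have -> : 2 * p - 2 = (p - 2) + p by ring.
  rewrite powRD; last by rewrite gt_eqF//=; lra.
  apply: (@le_trans _ _ (D `^ ((p - 2) / p) * `|t 0 i| `^ p)); last by rewrite lerDr.
  rewrite ler_wpM2r ?powR_ge0//.
  have -> : `|t 0 i| `^ (p - 2) = (`|t 0 i| `^ p) `^ ((p - 2) / p).
    by rewrite -powRrM; congr (_ `^ _); field; rewrite gt_eqF.
  by apply: ge0_ler_powR; rewrite ?nnegrE ?powR_ge0.
rewrite big_split/= sumr_const_natl mulr1 lerD2l -mulr_sumr.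
apply: (@le_trans _ _ (D `^ ((p - 2) / p) * D)).
  by rewrite ler_wpM2l ?powR_ge0.
have [->|Dn0] := eqVneq D 0; first by rewrite mulr0 expr0n/= mul0r.
rewrite -[X in _ * X](powRr1 D0) -powR_mulrn// -!powRD ?Dn0 ?implybT//.
by rewrite le_eqVlt; apply/orP; left; apply/eqP; congr (_ `^ _); field; rewrite gt_eqF.
Qed.

Lemma psum_high_prob p (C1 e : R) : 2 <= p -> 0 <= C1 -> 0 < e ->
  exists2 K : R, 0 < K & forall n (t : 'rV[R]_n) (A : set T),
  (0 < n)%N -> K * Num.sqrt n%:R <= signal p t -> measurable A ->
  (forall w, A w -> psum p (t + noise eps n w) < n%:R * mom p + C1 * Num.sqrt n%:R) ->
  (P A <= e%:E)%E.
Proof.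
move=> p2 C10 e0; have p0 : 0 < p by lra.
have p1 : 1 <= p by lra.
have [c c0 mean] := powR_shift_mean_ge p2.
have [C Cge0 var] := powR_shift_var_le p1.
(* The second condition makes C1 sqrt n at most half of the gain c D in mean, leaving a margin r = c
   D / 2. The third gives 2 C K^(-2/p) <= e c^2 / 4, so that the variance bound is at most e r^2.
   With K >= 1, the term n <= D^2 / K^2 is also at most D^2 K^(-2/p). *)
have [K [K1 K2 K3]] : exists K, [/\ 1 <= K, 2 * C1 / c <= K &
    (8 * C / (c ^+ 2 * e)) `^ (p / 2) <= K].
  exists (Num.max 1 (Num.max (2 * C1 / c) ((8 * C / (c ^+ 2 * e)) `^ (p / 2)))).
  by split; rewrite !le_max lexx ?orbT.
have K0 : 0 <= K := le_trans ler01 K1.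
have c20 : 0 < c ^+ 2 by rewrite exprn_gt0.
have k0 : 0 <= 8 * C / (c ^+ 2 * e) by rewrite divr_ge0 ?mulr_ge0// ltW.
exists K; first lra.
move=> n t A n0 Kt mA AS.
have nr0 : 0 < n%:R :> R by rewrite ltr0n.
pose s := Num.sqrt n%:R : R.
have s0 : 0 < s by rewrite sqrtr_gt0.
have ss : s ^+ 2 = n%:R by rewrite sqr_sqrtr// ltW.
have s1 : 1 <= s by rewrite -sqrtr1 ler_wsqrtr// ler1n.
set D := signal p t.
have DK : K <= D by apply: le_trans Kt; rewrite ler_peMr//; lra.
have D0 : 0 < D by lra.
have tft (u : R) : tame (fun x => `|u + x| `^ p).
  exact: (tame_shift u (tame_powR (ltW p0))).
pose m i := Nexp (fun x => `|t 0 i + x| `^ p).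
have Sm : n%:R * mom p + c * D <= \sum_(i < n) m i.
  rewrite /D /signal mulr_sumr -sumr_const_natl -big_split/=.
  by apply: ler_sum => i _; exact: mean.
have C1D : C1 * s <= c * D / 2.
  have : C1 * s <= K * c / 2 * s.
    by rewrite ler_wpM2r ?(ltW s0)//; move: K2; rewrite ler_pdivrMr//; lra.
  have : K * s * c <= D * c by rewrite ler_wpM2r// ltW.
  lra.
pose r := c * D / 2.
have r0 : 0 < r by rewrite divr_gt0// mulr_gt0.
have := @chebyshev_eps _ _ _ _ _ eps_iid n (fun i x => `|t 0 i + x| `^ p)
  (fun i => `|t 0 i| `^ p) m (fun i => C * Num.max 1 `|t 0 i| `^ (2 * p - 2))
  r A.
move=> H; apply: le_trans (H _ _ _ _ _ _ _ _) _ => //.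
- by move=> i; mfun.
- by move=> i; exact: NexpE.
- move=> w /AS; rewrite psum_noiseE -/s => wS.
  by rewrite distrC ler_normr; apply/orP; left; rewrite /r; lra.
rewrite lee_fin -mulr_suml -mulr_sumr ler_pdivrMr ?exprn_gt0//.
have V := sum_max_powR_le t p2; rewrite -/D in V.
have nD : n%:R <= D ^+ 2 * K^-1 ^+ 2.
  rewrite exprVn ler_pdivlMr ?exprn_gt0//; last lra.
  rewrite -ss mulrC -exprMn lerXn2r// nnegrE; last exact: ltW.
  by rewrite mulr_ge0// ltW.
have KV : K^-1 ^+ 2 <= K `^ (- (2 / p)).
  have -> : K^-1 ^+ 2 = K `^ (- 2) :> R.
    by rewrite powRN powR_mulrn ?exprVn//; lra.
  apply: ler_powR => //; rewrite lerN2 ler_pdivrMr//; lra.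
have DV : D `^ (- (2 / p)) <= K `^ (- (2 / p)).
  rewrite !powRN lef_pV2 ?posrE ?powR_gt0//; last lra.
  have p20 : 0 <= 2 / p by rewrite divr_ge0// ltW.
  exact: (ge0_ler_powR p20 K0 (ltW D0) DK).
have KE : C * (2 * K `^ (- (2 / p))) <= e * c ^+ 2 / 4.
  rewrite powRN.
  have Kp : 8 * C / (c ^+ 2 * e) <= K `^ (2 / p).
    have -> : 8 * C / (c ^+ 2 * e) = ((8 * C / (c ^+ 2 * e)) `^ (p / 2)) `^ (2 / p).
      rewrite -powRrM (_ : p / 2 * (2 / p) = 1) ?powRr1//.
      by field; rewrite gt_eqF.
    have p20 : 0 <= 2 / p by rewrite divr_ge0// ltW.
    exact: (ge0_ler_powR p20 (powR_ge0 _ _) K0 K3).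
  have Kpos : 0 < K by exact: lt_le_trans K1.
  have Kp0 : 0 < K `^ (2 / p) by rewrite powR_gt0.
  rewrite mulrA ler_pdivrMr//.
  move: Kp; rewrite ler_pdivrMr ?mulr_gt0//; lra.
have D20 : 0 <= D ^+ 2 by exact: sqr_ge0.
have k1 := ler_wpM2l D20 KV.
have k2 := ler_wpM2l D20 DV.
have k3 : C * (\sum_(i < n) Num.max 1 `|t 0 i| `^ (2 * p - 2)) <=
    C * (D ^+ 2 * (2 * K `^ (- (2 / p)))).
  by rewrite ler_wpM2l//; lra.
have k4 := ler_wpM2l D20 KE.
apply: (le_trans k3).
rewrite /r; lra.
Qed.

End power_sums.

(** * Measurability and rejection probabilities of the tests *)

Section measurability.
Context {R : realType} {d} {Y : measurableType d}.

Lemma measurable_bigmax (I : Type) (s : seq I) (f : I -> Y -> R) :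
  (forall i, measurable_fun setT (f i)) ->
  measurable_fun setT (fun y => \big[Num.max/0]_(i <- s) f i y).
Proof.
move=> mf; elim: s => [|i s IH].
  by under eq_fun do rewrite big_nil; exact: measurable_cst.
by under eq_fun do rewrite big_cons; exact: measurable_maxr.
Qed.

Lemma measurable_pnorm (p : \bar R) n (F : Y -> 'rV[R]_n) :
  (forall i, measurable_fun setT (fun y => F y 0 i)) ->
  measurable_fun setT (fun y => pnorm p (F y)).
Proof.
move=> mF; case: p => [r||] /=.
- apply: (measurableT_comp (measurable_powR _)).
  by apply: measurable_sum => i; mfun.
- by apply: measurable_bigmax => i; mfun.
- exact: measurable_cst.
Qed.

Lemma measurable_max_pnorm (p : nat -> R) (m : nat) (k : nat -> R) n
    (F : Y -> 'rV[R]_n) :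
  (forall i, measurable_fun setT (fun y => F y 0 i)) ->
  measurable_fun setT (fun y => \big[Num.max/0]_(1 <= j < m.+1)
    ((k j)^-1 * pnorm (p j)%:E (F y))).
Proof.
move=> mF; apply: measurable_bigmax => j.
by apply: measurable_funM; [exact: measurable_cst|exact: measurable_pnorm].
Qed.

Lemma measurable_natr_ge (f : Y -> R) (c : R) : measurable_fun setT f ->
  measurable_fun setT (fun y => (c <= f y)%R%:R : R).
Proof.
move=> mf; rewrite (_ : (fun _ => _) = \1_[set y | c <= f y]).
  exact/measurable_indic/measurable_set_ge.
apply/funext => y; rewrite indicE; congr (nat_of_bool _)%:R.
by apply/idP/idP; rewrite inE.
Qed.

End measurability.

Lemma borel_coord (R : realType) n (i : 'I_n) :
  measurable_fun [set: g_sigma_algebraType (@open 'rV[R]_n)]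
    (fun x : g_sigma_algebraType (@open 'rV[R]_n) => (x : 'rV[R]_n) 0 i).
Proof.
apply: (measurability _ (RGenOInfty.measurableE R)) => _ [_ [x ->] <-].
rewrite setTI; apply: sub_gen_smallest.
apply: (@open_comp _ _ (fun M : 'rV[R]_n => M 0 i)).
  by move=> M _; exact: coord_continuous.
exact: interval_open.
Qed.

Lemma max_pnorm_test_is_test (R : realType) (p : nat -> R) m kappas c :
  is_test_seq (max_pnorm_test p m kappas c).
Proof.
move=> n n0; split; last first.
  by move=> x; rewrite /max_pnorm_test; case: (c n <= _); rewrite /= ?lexx ler01.
apply: measurable_natr_ge; apply: measurable_max_pnorm => i.
exact: borel_coord.
Qed.

Section expectation_of_tests.
Context {d : measure_display} {T : measurableType d} {R : realType}.
Variable P : probability T R.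

Lemma expectation_bool (b : T -> bool) : measurable [set w | b w] ->
  ('E_P[fun w => (b w)%:R : R] = P [set w | b w])%E.
Proof.
move=> mb; rewrite expectation.unlock -(setIT [set w | b w]) -integral_indic//.
apply: eq_integral => w _; rewrite indicE; congr ((nat_of_bool _)%:R%:E).
by apply/idP/idP; rewrite inE.
Qed.

Lemma cvge_near_gt (f : nat -> \bar R) (a r : R) :
  f n @[n --> \oo] --> a%:E -> r < a -> \forall n \near \oo, (r%:E < f n)%E.
Proof.
move=> fa ra; apply: (fa [set y | (r%:E < y)%E]).
by apply: open_nbhs_nbhs; split; [exact: open_ereal_gt_ereal|rewrite /= lte_fin].
Qed.

Lemma cvge_near_lt (f : nat -> \bar R) (a r : R) :
  f n @[n --> \oo] --> a%:E -> a < r -> \forall n \near \oo, (f n < r%:E)%E.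
Proof.
move=> fa ra; apply: (fa [set y | (y < r%:E)%E]).
by apply: open_nbhs_nbhs; split; [exact: open_ereal_lt_ereal|rewrite /= lte_fin].
Qed.

Lemma probability_setC_fine (A : set T) : measurable A ->
  (P (~` A) = (1 - fine (P A))%:E)%E.
Proof.
move=> mA; rewrite probability_setC// EFinB fineK//.
exact: fin_num_measure.
Qed.

Lemma probability_cvg1 (A : nat -> set T) : (forall n, measurable (A n)) ->
  (forall e, 0 < e -> \forall n \near \oo, (P (~` A n) <= e%:E)%E) ->
  P (A n) @[n --> \oo] --> 1%E.
Proof.
move=> mA H; apply: cvg_EFin.
  by apply: nearW => n; exact: fin_num_measure.
apply/cvgrPdist_le => e e0; have := H e e0; apply: filterS => n.
rewrite probability_setC_fine// lee_fin /= => An.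
rewrite ger0_norm//.
by rewrite subr_ge0 -lee_fin fineK ?fin_num_measure// probability_le1.
Qed.

End expectation_of_tests.

Lemma pnorm_fin_ge (R : realType) n (q k : R) (x : 'rV[R]_n) : 0 < q -> 0 < k ->
  (k <= pnorm q%:E x) = (k `^ q <= psum q x).
Proof.
move=> q0 k0 /=; rewrite -/(psum q x).
have S0 : 0 <= psum q x by apply: sumr_ge0 => i _; exact: powR_ge0.
have kE : k = (k `^ q) `^ q^-1.
  by rewrite -powRrM mulfV ?gt_eqF// powRr1// ltW.
apply/idP/idP => [|kS]; last first.
  rewrite [leLHS]kE; apply: ge0_ler_powR; rewrite ?nnegrE ?powR_ge0//.
  by rewrite invr_ge0 ltW.
apply: contraTT; rewrite -!ltNge => Sk; rewrite [ltRHS]kE.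
by apply: gt0_ltr_powR; rewrite ?nnegrE ?powR_ge0// invr_gt0.
Qed.

(** * Norms with finite exponent *)

Section finite_norms.
Context {disp : measure_display} {T : measurableType disp} {R : realType}.
Context {P : probability T R} {eps : nat -> {RV P >-> R}}.
Hypothesis eps_iid : iid_std_normal eps.
Notation nu := (@normal_prob R 0 1).
Notation mom q := (Nexp (fun x : R => `|x| `^ q)).
Implicit Types (q p : R).

Lemma measurable_noise n (t : 'rV[R]_n) i :
  measurable_fun setT (fun w => (t + noise eps n w) 0 i).
Proof.
under eq_fun do rewrite !mxE.
by apply: measurable_funD; [exact: measurable_cst|exact: measurable_eps].
Qed.

Lemma measurable_pnorm_noise (p : \bar R) n (t : 'rV[R]_n) :
  measurable_fun setT (fun w => pnorm p (t + noise eps n w)).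
Proof. by apply: measurable_pnorm => i; exact: measurable_noise. Qed.

Lemma measurable_reject (p : \bar R) n (t : 'rV[R]_n) (k : R) :
  measurable [set w | k <= pnorm p (t + noise eps n w)].
Proof. by apply: measurable_set_ge; exact: measurable_pnorm_noise. Qed.

Lemma pnorm_test_expectation (p : \bar R) (k : nat -> R) n (t : 'rV[R]_n) :
  ('E_P[fun w => (pnorm_test p k n (t + noise eps n w))%R] =
   P [set w | (k n <= pnorm p (t + noise eps n w))%R])%E.
Proof. by rewrite expectation_bool//; exact: measurable_reject. Qed.

Lemma noise0 n w : noise eps n w = 0 + noise eps n w.
Proof. by rewrite add0r. Qed.

(** If the critical value lay further below the null mean, acceptance would be a deviation of more
    than C sqrt n, of probability at most e by Chebyshev. The test would then reject with
    probability at least 1 - e, which exceeds its limiting size. *)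
Lemma crit_lower q (k : nat -> R) (a : R) : 0 < q -> a < 1 ->
  P [set w | (k n <= pnorm q%:E (noise eps n w))%R] @[n --> \oo] --> a%:E ->
  exists2 C : R, 0 <= C & \forall n \near \oo,
    0 < k n /\ n%:R * mom q - C * Num.sqrt n%:R <= k n `^ q.
Proof.
move=> q0 a1 ka; have [V V0 dev] := psum_null_deviation eps_iid q0.
pose e := (1 - a) / 2.
have e0 : 0 < e by rewrite /e; lra.
(* From C >= 1 and C e >= V one gets V / C^2 <= e. *)
pose C := V / e + 1.
have Ve0 : 0 <= V / e by rewrite divr_ge0// ltW.
have C1 : 1 <= C by rewrite /C; lra.
exists C; first lra.
have ae1 : a < 1 - e by rewrite /e; lra.
near=> n.
have n0 : (0 < n)%N by near: n; exact: nbhs_infty_gt.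
have kn : (P [set w | (k n <= pnorm q%:E (noise eps n w))%R] < (1 - e)%:E)%E.
  by near: n; exact: cvge_near_lt ka ae1.
have mk : measurable [set w | (k n <= pnorm q%:E (noise eps n w))%R].
  under eq_set do rewrite noise0.
  exact: measurable_reject.
(* A nonpositive critical value rejects everywhere, which is incompatible with a size below 1. *)
have k0 : 0 < k n.
  rewrite ltNge; apply/negP => k0; move: kn.
  have -> : [set w | (k n <= pnorm q%:E (noise eps n w))%R] = setT.
    apply/seteqP; split => // w _ /=.
    by apply: (le_trans k0); exact: powR_ge0.
  by rewrite probability_setT lte_fin; lra.
split => //; rewrite leNgt; apply/negP => kq.
have : (P (~` [set w | (k n <= pnorm q%:E (noise eps n w))%R]) <= (V / C ^+ 2)%:E)%E.
  apply: (dev n C) => //; first lra; first exact: measurableC.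
  move=> w /= /negP; rewrite -/(pnorm q%:E _) pnorm_fin_ge// -ltNge => Sk.
  by rewrite distrC ler_normr; apply/orP; left; lra.
rewrite probability_setC_fine// lee_fin.
move: kn; rewrite -(fineK (fin_num_measure P _ mk)) lte_fin.
have : V / C ^+ 2 <= e.
  rewrite ler_pdivrMr ?exprn_gt0//; last lra.
  have : V / e * e = V by rewrite divfK// gt_eqF.
  have : C * e <= C ^+ 2 * e by rewrite ler_wpM2r ?(ltW e0)// expr2 ler_peMr; lra.
  rewrite {1}/C; lra.
lra.
Unshelve. all: by end_near. Qed.

(** The positive limit [l] enters here: a critical value more than C sqrt n above the null mean
    would be exceeded with probability at most V / C^2 <= l / 2, while [a n] is eventually larger
    than l / 2. *)
Lemma crit_upper p (k a : nat -> R) (l : R) : 0 < p -> 0 < l ->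
  a n @[n --> \oo] --> l ->
  (\forall n \near \oo, 0 < k n /\
     P [set w | (k n <= pnorm p%:E (noise eps n w))%R] = (a n)%:E) ->
  exists2 C : R, 0 <= C & \forall n \near \oo,
    k n `^ p <= n%:R * mom p + C * Num.sqrt n%:R.
Proof.
move=> p0 l0 al ka; have [V V0 dev] := psum_null_deviation eps_iid p0.
pose C := 2 * V / l + 1.
have Vl0 : 0 <= V / l by rewrite divr_ge0// ltW.
have C1 : 1 <= C by rewrite /C -mulrA; lra.
exists C; first lra.
near=> n.
have n0 : (0 < n)%N by near: n; exact: nbhs_infty_gt.
have [k0 kn] : 0 < k n /\ P [set w | (k n <= pnorm p%:E (noise eps n w))%R] = (a n)%:E.
  by near: n.
have an : l / 2 < a n.
  near: n; apply: (cvgr_gt _ al); lra.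
have mk : measurable [set w | (k n <= pnorm p%:E (noise eps n w))%R].
  under eq_set do rewrite noise0.
  exact: measurable_reject.
rewrite leNgt; apply/negP => kq.
have : (P [set w | (k n <= pnorm p%:E (noise eps n w))%R] <= (V / C ^+ 2)%:E)%E.
  apply: (dev n C) => //; first lra.
  move=> w /=; rewrite -/(pnorm p%:E _) pnorm_fin_ge// => Sk.
  by rewrite ler_normr; apply/orP; left; lra.
rewrite kn lee_fin.
have : V / C ^+ 2 <= l / 2.
  rewrite ler_pdivrMr ?exprn_gt0//; last lra.
  have : V / l * l = V by rewrite divfK// gt_eqF.
  have : C * l <= C ^+ 2 * l by rewrite ler_wpM2r ?(ltW l0)// expr2 ler_peMr; lra.
  rewrite {1}/C; lra.
lra.
Unshelve. all: by end_near. Qed.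

Lemma pnorm_dominates q p (k k' a' : nat -> R) (a l : R) (t : array R) :
  0 < q -> 2 * q <= p -> 2 <= p -> a < 1 -> 0 < l ->
  P [set w | (k n <= pnorm q%:E (noise eps n w))%R] @[n --> \oo] --> a%:E ->
  a' n @[n --> \oo] --> l ->
  (\forall n \near \oo, 0 < k' n /\
     P [set w | (k' n <= pnorm p%:E (noise eps n w))%R] = (a' n)%:E) ->
  P [set w | (k n <= pnorm q%:E (t n + noise eps n w))%R] @[n --> \oo] --> 1%E ->
  forall e, 0 < e -> \forall n \near \oo,
    (P (~` [set w | (k' n <= pnorm p%:E (t n + noise eps n w))%R]) <= e%:E)%E.
Proof.
move=> q0 qp p2 a1 l0 ka al ka' kt e e0.
have p0 : 0 < p by lra.
have [C0 C00 lowk] := crit_lower q0 a1 ka.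
have [C1 C10 uppk] := crit_upper p0 l0 al ka'.
have [K K0 high] := psum_high_prob eps_iid p2 C10 e0.
have [b b0 [N low]] := psum_low_prob eps_iid q0 qp (ltW K0) C00.
have b1 : 1 - b < 1 by lra.
near=> n.
have n0 : (0 < n)%N by near: n; exact: nbhs_infty_gt.
have nN : (N <= n)%N by near: n; exact: nbhs_infty_ge.
have [kn0 kn] : 0 < k n /\ n%:R * mom q - C0 * Num.sqrt n%:R <= k n `^ q.
  by near: n.
have k'n : k' n `^ p <= n%:R * mom p + C1 * Num.sqrt n%:R by near: n.
have [k'n0 _] : 0 < k' n /\
  P [set w | (k' n <= pnorm p%:E (noise eps n w))%R] = (a' n)%:E by near: n.
have ktn : ((1 - b)%:E < P [set w | (k n <= pnorm q%:E (t n + noise eps n w))%R])%E.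
  by near: n; exact: (cvge_near_gt kt b1).
have mk := measurable_reject q%:E (t n) (k n).
(* Otherwise the q-norm test would accept with probability at least [b], contradicting [ktn]. *)
have DK : K * Num.sqrt n%:R <= signal p (t n).
  rewrite leNgt; apply/negP => /ltW DK.
  have := low n (t n) _ nN DK (measurableC mk).
  rewrite probability_setC_fine// lee_fin => H.
  move: ktn; rewrite -(fineK (fin_num_measure P _ mk)) lte_fin.
  suff : b <= 1 - fine (P [set w | (k n <= pnorm q%:E (t n + noise eps n w))%R]) by lra.
  apply: H => w wS /=; apply/negP.
  by rewrite -/(pnorm q%:E _) pnorm_fin_ge// -ltNge; lra.
apply: (high n (t n)) => //.
  by apply: measurableC; exact: measurable_reject.
move=> w /= /negP; rewrite -/(pnorm p%:E _) pnorm_fin_ge// -ltNge => Sk.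
lra.
Unshelve. all: by end_near. Qed.

End finite_norms.

(** * Gaussian tails *)

Section normal_tails.
Context {R : realType}.
Notation nu := (@normal_prob R 0 1).
Implicit Types (k s t : R).

Definition upper_tail s : R := Nexp (\1_`[s, +oo[ : R -> R).

(* P(|t + eps| >= k) for a standard normal eps. *)
Definition abs_tail t k : R := Nexp (\1_[set x | k <= `|t + x|] : R -> R).

Lemma measurable_abs_tail t k : measurable [set x : R | k <= `|t + x|].
Proof. by apply: measurable_set_ge; mfun. Qed.

Lemma tame_upper_tail s : tame (\1_`[s, +oo[ : R -> R).
Proof. by apply: tame_indic; exact: measurable_itv. Qed.

Lemma tame_abs_tail t k : tame (\1_[set x | k <= `|t + x|] : R -> R).
Proof. by apply: tame_indic; exact: measurable_abs_tail. Qed.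

Lemma itv_upperE s (x : R) : \1_(`[s, +oo[%classic) x = (s <= x)%R%:R :> R.
Proof. by rewrite indicE mem_setE/= in_itv/= andbT. Qed.

Lemma abs_tail_setE t k (x : R) :
  \1_[set x | k <= `|t + x|] x = (k <= `|t + x|)%R%:R :> R.
Proof.
rewrite indicE; congr (nat_of_bool _)%:R.
by apply/idP/idP; rewrite inE.
Qed.

(** Moving the threshold amounts to moving the law. With the threshold kept fixed, tails at nearby
    thresholds are compared through pointwise bounds on the likelihood ratio. *)
Lemma upper_tail_shift s t :
  upper_tail (s + t) =
  Nexp (fun x : R => \1_`[s, +oo[ x * expR (- t * x - (- t) ^+ 2 / 2)).
Proof.
have [mI I0 _] := tame_upper_tail s.
rewrite /Nexp -(integral_normal_shift _ mI I0).
rewrite /upper_tail /Nexp; congr fine; apply: eq_integral => x _.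
by rewrite !itv_upperE lerBrDr.
Qed.

Lemma tame_upper_tail_exp s t :
  tame (fun x : R => \1_`[s, +oo[ x * expR (- t * x - (- t) ^+ 2 / 2)).
Proof.
apply: tameM; first exact: tame_upper_tail.
apply: (@tame_le _ _ (fun x => expR (`|t| * `|x|))); [by mfun|by move=> x; pos| |].
  exact: tame_expabs.
move=> x; rewrite ler_expR -normrM.
have := ler_norm (- (t * x)); rewrite normrN mulNr; have := sqr_ge0 (- t); lra.
Qed.

Lemma upper_tail_ge0 s : 0 <= upper_tail s.
Proof. exact/Nexp_ge0/tame_upper_tail. Qed.

Lemma abs_tail_ge0 t k : 0 <= abs_tail t k.
Proof. exact/Nexp_ge0/tame_abs_tail. Qed.

Lemma abs_tail_le1 t k : abs_tail t k <= 1.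
Proof.
rewrite -[leRHS](Nexp_cst (ler01 (R := R))).
apply: le_Nexp; [exact: tame_abs_tail|exact: tame_cst|by []].
Qed.

Lemma upper_tail_le s t : s <= t -> upper_tail t <= upper_tail s.
Proof.
move=> st; apply: le_Nexp; [exact: tame_upper_tail|exact: tame_upper_tail|].
move=> x; rewrite !itv_upperE; have [tx|] := boolP (t <= x); last by [].
by rewrite (le_trans st tx).
Qed.

(** For k > 0 the two ways of exceeding [k] in absolute value are disjoint, and the lower one is
    reflected into an upper tail. *)
Lemma abs_tailE t k : 0 < k ->
  abs_tail t k = upper_tail (k - t) + upper_tail (k + t).
Proof.
move=> k0; rewrite [X in _ = _ + X](_ : _ = Nexp (fun x : R => \1_`[k + t, +oo[ (- x))).
  rewrite -NexpD; first last.
  - have [m0 g0 [C [c H]]] := tame_upper_tail (k + t); split.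
    + apply: (measurableT_comp m0); exact: oppr_measurable.
    + by move=> x; exact: g0.
    + by exists C, c => x; have := H (- x); rewrite normrN.
  - exact: tame_upper_tail.
  apply: eq_Nexp => x; rewrite abs_tail_setE !itv_upperE ler_normr.
  rewrite lerBlDl opprD.
  have -> : (k + t <= - x) = (k <= - t - x).
    by rewrite -lerBrDr addrC.
  have [h1|h1] := leP k (t + x); have [h2|h2] := leP k (- t - x);
    rewrite /= ?addr0 ?add0r//; lra.
by rewrite (NexpN (tame_upper_tail (k + t))).
Qed.

Lemma abs_tailN t k : 0 < k -> abs_tail (- t) k = abs_tail t k.
Proof. by move=> k0; rewrite !abs_tailE// opprK addrC. Qed.

Lemma abs_tail_le t k k' : k <= k' -> abs_tail t k' <= abs_tail t k.
Proof.
move=> kk; apply: le_Nexp; [exact: tame_abs_tail|exact: tame_abs_tail|].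
move=> x; rewrite !abs_tail_setE; have [kx|] := boolP (k' <= `|t + x|); last by [].
by rewrite (le_trans kk kx).
Qed.

Lemma upper_tail_decay k s : 0 <= s ->
  upper_tail (k + s) <= expR (- (s * k)) * upper_tail k.
Proof.
move=> s0; rewrite upper_tail_shift -NexpZ ?expR_ge0//; last exact: tame_upper_tail.
apply: le_Nexp; [exact: tame_upper_tail_exp|
  by apply: tameZ; [exact: expR_ge0|exact: tame_upper_tail]|].
move=> x; rewrite itv_upperE; have [kx|] := boolP (k <= x); last by rewrite mul0r mulr0.
rewrite mul1r mulr1 ler_expR.
have := ler_wpM2l s0 kx; have := sqr_ge0 (- s); lra.
Qed.

Lemma upper_tail_gauss k : 0 <= k -> upper_tail k <= expR (- k ^+ 2 / 2).
Proof.
move=> k0; rewrite -[k in upper_tail k]add0r upper_tail_shift.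
have e0 : 0 <= expR (- k ^+ 2 / 2) := expR_ge0 _.
rewrite -[leRHS](Nexp_cst e0).
apply: le_Nexp; [exact: tame_upper_tail_exp|exact: tame_cst|].
move=> x; rewrite itv_upperE; have [x0|_] := boolP (0 <= x); last by rewrite mul0r.
rewrite mul1r ler_expR; have := mulr_ge0 k0 x0; rewrite sqrrN; lra.
Qed.

(** A lower bound of Mills type: only the window from k to k + 1/k is kept, on which the Gaussian
    exponent drops by at most 3/2. *)
Lemma upper_tail_ge k : 1 <= k ->
  normal_peak 1 * expR (- (3 / 2)) * (expR (- k ^+ 2 / 2) / k) <= upper_tail k.
Proof.
move=> k1; have k0 : 0 < k by lra.
have kV0 : 0 < k^-1 by rewrite invr_gt0.
have kV1 : k^-1 <= 1 by rewrite invf_le1.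
have H := @normal_itv_ge R k (k + k^-1) (k + k^-1) _ _.
have kk : k * k^-1 = 1 by rewrite mulfV// gt_eqF.
rewrite -lee_fin -Nexp_indic; last exact: measurable_itv.
have sub : `[k, k + k^-1]%classic `<=` `[k, +oo[%classic.
  by move=> x /=; rewrite !in_itv/= andbT => /andP[].
apply: le_trans (le_measure nu _ _ sub); rewrite ?inE//.
apply: le_trans (H _ _); last 2 first.
- by rewrite lerDl ltW.
- by move=> x /andP[kx xk]; rewrite ger0_norm//; lra.
rewrite lee_fin.
have E : expR (- (3 / 2)) * expR (- k ^+ 2 / 2) <=
    expR (- (k + k^-1) ^+ 2 / 2) :> R.
  rewrite -expRD ler_expR.
  have : k^-1 ^+ 2 <= 1 by rewrite exprn_ile1// ltW.
  have -> : (k + k^-1) ^+ 2 = k ^+ 2 + 2 * (k * k^-1) + k^-1 ^+ 2 by ring.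
  rewrite kk; lra.
have := ler_wpM2l (mulr_ge0 (normal_peak_ge0 1) (ltW kV0)) E.
rewrite (_ : k + k^-1 - k = k^-1); last by ring.
lra.
Qed.

Lemma normal_peak_le1 : normal_peak 1 <= 1 :> R.
Proof.
rewrite /normal_peak invf_le1.
  rewrite -[leLHS]sqrtr1 ler_wsqrtr// expr1n mul1r.
  by have := pi_ge2 R; rewrite mulr2n; lra.
by rewrite sqrtr_gt0 expr1n mul1r mulrn_wgt0// pi_gt0.
Qed.

Lemma normal_pdf_le1 (x : R) : normal_pdf 0 1 x <= 1.
Proof. exact: le_trans (normal_pdf_ub 0 x (oner_neq0 R)) normal_peak_le1. Qed.

Lemma normal_itv_le (a b : R) : a <= b -> (nu `[a, b[%classic <= (b - a)%:E)%E.
Proof.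
move=> ab; rewrite /normal_prob.
have -> : ((b - a)%:E = \int[lebesgue_measure]_(x in `[a, b[) 1%:E)%E.
  rewrite integral_cst//= lebesgue_measure_itv/= lte_fin mul1e.
  by case: ltgtP ab => // -> _; rewrite subrr.
apply: ge0_le_integral => //.
- by move=> x _; rewrite lee_fin normal_pdf_ge0.
- apply/measurable_EFinP; apply: measurable_funTS.
  exact: measurable_normal_pdf.
- by move=> x _; rewrite lee_fin normal_pdf_le1.
Qed.

Lemma upper_tail_lipschitz k s : 0 <= s -> upper_tail k - s <= upper_tail (k + s).
Proof.
move=> s0; have H := @normal_itv_le k (k + s) _.
have tI : tame (\1_`[k, k + s[ : R -> R) by apply: tame_indic; exact: measurable_itv.
have : upper_tail k <= Nexp (\1_`[k, (k + s)[ : R -> R) + upper_tail (k + s).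
  rewrite -NexpD//; last exact: tame_upper_tail.
  apply: le_Nexp; [exact: tame_upper_tail|by apply: tameD => //; exact: tame_upper_tail|].
  move=> x; rewrite !itv_upperE indicE mem_setE/= in_itv/=.
  by have [kx|kx] := leP k x; have [ksx|ksx] := leP (k + s) x;
    rewrite /= ?addr0 ?add0r ?ler01 ?lexx.
have : Nexp (\1_`[k, (k + s)[ : R -> R) <= s.
  rewrite -lee_fin -Nexp_indic; last exact: measurable_itv.
  by apply: le_trans (H _) _; rewrite ?lerDl// addrAC subrr add0r.
lra.
Qed.

Lemma abs_tail_lipschitz t k s : 0 < k -> 0 <= s ->
  abs_tail t k - 2 * s <= abs_tail t (k + s).
Proof.
move=> k0 s0; have ks0 : 0 < k + s by lra.
rewrite !abs_tailE//.
have := upper_tail_lipschitz (k - t) s0; have := upper_tail_lipschitz (k + t) s0.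
rewrite (addrAC k t) (addrAC k (- t)).
by do 4!move: (upper_tail _) => ?; lra.
Qed.

(** The likelihood ratio of the shift C / k is bounded below only where x <= k + 1; there it is at
    least exp(- 2C - C^2 / 2). The part beyond k + 1 carries at most exp(-1) of the tail at [t],
    because t <= k and k >= 1, and is given away. *)
Lemma upper_tail_shift_ge (C k t : R) : 0 <= C -> 1 <= k -> t <= k ->
  (1 - expR (- 1)) * expR (- (2 * C + C ^+ 2 / 2)) * upper_tail t <=
  upper_tail (t + C / k).
Proof.
move=> C0 k1 tk; have k0 : 0 < k by lra.
pose s := C / k.
have s0 : 0 <= s by rewrite divr_ge0// ltW.
have sk : s * k = C by rewrite divfK// gt_eqF.
have sC : s <= C by rewrite /s ler_pdivrMr// ler_peMr.
pose E := expR (- s * (k + 1) - s ^+ 2 / 2).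
have E0 : 0 <= E by exact: expR_ge0.
have H1 : E * upper_tail t <= upper_tail (t + s) + E * upper_tail (k + 1).
  rewrite upper_tail_shift -!NexpZ ?expR_ge0//; do ?exact: tame_upper_tail.
  have tE u : tame (fun x : R => E * \1_`[u, +oo[ x).
    by apply: tameZ => //; exact: tame_upper_tail.
  rewrite -NexpD//; last exact: tame_upper_tail_exp.
  apply: le_Nexp => //; first by apply: tameD => //; exact: tame_upper_tail_exp.
  move=> x; rewrite !itv_upperE sqrrN.
  have [tx|tx] := leP t x; last first.
    by rewrite mulr0 mul0r add0r mulr_ge0.
  have [kx|kx] := leP (k + 1) x.
    by rewrite mulr1 mul1r lerDr expR_ge0.
  rewrite mulr1 mulr0 addr0 mul1r ler_expR lerD2r -subr_ge0.
  have -> : - s * x - - s * (k + 1) = s * (k + 1 - x) by ring.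
  by rewrite mulr_ge0//; lra.
have H2 : upper_tail (k + 1) <= expR (- 1) * upper_tail t.
  apply: le_trans (upper_tail_decay k ler01) _; rewrite mul1r.
  apply: ler_pM; rewrite ?expR_ge0 ?upper_tail_ge0//.
    by rewrite ler_expR lerN2.
  exact: upper_tail_le.
have H3 : expR (- (2 * C + C ^+ 2 / 2)) <= E.
  rewrite ler_expR.
  have : s ^+ 2 <= C ^+ 2 by rewrite lerXn2r.
  have -> : - s * (k + 1) = - (s * k) - s by ring.
  rewrite sk; lra.
have e1 : expR (- 1) <= 1 :> R by rewrite -[leRHS]expR0 ler_expR; lra.
have H4 := ler_wpM2l E0 H2.
have g0 : 0 <= (1 - expR (- 1)) * upper_tail t.
  by rewrite mulr_ge0 ?upper_tail_ge0// subr_ge0.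
have H5 := ler_wpM2r g0 H3.
rewrite -/s; lra.
Qed.

(** By symmetry t >= 0. The upper side then has threshold k - t <= k, where the one-sided comparison
    applies, and carries at least half of the exceedance probability. The constant is uniform in [t]
    since the coordinates of theta are arbitrary. *)
Lemma abs_tail_shift_ge (C : R) : 0 <= C -> exists2 c : R, 0 < c &
  forall k t, 1 <= k -> c * abs_tail t k <= abs_tail t (k + C / k).
Proof.
move=> C0; pose c1 : R := (1 - expR (- 1)) * expR (- (2 * C + C ^+ 2 / 2)).
have e1 : expR (- 1) < 1 :> R by rewrite -[ltRHS]expR0 ltr_expR; lra.
have c10 : 0 < c1 by rewrite mulr_gt0 ?expR_gt0// subr_gt0.
exists (c1 / 2); first by rewrite divr_gt0.
move=> k t k1; have k0 : 0 < k by lra.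
have Ck0 : 0 <= C / k by rewrite divr_ge0// ltW.
wlog t0 : t / 0 <= t.
  move=> H; have [/H//|t0] := leP 0 t.
  by rewrite -abs_tailN// -(abs_tailN t); [apply: H|]; lra.
rewrite !abs_tailE//; last lra.
have kt : k - t <= k by lra.
have := upper_tail_shift_ge C0 k1 kt.
have ktt : k - t <= k + t by lra.
have := ler_wpM2l (ltW c10) (upper_tail_le ktt).
have := upper_tail_ge0 (k + C / k + t).
rewrite -/c1 (addrAC k (C / k) (- t)).
by do 4!move: (upper_tail _) => ?; move: c1 c10 => c1 c10; lra.
Qed.

End normal_tails.

(** * Moments of large order truncated below their saddle point *)

Section truncated_moment.
Context {R : realType}.
Notation nu := (@normal_prob R 0 1).
Notation mu := lebesgue_measure.

Lemma integral_itv_expR (g h a b : R) : g != 0 -> a < b ->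
  (\int[mu]_(x in `[a, b]) (expR (g * x + h))%:E =
   ((expR (g * b + h) - expR (g * a + h)) / g)%:E)%E.
Proof.
move=> g0 ab; pose F (x : R) := expR (g * x + h) / g.
have dF (x : R) : is_derive x 1 F (expR (g * x + h)).
  apply: is_derive_eq.
  rewrite !scaler0 /= ?addr0 ?add0r /GRing.scale/= mulr1.
  by field.
have cF (x : R) : {for x, continuous F}.
  by apply/differentiable_continuous/derivable1_diffP.
rewrite (@continuous_FTC2 _ _ F)//.
- by rewrite -EFinB /F mulrBl.
- apply: continuous_subspaceT => x.
  apply: continuous_comp; last exact: continuous_expR.
  apply: continuousD; last exact: cst_continuous.
  exact: mulrl_continuous.
- split; [by move=> x _|exact/cvg_at_right_filter/cF|exact/cvg_at_left_filter/cF].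
- by move=> x _; rewrite derive1E; exact: derive_val.
Qed.

(** The logarithm q ln y - y^2 / 2 of the integrand at y = |x|, up to a constant, is concave and so
    lies below its tangent at [k]. The slope q/k - k is positive as k^2 < q, so the integral over
    |x| < k is dominated by an exponential peaking at the truncation point. *)
Lemma truncated_moment_le (q k : R) : 0 < k -> k ^+ 2 < q ->
  (\int[nu]_x (`|x| `^ q * (`|x| < k)%R%:R)%:E <=
   (k `^ q * (2 * expR (- k ^+ 2 / 2) / (q / k - k)))%:E)%E.
Proof.
move=> k0 kq.
have q0 : 0 < q by have := sqr_ge0 k; lra.
pose g := q / k - k.
have g0 : 0 < g.
  have : k < q / k by rewrite ltr_pdivlMr// -expr2.
  by rewrite /g; lra.
pose Kc := k `^ q * expR (- k ^+ 2 / 2).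
have Kc0 : 0 <= Kc by rewrite mulr_ge0 ?powR_ge0 ?expR_ge0.
have mf : measurable_fun setT (fun x : R => `|x| `^ q * (`|x| < k)%R%:R).
  apply: measurable_funM; first by mfun.
  rewrite (_ : (fun _ => _) = \1_[set x : R | `|x| < k]).
    by apply/measurable_indic/measurable_set_lt; mfun.
  apply/funext => x; rewrite indicE; congr (nat_of_bool _)%:R.
  by apply/idP/idP; rewrite inE.
rewrite integral_normalE; last 2 first.
- exact/measurable_EFinP.
- by move=> x; rewrite lee_fin mulr_ge0 ?powR_ge0.
(* Summing the branches for x and -x bounds exp(g |x|) by a function with an explicit primitive. *)
pose b (x : R) := Kc * (expR (g * x + (- (g * k))) + expR ((- g) * x + (- (g * k)))).
have mb : measurable_fun setT b by rewrite /b; mfun.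
have b0 x : 0 <= b x by rewrite mulr_ge0// addr_ge0// expR_ge0.
have H1 : (\int[mu]_x ((`|x| `^ q * (`|x| < k)%R%:R)%:E * (normal_pdf 0 1 x)%:E) <=
    \int[mu]_(x in `[(- k)%R, k]) (b x)%:E)%E.
  rewrite [leRHS]integral_mkcond; apply: ge0_le_integral => //.
  - by move=> x _; rewrite -EFinM lee_fin mulr_ge0 ?mulr_ge0 ?powR_ge0 ?normal_pdf_ge0.
  - apply: emeasurable_funM; apply/measurable_EFinP => //.
    exact: measurable_normal_pdf.
  - apply/(measurable_restrictT (fun x => (b x)%:E)); first exact: measurable_itv.
    by apply/measurable_EFinP; exact: measurable_funTS.
  - move=> x _; rewrite patchE; case: ifPn => [_|xI]; last first.
      rewrite (_ : `|x| < k = false) ?mulr0 ?mul0e//.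
      apply/negbTE; move: xI; apply: contra => xk.
      by rewrite inE/= in_itv/= -ler_norml ltW.
    rewrite -EFinM lee_fin.
    have [xk|_] := ltP `|x| k; last by rewrite mulr0 mul0r.
    rewrite mulr1 normal_pdf01E.
    set y := `|x|.
    have y0 : 0 <= y := normr_ge0 x.
    have B1 : y `^ q <= k `^ q * expR (q / k * (y - k)).
      have -> : y = k * (y / k) by rewrite mulrCA mulfV ?mulr1// gt_eqF.
      have yk0 : 0 <= y / k by rewrite divr_ge0// ltW.
      rewrite powRM//; last exact: ltW.
      rewrite ler_wpM2l ?powR_ge0//.
      rewrite (_ : k * (y / k) = y); last by rewrite mulrCA mulfV ?mulr1// gt_eqF.
      have -> : expR (q / k * (y - k)) = expR (y / k - 1) `^ q.
        by rewrite -expRM; congr expR; field; rewrite gt_eqF.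
      apply: ge0_ler_powR; rewrite ?nnegrE ?expR_ge0//; first exact: ltW.
      by apply: le_trans (expR_ge1Dx _); lra.
    have B2 : normal_peak 1 * expR (- x ^+ 2 / 2) <=
        expR (- k ^+ 2 / 2) * expR (- k * (y - k)).
      apply: (@le_trans _ _ (expR (- x ^+ 2 / 2))).
        by rewrite ler_piMl ?expR_ge0// normal_peak_le1.
      rewrite -expRD ler_expR -[x ^+ 2]real_normK ?num_real// -/y.
      have := sqr_ge0 (y - k); nra.
    have B3 : expR (q / k * (y - k)) * expR (- k * (y - k)) =
        expR (g * y + (- (g * k))).
      by rewrite -expRD; congr expR; rewrite /g; ring.
    have B4 : expR (g * y + - (g * k)) <=
        expR (g * x + - (g * k)) + expR ((- g) * x + - (g * k)).
      rewrite /y; have [x0|x0] := ler0P x.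
        by rewrite mulrN -mulNr lerDr expR_ge0.
      by rewrite lerDl expR_ge0.
    apply: (@le_trans _ _ ((k `^ q * expR (q / k * (y - k))) *
        (expR (- k ^+ 2 / 2) * expR (- k * (y - k))))).
      apply: ler_pM => //; first exact: powR_ge0.
      by rewrite mulr_ge0 ?normal_peak_ge0 ?expR_ge0.
    rewrite mulrACA B3 -/Kc.
    exact: ler_wpM2l.
apply: (le_trans H1).
have mI (c : R) : measurable_fun `[(- k), k]%classic (fun x => (expR (c * x + (- (g * k))))%:E).
  by apply/measurable_EFinP; apply: measurable_funTS; mfun.
have kk : - k < k by lra.
have Ng0 : - g != 0 by rewrite oppr_eq0 gt_eqF.
have E2 : (\int[mu]_(x in `[(- k)%R, k]) ((expR (g * x + (- (g * k))))%:E +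
      (expR ((- g) * x + (- (g * k))))%:E) =
    ((expR (g * k + (- (g * k))) - expR (g * (- k) + (- (g * k)))) / g)%:E +
    ((expR ((- g) * k + (- (g * k))) - expR ((- g) * (- k) + (- (g * k)))) / (- g))%:E)%E.
  rewrite -(integral_itv_expR _ _ kk) ?gt_eqF// -(integral_itv_expR _ Ng0 kk).
  apply: ge0_integralD => //; try exact: mI;
    by move=> x _; rewrite lee_fin expR_ge0.
have E1 : (\int[mu]_(x in `[(- k)%R, k]) (b x)%:E =
    Kc%:E * \int[mu]_(x in `[(- k)%R, k])
      ((expR (g * x + (- (g * k))))%:E + (expR ((- g) * x + (- (g * k))))%:E))%E.
  transitivity (\int[mu]_(x in `[(- k)%R, k]) (Kc%:E *
      ((expR (g * x + (- (g * k))))%:E + (expR ((- g) * x + (- (g * k))))%:E)))%E.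
    by apply: eq_integral => x _; rewrite /b EFinM EFinD.
  apply: ge0_integralZl_EFin => //.
    by move=> x _; rewrite -EFinD lee_fin addr_ge0 ?expR_ge0.
  by apply: emeasurable_funD; exact: mI.
rewrite E1 E2.
rewrite -EFinD -EFinM lee_fin.
have -> : k `^ q * (2 * expR (- k ^+ 2 / 2) / (q / k - k)) = Kc * (2 / g).
  by rewrite /Kc -/g; ring.
rewrite ler_wpM2l//.
have -> : g * k - g * k = 0 by ring.
have -> : - g * - k - g * k = 0 by ring.
rewrite expR0.
have := expR_gt0 (g * - k - g * k); have := expR_gt0 (- g * k - g * k).
set A := expR (g * - k - g * k); set B := expR (- g * k - g * k) => B0 A0.
have -> : (1 - A) / g + (B - 1) / - g = (2 - A - B) / g.
  by field; rewrite gt_eqF.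
by rewrite ler_pdivrMr// divfK ?gt_eqF//; lra.
Qed.

End truncated_moment.

(** * Products of non-exceedance probabilities *)

Lemma bernoulli_le (R : realType) (x : R) n : 0 <= x <= 1 ->
  1 - n%:R * x <= (1 - x) ^+ n.
Proof.
move=> /andP[x0 x1]; elim: n => [|n IH]; first by rewrite mul0r subr0 expr0.
have x10 : 0 <= 1 - x by lra.
have := ler_wpM2l x10 IH; rewrite exprS -natr1.
have : 0 <= n%:R * (x * x) by rewrite !mulr_ge0.
lra.
Qed.

Lemma expX_le_expR (R : realType) (x : R) n : x <= 1 ->
  (1 - x) ^+ n <= expR (- (n%:R * x)).
Proof.
move=> x1; apply: (@le_trans _ _ (expR (- x) ^+ n)).
  by rewrite lerXn2r ?nnegrE ?expR_ge0//; [lra|exact: expR_ge1Dx].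
by rewrite -expRM_natl mulrN.
Qed.

(* Either some u i exceeds 1 - d, and then v i is almost as large, or all satisfy
   1 - u i >= exp (- u i / d), and then the sum of the u i is large. *)
Lemma prod_one_sub_transfer (R : realType) (c e : R) : 0 < c -> 0 < e ->
  exists2 rho : R, 0 < rho & forall n (u v : 'I_n -> R) (s : R),
  (forall i, 0 <= u i <= 1) -> (forall i, 0 <= v i <= 1) ->
  (forall i, c * u i <= v i) -> (forall i, u i - s <= v i) -> s <= e / 2 ->
  \prod_(i < n) (1 - u i) <= rho -> \prod_(i < n) (1 - v i) <= e.
Proof.
move=> c0 e0; pose d := e / 2.
have d0 : 0 < d by rewrite divr_gt0.
(* Makes exp(- c d B) equal to [e]; in the second case d B is a lower bound for the sum of the
   [u i]. *)
pose B := - ln e / (c * d).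
exists (expR (- B)); first exact: expR_gt0.
move=> n u v s u01 v01 cuv suv se urho.
have [[i ui]|/forallNP ui] := pselect (exists i, 1 - d < u i).
  have vi : 1 - v i <= e by have := suv i; rewrite /d in ui; lra.
  apply: le_trans vi; rewrite (bigD1 i)//= ler_piMr//.
    by have /andP[] := v01 i; lra.
  apply: prodr_ile1 => j _; have /andP[] := v01 j; lra.
have Su : d * B <= \sum_(i < n) u i.
  have H : expR (- (\sum_(i < n) u i / d)) <= expR (- B).
    apply: le_trans urho; rewrite -sumrN expR_sum.
    apply: ler_prod => i _; rewrite expR_ge0/= expRN.
    have uid : u i <= 1 - d by rewrite leNgt; apply/negP; exact: ui.
    have pos1 : 0 < 1 - u i by lra.
    rewrite -[leRHS]invrK lef_pV2 ?posrE ?expR_gt0 ?invr_gt0//.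
    have -> : (1 - u i)^-1 = 1 + u i / (1 - u i) by field; lra.
    apply: le_trans (expR_ge1Dx _) _; rewrite ler_expR.
    have /andP[ui0 _] := u01 i.
    by rewrite ler_wpM2l// lef_pV2 ?posrE//; lra.
  move: H; rewrite ler_expR lerN2 -mulr_suml ler_pdivlMr//; lra.
apply: (@le_trans _ _ (expR (- (\sum_(i < n) v i)))).
  rewrite -sumrN expR_sum; apply: ler_prod => i _.
  rewrite expR_ge1Dx andbT; have /andP[] := v01 i; lra.
have Sv : c * \sum_(i < n) u i <= \sum_(i < n) v i.
  by rewrite mulr_sumr; apply: ler_sum.
have -> : e = expR (- (c * (d * B))).
  rewrite /B (_ : - (c * (d * (- ln e / (c * d)))) = ln e) ?lnK//.
  by field; rewrite !gt_eqF.
rewrite ler_expR lerN2; apply: le_trans Sv; rewrite ler_wpM2l//; exact: ltW.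
Qed.

(** * The supremum norm *)

Section sup_norm.
Context {disp : measure_display} {T : measurableType disp} {R : realType}.
Context {P : probability T R} {eps : nat -> {RV P >-> R}}.
Hypothesis eps_iid : iid_std_normal eps.
Notation nu := (@normal_prob R 0 1).
Implicit Types (q k : R).

Lemma sup_norm_ge0 n (x : 'rV[R]_n) : 0 <= pnorm +oo%E x.
Proof.
rewrite /pnorm; apply: (big_ind (fun y : R => 0 <= y)) => // a b a0 b0.
by rewrite le_max a0.
Qed.

Lemma sup_norm_le_pnorm q n (x : 'rV[R]_n) : 0 < q ->
  pnorm +oo%E x <= pnorm q%:E x.
Proof.
move=> q0; rewrite /pnorm; apply/bigmax_leP; split; first exact: powR_ge0.
move=> i _.
have -> : `|x 0 i| = (`|x 0 i| `^ q) `^ q^-1.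
  by rewrite -powRrM mulfV ?gt_eqF// powRr1.
apply: ge0_ler_powR; rewrite ?nnegrE ?powR_ge0 ?invr_ge0//; first exact: ltW.
  by apply: sumr_ge0 => j _; exact: powR_ge0.
rewrite (bigD1 i)//= lerDl.
by apply: sumr_ge0 => j _; exact: powR_ge0.
Qed.

Lemma probability_sup_norm_lt n (t : 'rV[R]_n) k : 0 < k ->
  P (~` [set w | (k <= pnorm +oo%E (t + noise eps n w))%R]) =
  (\prod_(i < n) (1 - abs_tail (t 0 i) k))%:E.
Proof.
move=> k0.
pose B i : set R := ~` [set x | k <= `|t 0 i + x|].
have mB i : measurable (B i).
  by apply: measurableC; exact: measurable_abs_tail.
have mE : measurable (~` [set w | (k <= pnorm +oo%E (t + noise eps n w))%R]).
  by apply: measurableC; exact: measurable_reject.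
rewrite -(@integral_prod_eps_ord _ _ _ _ _ eps_iid _ (fun i => \1_(B i))).
- rewrite -[in LHS](setIT (~` _)) -integral_indic//.
  apply: eq_integral => w _; congr EFin; rewrite indicE.
  have [wE|/negP wE] := boolP (w \in _).
    rewrite big1// => i _; rewrite indicE mem_set//.
    move: wE; rewrite inE => wE /= ki; apply: wE => /=.
    by apply: (le_trans ki); apply: le_trans (le_bigmax _ _ i); rewrite !mxE.
  have {}wE : k <= pnorm +oo%E (t + noise eps n w).
    by apply: contrapT => h; apply: wE; rewrite inE.
  have [i ki] : exists i : 'I_n, k <= `|t 0 i + eps i w|.
    apply: contrapT => /forallNP h; move: wE; apply/negP; rewrite -ltNge.
    rewrite /pnorm; apply/bigmax_ltP; split=> // i _; rewrite ltNge !mxE.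
    by apply/negP; exact: h.
  by rewrite (bigD1 i)//= indicE memNset ?mul0r//.
- by move=> i; apply: measurable_indic; exact: mB.
- by [].
- move=> i; rewrite NexpE; last exact: tame_indic.
  congr EFin; apply/eqP; rewrite eq_sym subr_eq; apply/eqP.
  rewrite -NexpD; [|exact: tame_indic|exact: tame_abs_tail].
  rewrite -[LHS](Nexp_cst (ler01 (R := R))); apply: eq_Nexp => x.
  by rewrite !indicE in_setC; case: (x \in _); rewrite ?addr0 ?add0r.
Qed.

(** If the norm reaches [k], then either some coordinate does, or the power sum restricted to
    coordinates below [k] reaches k^q. The first event is handled by a union bound, the second by
    Markov's inequality; [Y] adds the two contributions of one coordinate. *)
Lemma probability_pnorm_null_le n q k : 0 < k -> k ^+ 2 < q ->
  (P [set w | (k <= pnorm q%:E (noise eps n w))%R] <=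
   (n%:R * (abs_tail 0 k + 2 * expR (- k ^+ 2 / 2) / (q / k - k)))%:E)%E.
Proof.
move=> k0 kq.
have q0 : 0 < q by have := sqr_ge0 k; lra.
have kq0 : 0 < k `^ q by rewrite powR_gt0.
have kqV0 : 0 <= (k `^ q)^-1 by rewrite invr_ge0 ltW.
pose Z (x : R) := `|x| `^ q * (`|x| < k)%R%:R.
pose Y (x : R) := \1_[set x : R | k <= `|0 + x|] x + (k `^ q)^-1 * Z x.
have Z0 x : 0 <= Z x by rewrite mulr_ge0 ?powR_ge0.
have Y0 x : 0 <= Y x by rewrite addr_ge0// mulr_ge0.
have mZ : measurable_fun setT Z.
  apply: measurable_funM; first by mfun.
  rewrite (_ : (fun _ => _) = \1_[set x : R | `|x| < k]).
    by apply/measurable_indic/measurable_set_lt; mfun.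
  apply/funext => x; rewrite indicE; congr (nat_of_bool _)%:R.
  by apply/idP/idP; rewrite inE.
have mI : measurable_fun setT (\1_[set x : R | k <= `|0 + x|] : R -> R).
  by apply: measurable_indic; exact: measurable_abs_tail.
have mY : measurable_fun setT Y by rewrite /Y; mfun.
have YE : (\int[nu]_x (Y x)%:E <=
    (abs_tail 0 k + 2 * expR (- k ^+ 2 / 2) / (q / k - k))%:E)%E.
  rewrite ge0_integralD_EFin//; [|by mfun|by move=> x; rewrite mulr_ge0].
  rewrite ge0_integralZ_EFin// EFinD NexpE; last exact: tame_abs_tail.
  rewrite leeD2l//.
  apply: le_trans (lee_wpmul2l _ (truncated_moment_le k0 kq)) _ => //.
  by rewrite -EFinM mulKf// gt_eqF.
pose y := fine (\int[nu]_x (Y x)%:E)%E.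
have yE : (\int[nu]_x (Y x)%:E = y%:E)%E.
  rewrite /y fineK// ge0_fin_numE; last exact: ge0_integral_EFin_ge0.
  by apply: le_lt_trans YE _; rewrite ltry.
have yb : y <= abs_tail 0 k + 2 * expR (- k ^+ 2 / 2) / (q / k - k).
  by rewrite -lee_fin -yE.
have mE : measurable [set w | (k <= pnorm q%:E (noise eps n w))%R].
  under eq_set do rewrite noise0.
  exact: measurable_reject.
rewrite -[X in P X]setIT -integral_indic//.
apply: (@le_trans _ _ (\int[P]_w (\sum_(i < n) Y (eps i w))%:E)%E).
  apply: ge0_le_integral_EFin => //.
  - by apply: (@measurable_row_fun _ _ _ P eps n (fun=> Y) +%R 0) => // f g;
      exact: measurable_funD.
  - move=> w; rewrite indicE; have [|_] := boolP (w \in _); last by apply: sumr_ge0.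
    rewrite inE /= -/(pnorm q%:E (noise eps n w)) pnorm_fin_ge// => kS.
    have [[i ki]|/forallNP ki] := pselect (exists i : 'I_n, k <= `|eps i w|).
      rewrite (bigD1 i)//= /Y abs_tail_setE add0r ki -addrA lerDl.
      by apply: addr_ge0; [exact: mulr_ge0|apply: sumr_ge0 => j _; exact: Y0].
    rewrite -(@ler_pM2l _ (k `^ q))// mulr1; apply: (le_trans kS).
    rewrite mulr_sumr; apply: ler_sum => i _.
    rewrite mxE /Y mulrDr mulVKf ?gt_eqF// /Z.
    have -> : `|eps i w| < k by rewrite ltNge; apply/negP; exact: ki.
    by rewrite mulr1 lerDr mulr_ge0// ltW.
rewrite ge0_integral_sum_EFin//; last first.
  by move=> i; exact: measurable_eps_comp.
rewrite (eq_bigr (fun=> y%:E)); last first.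
  move=> i _; rewrite -yE.
  have := @integral_prod_eps _ _ _ _ _ eps_iid [:: (i : nat)] (fun=> Y) (fun=> y) _ _ _ _.
  rewrite yE big_seq1 => <- //.
  by apply: eq_integral => w _; rewrite big_seq1.
rewrite sumEFin lee_fin sumr_const card_ord.
by rewrite -[leLHS]mulr_natl ler_wpM2l.
Qed.

End sup_norm.

Section tail_bounds.
Context {R : realType}.
Implicit Types (q k : R).

Lemma near_natr_ge (B : R) : \forall n \near \oo, B <= n%:R.
Proof.
near=> n; apply: (@le_trans _ _ (Num.truncn B).+1%:R).
  exact/ltW/truncnS_gt.
by rewrite ler_nat; near: n; exact: nbhs_infty_ge.
Unshelve. all: by end_near. Qed.

Lemma near_ln_ge (B : R) : \forall n \near \oo, B <= ln n%:R.
Proof.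
near=> n; rewrite -[leLHS]expRK ler_ln ?posrE ?expR_gt0//.
  by near: n; exact: near_natr_ge.
by rewrite ltr0n; near: n; exact: nbhs_infty_gt.
Unshelve. all: by end_near. Qed.

Lemma abs_tail0_ge : exists2 c : R, 0 < c & forall k : R, 1 <= k ->
  c * (expR (- k ^+ 2 / 2) / k) <= abs_tail 0 k.
Proof.
exists (normal_peak 1 * expR (- (3 / 2))).
  by rewrite mulr_gt0 ?expR_gt0 ?normal_peak_gt0.
move=> k k1; rewrite abs_tailE; last lra.
rewrite subr0 addr0; have := upper_tail_ge k1; have := upper_tail_ge0 k; lra.
Qed.

Lemma abs_tail0_decay (k s : R) : 0 < k -> 0 <= s ->
  abs_tail 0 (k + s) <= expR (- (s * k)) * abs_tail 0 k.
Proof.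
move=> k0 s0; have ks0 : 0 < k + s by lra.
rewrite !abs_tailE// !subr0 !addr0; have := upper_tail_decay k s0; lra.
Qed.

Lemma abs_tail0_gauss (k : R) : 0 < k ->
  abs_tail 0 k <= 2 * expR (- k ^+ 2 / 2).
Proof.
move=> k0; rewrite abs_tailE// subr0 addr0.
have := upper_tail_gauss (ltW k0); lra.
Qed.

Lemma abs_tail0_gt0 (k : R) : 0 < abs_tail 0 k.
Proof.
apply: (@Nexp_indic_gt0 _ _ (`|k| + 1) (`|k| + 2)).
- exact: measurable_abs_tail.
- lra.
- move=> x /=; rewrite in_itv/= add0r => /andP[kx _].
  have := ler_norm k; have := ler_norm x; lra.
Qed.

(** Half of the excess 4 d L of [q] over 2 L pays for the factor 1 + d, the other half for the terms
    that stay bounded as L grows. It is applied with L = ln n. *)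
Lemma shifted_square_lt (d C h k L q : R) : 0 < d -> 0 < C -> 1 <= k ->
  k ^+ 2 <= 2 * L + h -> (1 + d) * (h + 2 * C + C ^+ 2) / (2 * d) <= L ->
  (2 + 4 * d) * L <= q ->
  (1 + d) * (k + C / k) ^+ 2 <= q.
Proof.
move=> d0 C0 k1 k2 LC Lq; have k0 : 0 < k by lra.
have sk : C / k * k = C by rewrite divfK// gt_eqF.
have s0 : 0 <= C / k by rewrite divr_ge0//; exact: ltW.
have sC : C / k <= C by rewrite ler_pdivrMr// ler_peMr// ltW.
have ss : (C / k) ^+ 2 <= C ^+ 2 by rewrite lerXn2r// nnegrE ltW.
have -> : (k + C / k) ^+ 2 = k ^+ 2 + 2 * (C / k * k) + (C / k) ^+ 2 by ring.
rewrite sk.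
move: LC; rewrite ler_pdivrMr ?mulr_gt0// => LC.
have d10 : 0 <= 1 + d by lra.
have : (1 + d) * (k ^+ 2 + 2 * C + (C / k) ^+ 2) <=
    (1 + d) * (2 * L + (h + 2 * C + C ^+ 2)).
  by rewrite ler_wpM2l//; lra.
lra.
Qed.

(* Moving the critical value from k to k + C / k multiplies both terms of
   probability_pnorm_null_le by at most exp(- C), up to constants. *)
Lemma shifted_null_bound (d c5 B C k q : R) n : 0 < d -> 0 < c5 -> 0 < C ->
  1 <= k -> c5 * (expR (- k ^+ 2 / 2) / k) <= abs_tail 0 k ->
  n%:R * abs_tail 0 k <= B -> (1 + d) * (k + C / k) ^+ 2 <= q ->
  n%:R * (abs_tail 0 (k + C / k) +
    2 * expR (- (k + C / k) ^+ 2 / 2) / (q / (k + C / k) - (k + C / k))) <=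
  expR (- C) * (B * (1 + 2 / (d * c5))).
Proof.
move=> d0 c50 C0 k1 lowG GB kkq; have k0 : 0 < k by lra.
set s := C / k in kkq *.
have sk : s * k = C by rewrite divfK// gt_eqF.
have s0 : 0 < s by rewrite divr_gt0.
pose kk := k + s; rewrite -/kk in kkq *.
have kk0 : 0 < kk by rewrite addr_gt0.
have nr0 : 0 <= n%:R :> R by [].
(* The margin 1 + d keeps the slope in the truncated moment proportional to the threshold, so that
   this term has the size exp(- kk^2 / 2) / kk of a Gaussian tail. *)
have gap : d * kk <= q / kk - kk.
  suff : (1 + d) * kk <= q / kk by clear -R; lra.
  by rewrite ler_pdivlMr// -mulrA -expr2.
have T1 : n%:R * abs_tail 0 kk <= expR (- C) * B.
  have := abs_tail0_decay k0 (ltW s0); rewrite sk -/kk => H.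
  apply: (le_trans (ler_wpM2l nr0 H)).
  by rewrite mulrCA ler_wpM2l ?expR_ge0.
have T2 : expR (- kk ^+ 2 / 2) <= expR (- C) * expR (- k ^+ 2 / 2).
  rewrite -expRD ler_expR.
  have -> : kk ^+ 2 = k ^+ 2 + 2 * (s * k) + s ^+ 2 by rewrite /kk; ring.
  by rewrite sk; have := sqr_ge0 s; clear -R; lra.
have dk0 : 0 < d * k by rewrite mulr_gt0.
have T3 : 2 * expR (- kk ^+ 2 / 2) / (q / kk - kk) <=
   2 * (expR (- C) * expR (- k ^+ 2 / 2)) / (d * k).
  apply: ler_pM.
  - by rewrite mulr_ge0 ?expR_ge0.
  - by rewrite invr_ge0; apply: le_trans gap; rewrite mulr_ge0// ltW.
  - by rewrite ler_wpM2l.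
  - rewrite lef_pV2 ?posrE//.
      apply: le_trans gap; rewrite ler_wpM2l//; [exact: ltW|].
      by rewrite /kk lerDl ltW.
    by apply: lt_le_trans gap; rewrite mulr_gt0.
(* The Mills-type lower bound turns the truncated term back into the exceedance probability, whose
   multiple by [n] is at most [B]. *)
have T4 : expR (- k ^+ 2 / 2) / k <= abs_tail 0 k / c5.
  by rewrite ler_pdivlMr// mulrC.
have T5 : n%:R * (2 * (expR (- C) * expR (- k ^+ 2 / 2)) / (d * k)) <=
    expR (- C) * (B * (2 / (d * c5))).
  have -> : n%:R * (2 * (expR (- C) * expR (- k ^+ 2 / 2)) / (d * k)) =
     (2 / d * expR (- C) * n%:R) * (expR (- k ^+ 2 / 2) / k).
    by field; rewrite !gt_eqF.
  have q0 : 0 <= 2 / d * expR (- C) * n%:R.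
    by rewrite !mulr_ge0 ?expR_ge0 ?invr_ge0// ltW.
  apply: (le_trans (ler_wpM2l q0 T4)).
  have -> : 2 / d * expR (- C) * n%:R * (abs_tail 0 k / c5) =
     (2 / (d * c5) * expR (- C)) * (n%:R * abs_tail 0 k).
    by field; rewrite !gt_eqF.
  have -> : expR (- C) * (B * (2 / (d * c5))) = (2 / (d * c5) * expR (- C)) * B.
    by ring.
  apply: ler_wpM2l => //.
  by rewrite !mulr_ge0 ?expR_ge0 ?invr_ge0 ?mulr_ge0//; exact: ltW.
have T6 := ler_wpM2l nr0 T3.
rewrite mulrDr; apply: (le_trans (lerD T1 (le_trans T6 T5))).
by rewrite -mulrDr [B * (1 + _)]mulrDr mulr1.
Qed.

End tail_bounds.

Lemma half_lt_quarter_ge (R : realType) (x l : R) :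
  0 < l -> l / 2 < x -> x <= l / 4 -> False.
Proof. by lra. Qed.

Lemma double_quotient_le (R : realType) (C e k : R) : 0 < e -> 0 < k ->
  4 * C / e <= k -> 2 * (C / k) <= e / 2.
Proof.
by move=> e0 k0; rewrite ler_pdivrMr// mulrA ler_pdivrMr//; lra.
Qed.

(** * Comparison with the supremum norm test *)

Section sup_domination.
Context {disp : measure_display} {T : measurableType disp} {R : realType}.
Context {P : probability T R} {eps : nat -> {RV P >-> R}}.
Hypothesis eps_iid : iid_std_normal eps.
Notation nu := (@normal_prob R 0 1).
Implicit Types (q k : R).

Lemma probability_sup_norm_null n k : 0 < k ->
  P (~` [set w | (k <= pnorm +oo%E (noise eps n w))%R]) =
  ((1 - abs_tail 0 k) ^+ n)%:E.
Proof.
move=> k0; under eq_set do rewrite noise0.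
rewrite (probability_sup_norm_lt eps_iid)//; congr EFin.
rewrite (eq_bigr (fun=> 1 - abs_tail 0 k)) => [|i _]; last by rewrite mxE.
by rewrite prodr_const card_ord.
Qed.

(** With G the null exceedance probability of one coordinate, the size is 1 - (1 - G)^n. Size below
    1 bounds n G, through (1 - G)^n <= exp(- n G), and hence forces k to infinity. Positive size
    gives n G >= a / 2, through Bernoulli's inequality, and the Gaussian tail bound then yields
    exp(k^2 / 2) <= 4 n / a. *)
Lemma sup_crit_asymptotics (k : nat -> R) (a : R) : 0 < a < 1 ->
  P [set w | (k n <= pnorm +oo%E (noise eps n w))%R] @[n --> \oo] --> a%:E ->
  exists2 B : R, 0 < B &
  [/\ forall K, \forall n \near \oo, K <= k n,
      \forall n \near \oo, n%:R * abs_tail 0 (k n) <= B &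
      \forall n \near \oo, k n ^+ 2 <= 2 * ln n%:R + 2 * ln (4 / a)].
Proof.
move=> /andP[a0 a1] ka.
pose e0 := (1 - a) / 2.
have e00 : 0 < e0 by rewrite divr_gt0//; lra.
have mk n : measurable [set w | (k n <= pnorm +oo%E (noise eps n w))%R].
  under eq_set do rewrite noise0.
  exact: measurable_reject.
have ae : a < 1 - e0 by rewrite /e0; lra.
have a2 : a / 2 < a by lra.
have k0 : \forall n \near \oo, 0 < k n.
  near=> n; rewrite ltNge; apply/negP => k0.
  have : (P [set w | (k n <= pnorm +oo%E (noise eps n w))%R] < (1 - e0)%:E)%E.
    by near: n; exact: cvge_near_lt ka ae.
  have -> : [set w | (k n <= pnorm +oo%E (noise eps n w))%R] = setT.
    apply/seteqP; split => // w _ /=.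
    exact: le_trans k0 (sup_norm_ge0 _).
  by rewrite probability_setT lte_fin; lra.
have rej n : 0 < k n ->
    P [set w | (k n <= pnorm +oo%E (noise eps n w))%R] =
    (1 - (1 - abs_tail 0 (k n)) ^+ n)%:E.
  move=> kn0; have := probability_sup_norm_null n kn0.
  rewrite probability_setC_fine// => -[H].
  by rewrite -(fineK (fin_num_measure P _ (mk n))) -H; congr EFin; ring.
have bnd : \forall n \near \oo, n%:R * abs_tail 0 (k n) <= e0^-1.
  near=> n.
  have kn0 : 0 < k n by near: n.
  have : (P [set w | (k n <= pnorm +oo%E (noise eps n w))%R] < (1 - e0)%:E)%E.
    by near: n; exact: cvge_near_lt ka ae.
  rewrite rej// lte_fin => H.
  have := @expX_le_expR _ (abs_tail 0 (k n)) n (abs_tail_le1 _ _).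
  set x := n%:R * _ => H2.
  have : x <= expR x by apply: le_trans (expR_ge1Dx _); lra.
  move=> H3; apply: (le_trans H3).
  by rewrite -[expR x]invrK -expRN lef_pV2 ?posrE ?expR_gt0//; lra.
exists e0^-1; first by rewrite invr_gt0.
split => //.
- move=> K; near=> n.
  rewrite leNgt; apply/negP => kK.
  have H1 : n%:R * abs_tail 0 (k n) <= e0^-1 by near: n.
  have H2 : abs_tail 0 K <= abs_tail 0 (k n) by apply: abs_tail_le; exact: ltW.
  have H3 : e0^-1 / abs_tail 0 K + 1 <= n%:R by near: n; exact: near_natr_ge.
  have G0 := abs_tail0_gt0 K.
  have : e0^-1 / abs_tail 0 K * abs_tail 0 K = e0^-1 by rewrite divfK// gt_eqF.
  have : n%:R * abs_tail 0 K <= n%:R * abs_tail 0 (k n) by rewrite ler_wpM2l.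
  have := ler_wpM2r (ltW G0) H3; lra.
- near=> n.
  have n0 : (0 < n)%N by near: n; exact: nbhs_infty_gt.
  have nr0 : 0 < n%:R :> R by rewrite ltr0n.
  have kn0 : 0 < k n by near: n.
  have : ((a / 2)%:E < P [set w | (k n <= pnorm +oo%E (noise eps n w))%R])%E.
    by near: n; exact: cvge_near_gt ka a2.
  rewrite rej// lte_fin => H.
  have G01 : 0 <= abs_tail 0 (k n) <= 1 by rewrite abs_tail_ge0 abs_tail_le1.
  have H2 := bernoulli_le n G01.
  have H3 := ler_wpM2l (ltW nr0) (abs_tail0_gauss kn0).
  have H4 : expR (k n ^+ 2 / 2) <= n%:R * (4 / a).
    have E : expR (- k n ^+ 2 / 2) * expR (k n ^+ 2 / 2) = 1.
      by rewrite -expRD mulNr addNr expR0.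
    have H5 : a / 2 <= n%:R * (2 * expR (- k n ^+ 2 / 2)) by lra.
    have := ler_wpM2r (expR_ge0 (k n ^+ 2 / 2)) H5.
    move: E; set x := expR (- _ / 2); set y := expR (k n ^+ 2 / 2) => E.
    have -> : n%:R * (2 * x) * y = 2 * n%:R * (x * y) by ring.
    by rewrite E mulr1 => H6; rewrite mulrA ler_pdivlMr//; lra.
  have a40 : 0 < 4 / a by rewrite divr_gt0.
  rewrite -mulrDr -lnM ?posrE// -ler_pdivrMl// mulrC.
  rewrite -[leLHS]expRK ler_ln ?posrE ?expR_gt0//.
  by rewrite mulr_gt0.
Unshelve. all: by end_near. Qed.

Lemma sup_norm_dominates (pi k k' a' : nat -> R) (a l lam : R) (t : array R) :
  0 < a < 1 -> 0 < l -> 2 < lam ->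
  (\forall n \near \oo, lam <= pi n / ln n%:R) ->
  P [set w | (k n <= pnorm +oo%E (noise eps n w))%R] @[n --> \oo] --> a%:E ->
  a' n @[n --> \oo] --> l ->
  (\forall n \near \oo,
     P [set w | (k' n <= pnorm (pi n)%:E (noise eps n w))%R] = (a' n)%:E) ->
  P [set w | (k n <= pnorm +oo%E (t n + noise eps n w))%R] @[n --> \oo] --> 1%E ->
  forall e, 0 < e -> \forall n \near \oo,
    (P (~` [set w | (k' n <= pnorm (pi n)%:E (t n + noise eps n w))%R]) <= e%:E)%E.
Proof.
move=> a01 l0 lam2 pilam ka al ka' kt e e0.
have a0 : 0 < a by have /andP[] := a01.
have [B B0 [klarge kB ksqr]] := sup_crit_asymptotics a01 ka.
have [c5 c50 lowG] := @abs_tail0_ge R.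
(* So that [lam] is 2 + 4 d. *)
pose d := (lam - 2) / 4.
have d0 : 0 < d by rewrite divr_gt0//; lra.
pose D := B * (1 + 2 / (d * c5)).
have D0 : 0 < D by rewrite mulr_gt0// addr_gt0// divr_gt0// mulr_gt0.
(* By C <= exp C this gives exp(- C) D <= l / 4, which keeps the null probability of reaching the
   shifted threshold below the eventual lower bound l / 2 of [a' n]. *)
pose C := 4 * D / l.
have C0 : 0 < C by rewrite divr_gt0// mulr_gt0.
have eC : expR (- C) * D <= l / 4.
  have : C <= expR C by apply: le_trans (expR_ge1Dx _); lra.
  rewrite expRN => Ce; rewrite mulrC ler_pdivrMr ?expR_gt0//.
  have : l * C = 4 * D by rewrite mulrC divfK// gt_eqF.
  have := ler_wpM2l (ltW l0) Ce; lra.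
have [c c0 shiftG] := abs_tail_shift_ge (ltW C0).
have [rho rho0 prodH] := prod_one_sub_transfer c0 e0.
pose C4 := 2 * ln (4 / a) + 2 * C + C ^+ 2.
near=> n.
have n0 : (0 < n)%N by near: n; exact: nbhs_infty_gt.
have nr0 : 0 <= n%:R :> R by [].
have k1 : 1 <= k n by near: n; exact: klarge.
(* Makes the additive loss 2 C / k at most e / 2, the slack allowed by [prodH]. *)
have kCe : 4 * C / e <= k n by near: n; exact: klarge.
have GB : n%:R * abs_tail 0 (k n) <= B by near: n; exact: kB.
have k2 : k n ^+ 2 <= 2 * ln n%:R + 2 * ln (4 / a) by near: n; exact: ksqr.
have L1 : 1 <= ln n%:R :> R by near: n; exact: near_ln_ge.
have LC : (1 + d) * C4 / (2 * d) <= ln n%:R by near: n; exact: near_ln_ge.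
have pin : lam <= pi n / ln n%:R by near: n.
have an : l / 2 < a' n by near: n; apply: (cvgr_gt _ al); lra.
have k'n : P [set w | (k' n <= pnorm (pi n)%:E (noise eps n w))%R] = (a' n)%:E.
  by near: n.
have kn0 : 0 < k n by apply: lt_le_trans k1.
pose s := C / k n.
have s0 : 0 < s by rewrite divr_gt0.
pose kk := k n + s.
have kk0 : 0 < kk by rewrite addr_gt0.
have pikk : (1 + d) * kk ^+ 2 <= pi n.
  apply: shifted_square_lt k2 LC _ => //.
  rewrite (_ : 2 + 4 * d = lam); last by rewrite /d; field.
  by rewrite -ler_pdivlMr//; apply: lt_le_trans L1.
have kksq0 : 0 < kk ^+ 2 by rewrite exprn_gt0.
have kkpi : kk ^+ 2 < pi n.
  apply: lt_le_trans pikk; rewrite ltr_pMl//.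
  by rewrite ltrDl.
have pi0 : 0 < pi n by apply: lt_trans kkpi.
have nullk : n%:R * (abs_tail 0 kk + 2 * expR (- kk ^+ 2 / 2) / (pi n / kk - kk)) <= l / 4.
  apply: (le_trans _ eC); apply: shifted_null_bound => //.
  exact: lowG.
have mpk (t' : 'rV[R]_n) (x : R) : measurable [set w | (x <= pnorm (pi n)%:E (t' + noise eps n w))%R].
  exact: measurable_reject.
(* A critical value of at least [kk] would have null rejection probability at most l / 4, but it is
   [a' n], larger than l / 2. *)
have k'kk : k' n < kk.
  rewrite ltNge; apply/negP => kkk'.
  have := probability_pnorm_null_le eps_iid n kk0 kkpi.
  have : (P [set w | (k' n <= pnorm (pi n)%:E (noise eps n w))%R] <=
      P [set w | (kk <= pnorm (pi n)%:E (noise eps n w))%R])%E.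
    apply: le_measure; rewrite ?inE.
    - by under eq_set do rewrite noise0; exact: mpk.
    - by under eq_set do rewrite noise0; exact: mpk.
    - by move=> w /=; exact: le_trans.
  rewrite k'n => H1 H2; have := le_trans H1 H2.
  rewrite lee_fin => H3.
  exact: half_lt_quarter_ge l0 an (le_trans H3 nullk).
have ktn : ((1 - rho)%:E < P [set w | (k n <= pnorm +oo%E (t n + noise eps n w))%R])%E.
  near: n; apply: (cvge_near_gt kt); lra.
have ms (x : R) : measurable [set w | (x <= pnorm +oo%E (t n + noise eps n w))%R].
  exact: measurable_reject.
have prodrho : \prod_(i < n) (1 - abs_tail (t n 0 i) (k n)) <= rho.
  have := probability_sup_norm_lt eps_iid (t n) kn0.
  rewrite probability_setC_fine// => -[<-].
  move: ktn; rewrite -(fineK (fin_num_measure P _ (ms (k n)))) lte_fin.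
  by rewrite ltrBlDl lerBlDr => /ltW.
have final : \prod_(i < n) (1 - abs_tail (t n 0 i) kk) <= e.
  apply: (prodH n (fun i => abs_tail (t n 0 i) (k n)) _ (2 * s)) => //.
  - by move=> i; rewrite abs_tail_ge0 abs_tail_le1.
  - by move=> i; rewrite abs_tail_ge0 abs_tail_le1.
  - by move=> i; exact: shiftG.
  - by move=> i; apply: abs_tail_lipschitz => //; exact: ltW.
  - exact: double_quotient_le.
(* The supremum norm is at most the norm of exponent [pi n] and [k' n < kk], so acceptance by the
   latter test forces the supremum norm below [kk]. *)
apply: (@le_trans _ _ (P (~` [set w | (kk <= pnorm +oo%E (t n + noise eps n w))%R]))).
  apply: le_measure; rewrite ?inE.
  - by apply: measurableC; exact: mpk.
  - by apply: measurableC; exact: ms.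
  - move=> w /= kw kkw; apply: kw.
    apply: le_trans (sup_norm_le_pnorm _ pi0); apply: le_trans kkw; exact: ltW.
by rewrite (probability_sup_norm_lt eps_iid)// lee_fin.
Unshelve. all: by end_near. Qed.

End sup_domination.

(** * Consistency of the combined test *)

Lemma limn_einf_near_ge (R : realType) (u : nat -> R) (b : R) :
  (b%:E < limn_einf (fun n => (u n)%:E))%E ->
  exists2 lam : R, b < lam & \forall n \near \oo, lam <= u n.
Proof.
rewrite limn_einf_lim => bu.
have := ereal_nondecreasing_cvgn (nondecreasing_einfs (fun n => (u n)%:E)).
move=> /cvg_lim E; rewrite E// in bu.
have [_ [N _ <-]] := ereal_sup_gt bu.
rewrite /einfs /= => bN.
have [lam blam lamN] : exists2 lam : R, b < lam &
    (lam%:E <= ereal_inf (sdrop (fun n => (u n)%:E) N))%E.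
  move: bN; case: (ereal_inf _) => [r||] //.
    by rewrite lte_fin => br; exists r.
  by move=> _; exists (b + 1); [lra|rewrite leey].
exists lam => //; exists N => // n /= Nn.
rewrite -lee_fin; apply: le_trans lamN _; apply: ereal_inf_lbound.
by exists n.
Qed.

Lemma max_pnorm_ge (R : realType) (p : nat -> R) (m j : nat) (k : nat -> R)
    (c : R) n (x : 'rV[R]_n) :
  (1 <= j <= m)%N -> 0 < k j -> c <= 1 -> k j <= pnorm (p j)%:E x ->
  c <= \big[Num.max/0]_(1 <= i < m.+1) ((k i)^-1 * pnorm (p i)%:E x).
Proof.
move=> jm k0 c1 kj; apply: (le_trans c1).
rewrite (bigD1_seq j) ?iota_uniq ?mem_index_iota ?ltnS//= le_max; apply/orP; left.
by rewrite mulrC ler_pdivlMr// mul1r.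
Qed.

Section psi.
Context {disp : measure_display} {T : measurableType disp} {R : realType}.
Context {P : probability T R} {eps : nat -> {RV P >-> R}}.
Variables (p : nat -> R) (m : nat -> nat) (kappas : nat -> nat -> R) (c : nat -> R).
Hypothesis kappas_gt0 : forall j d, (0 < d)%N -> (1 <= j <= m d)%N ->
  0 < kappas j d.
Hypothesis c01 : forall d, (0 < d)%N -> 0 < c d <= 1.

(** The constituent [J n] may vary with [n]: it is a fixed index for a finite exponent and the last
    index [m n] for the supremum norm. *)
Lemma max_pnorm_test_consistent (J : nat -> nat) (t : array R) :
  (\forall n \near \oo, (1 <= J n <= m n)%N) ->
  (forall e : R, 0 < e -> \forall n \near \oo,
    (P (~` [set w | (kappas (J n) n <=
       pnorm (p (J n))%:E (t n + noise eps n w))%R]) <= e%:E)%E) ->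
  consistency_set eps (max_pnorm_test p m kappas c) t.
Proof.
move=> Jm H; rewrite /consistency_set/=.
pose A n := [set w | c n <= \big[Num.max/0]_(1 <= j < (m n).+1)
  ((kappas j n)^-1 * pnorm (p j)%:E (t n + noise eps n w))].
have mA n : measurable (A n).
  apply: measurable_set_ge; apply: (measurable_max_pnorm _ _ (kappas ^~ n)) => i.
  exact: measurable_noise.
rewrite (_ : (fun _ => _) = (fun n => P (A n))); last first.
  by apply/funext => n; rewrite expectation_bool//; exact: mA.
apply: probability_cvg1 => // e e0; near=> n.
have n0 : (0 < n)%N by near: n; exact: nbhs_infty_gt.
have Jn : (1 <= J n <= m n)%N by near: n.
apply: (@le_trans _ _ (P (~` [set w | (kappas (J n) n <=
       pnorm (p (J n))%:E (t n + noise eps n w))%R]))); last by near: n; exact: H.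
apply: le_measure; rewrite ?inE.
- exact: measurableC.
- by apply: measurableC; exact: measurable_reject.
- move=> w /= nA kw; apply: nA; rewrite /A/=.
  apply: (@max_pnorm_ge _ p _ (J n) (kappas ^~ n)) => //; first exact: kappas_gt0.
  by have /andP[] := c01 n0.
Unshelve. all: by end_near. Qed.

Lemma consistency_set_pnormE (q : \bar R) (k : nat -> R) (t : array R) :
  consistency_set eps (pnorm_test q k) t ->
  P [set w | (k n <= pnorm q (t n + noise eps n w))%R] @[n --> \oo] --> 1%E.
Proof.
rewrite /consistency_set/=; rewrite (_ : (fun _ => _) = (fun n =>
  P [set w | (k n <= pnorm q (t n + noise eps n w))%R]))//.
by apply/funext => n; exact: pnorm_test_expectation.
Qed.

Lemma tests_of_size_pnormE (q : \bar R) (k : nat -> R) (a : R) :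
  tests_of_size eps a (pnorm_test q k) ->
  P [set w | (k n <= pnorm q (noise eps n w))%R] @[n --> \oo] --> a%:E.
Proof.
case=> _; rewrite (_ : (fun _ => _) = (fun n =>
  P [set w | (k n <= pnorm q (noise eps n w))%R]))//.
apply/funext => n; under eq_set do rewrite noise0.
rewrite -pnorm_test_expectation.
by congr expectation; apply/funext => w; rewrite -noise0.
Qed.

End psi.

Theorem theorem5p1 (disp : measure_display) (T : measurableType disp)
  (R : realType) (P : probability T R) (eps : nat -> {RV P >-> R})
  (eps_iid : iid_std_normal eps)
  (p : nat -> R)
  (p_gt0 : forall j, (0 < j)%N -> 0 < p j)
  (p_incr : forall i j, (0 < i)%N -> (i < j)%N -> p i < p j)
  (p_unbounded : forall B : R, exists2 j, (0 < j)%N & B < p j)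
  (m : nat -> nat)
  (m_gt0 : forall d, (0 < d)%N -> (0 < m d)%N)
  (m_nondecr : forall d e, (0 < d)%N -> (d <= e)%N -> (m d <= m e)%N)
  (m_unbounded : forall B : nat, exists2 d, (0 < d)%N & (B < m d)%N)
  (alpha : R) (alpha01 : 0 < alpha < 1)
  (alphas : nat -> nat -> R)
  (alphas01 : forall j d, (0 < d)%N -> (1 <= j <= m d)%N ->
     0 < alphas j d < 1)
  (M : set nat)
  (M_gt0 : forall j, M j -> (0 < j)%N)
  (M_unbounded : forall B : nat, exists2 j, M j & (B < j)%N)
  (sum_alphas : forall d, (0 < d)%N ->
     \sum_(1 <= j < (m d).+1) alphas j d = alpha)
  (lim_alphas_m : exists2 l : R, 0 < l &
     alphas (m d) d @[d --> \oo] --> l)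
  (lim_alphas_M : forall j, M j -> exists2 l : R, 0 < l &
     alphas j d @[d --> \oo] --> l)
  (kappas : nat -> nat -> R)
  (kappas_gt0 : forall j d, (0 < d)%N -> (1 <= j <= m d)%N -> 0 < kappas j d)
  (kappas_size : forall j d, (0 < d)%N -> (1 <= j <= m d)%N ->
     P [set w | kappas j d <= pnorm (p j)%:E (noise eps d w)] =
     (alphas j d)%:E)
  (c : nat -> R)
  (c01 : forall d, (0 < d)%N -> 0 < c d <= 1)
  (psi_size : forall d, (0 < d)%N ->
     ('E_P[fun w => (max_pnorm_test p m kappas c d (noise eps d w))%R])%E = alpha%:E) :
  (tests_of_size eps alpha (max_pnorm_test p m kappas c) /\
   forall (q : R) (kappa : nat -> R), 0 < q ->
     tests_of_size eps alpha (pnorm_test q%:E kappa) ->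
     consistency_set eps (pnorm_test q%:E kappa) `<=`
     consistency_set eps (max_pnorm_test p m kappas c)) /\
  ((2%:E < limn_einf (fun d => (p (m d) / ln d%:R)%:E))%E ->
   forall kappa : nat -> R,
     tests_of_size eps alpha (pnorm_test +oo%E kappa) ->
     consistency_set eps (pnorm_test +oo%E kappa) `<=`
     consistency_set eps (max_pnorm_test p m kappas c)).
Proof.
have a1 : alpha < 1 by have /andP[] := alpha01.
split; first split.
- split; first exact: max_pnorm_test_is_test.
  (* The size equals [alpha] exactly at every positive index; only the junk index 0 has to be
     avoided. *)
  apply: cvg_near_cst; near=> n; apply: psi_size.
  by near: n; exact: nbhs_infty_gt.
- move=> q kappa q0 /tests_of_size_pnormE size t /consistency_set_pnormE cons.
  (* The index [j0] may lie outside [M]; a later element [j] of [M] inherits the bound because [p]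
     is increasing. *)
  have [j0 j00 pj0] := p_unbounded (Num.max (2 * q) 2).
  have [j Mj j0j] := M_unbounded j0.
  have pj : Num.max (2 * q) 2 < p j by apply: lt_trans pj0 (p_incr _ _ _ _).
  move: pj; rewrite gt_max => /andP[pj1 pj2].
  have [l l0 al] := lim_alphas_M j Mj.
  have jm : \forall n \near \oo, (1 <= j <= m n)%N.
    have [d d0 jd] := m_unbounded j.
    near=> n; rewrite M_gt0//=; apply: leq_trans (ltnW jd) (m_nondecr _ _ d0 _).
    by near: n; exact: nbhs_infty_ge.
  apply: (max_pnorm_test_consistent kappas_gt0 c01 (J := fun=> j)) => //.
  apply: (pnorm_dominates eps_iid q0 (ltW pj1) (ltW pj2) a1 l0 size al _ cons).
  near=> n.
  have n0 : (0 < n)%N by near: n; exact: nbhs_infty_gt.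
  have jn : (1 <= j <= m n)%N by near: n.
  by split; [exact: kappas_gt0|exact: kappas_size].
- move=> /limn_einf_near_ge[lam lam2 pm] kappa /tests_of_size_pnormE size t.
  move=> /consistency_set_pnormE cons.
  have [l l0 al] := lim_alphas_m.
  have jm : \forall n \near \oo, (1 <= m n <= m n)%N.
    by near=> n; rewrite m_gt0 ?leqnn//; near: n; exact: nbhs_infty_gt.
  apply: (max_pnorm_test_consistent kappas_gt0 c01 jm).
  apply: (sup_norm_dominates eps_iid (pi := fun n => p (m n)) alpha01 l0 lam2 pm size al _ cons).
  near=> n; apply: kappas_size; last by near: n.
  by near: n; exact: nbhs_infty_gt.
Unshelve. all: by end_near. Qed.
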